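(* Let $\mathfrak g_{\mathrm{af}}$ be an affine Kac--Moody Lie algebra of twisted type and let $\lambda\in P^0_+$. Then the root operators $e_i,f_i$ ($i\in I_{\mathrm{af}}$) together with the maps $\mathrm{wt},\varepsilon_i,\varphi_i$ ($i\in I_{\mathrm{af}}$) defined in the context equip the set $\frac{\infty}{2}\mathrm{LS}(\lambda)$ of semi-infinite Lakshmibai--Seshadri paths of shape $\lambda$ with the structure of a crystal with weight lattice $P_{\mathrm{af}}$ (in particular $e_i,f_i$ map $\frac{\infty}{2}\mathrm{LS}(\lambda)$ into $\frac{\infty}{2}\mathrm{LS}(\lambda)\sqcup\{\boldsymbol 0\}$).
   Context: **Root data.** $\mathfrak g_{\mathrm{af}}$ is an affine Kac--Moody algebra over $\mathbb C$ of twisted type, with generalized Cartan matrix $X_{\mathrm{af}}$, index set $I_{\mathrm{af}}=\{0,1,\dots,\ell\}$, Cartan subalgebra $\mathfrak h_{\mathrm{af}}$, canonical pairing $\langle\cdot,\cdot\rangle:\mathfrak h_{\mathrm{af}}\times\mathfrak h_{\mathrm{af}}^*\to\mathbb C$, simple roots $\alpha_i$, simple coroots $\alpha_i^\vee$, fundamental weights $\Lambda_i$, null root $\delta=\sum a_i\alpha_i$, canonical central element $K=\sum a_i^\vee\alpha_i^\vee$. ''Dual untwisted'' means $X_{\mathrm{af}}$ is $D_{\ell+1}^{(2)},A_{2\ell-1}^{(2)},E_6^{(2)}$ or $D_4^{(3)}$; ''twisted'' means dual untwisted or $A_{2\ell}^{(2)}$. In the dual untwisted types node $0$ is the usual one (removing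 it leaves $B_\ell,C_\ell,F_4,G_2$ respectively); in type $A_{2\ell}^{(2)}$, $\alpha_0$ is the longest simple root, so that removing node $0$ leaves type $B_\ell$ with $\alpha_\ell$ short, $a_0=1$, $a_0^\vee=2$. $I=I_{\mathrm{af}}\setminus\{0\}$, $Q=\bigoplus_{i\in I}\mathbb Z\alpha_i$, $P_{\mathrm{af}}=\bigoplus_{i\in I_{\mathrm{af}}}\mathbb Z\Lambda_i\oplus\mathbb Z\delta$, $W_{\mathrm{af}}=\langle s_i\mid i\in I_{\mathrm{af}}\rangle$, $W=\langle s_i\mid i\in I\rangle$, $\ell(\cdot)$ is the length function. $\Delta_{\mathrm{af}}$ (resp. $\Delta_{\mathrm{af}}^+$) is the set of real (resp. positive real) roots, $\Delta=\Delta_{\mathrm{af}}\cap Q$, $\Delta^+=\Delta\cap\Delta_{\mathrm{af}}^+$; $s_\beta$ and $\beta^\vee$ are the reflection and coroot of $\beta\in\Delta_{\mathrm{af}}$. The level-zero fundamental weights are $\varpi_i=\Lambda_i-a_i^\vee\Lambda_0$ ($i\in I$) if $X_{\mathrm{af}}\ne A_{2\ell}^{(2)}$; if $X_{\mathrm{af}}=A_{2\ell}^{(2)}$, $\varpi_i=\Lambda_i-\Lambda_0$ for $i\neq\ell$ and $\varpi_\ell=2\Lambda_\ell-\Lambda_0$. $P^0_+=\sum_{i\in I}\mathbb Z_{\ge0}\varpi_i$. For $\lambda=\sum_i m_i\varpi_i\in P^0_+$, $J_\lambda=\{i\in I\mid m_i=0\}$. **Translations and semi-infinite length.** Let $\theta_s=\delta-\alpha_0$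 (dual untwisted) or $\theta_s=(\delta-\alpha_0)/2$ (type $A_{2\ell}^{(2)}$). There is an isomorphism $W_{\mathrm{af}}\cong W\ltimes Q$, $s_i\mapsto s_i$ ($i\in I$), $s_0\mapsto s_{\theta_s}t_{-\theta_s}$, where $t_\xi$ denotes the translation by $\xi\in Q$. For $x=wt_\xi$ ($w\in W,\xi\in Q$), $\ell^{\frac\infty2}(x)=\ell(w)+2\langle\rho^\vee,\xi\rangle$, $\rho^\vee=\frac12\sum_{\alpha\in\Delta^+}\alpha^\vee$. **Peterson representatives and graph.** For $J\subset I$ let $Q_J=\bigoplus_{j\in J}\mathbb Z\alpha_j$, $(\Delta_J)_{\mathrm{af}}^+=\{\beta\in\Delta_{\mathrm{af}}^+\mid \beta\in Q_J+\mathbb Z\delta\}$, and $(W^J)_{\mathrm{af}}=\{x\in W_{\mathrm{af}}\mid x\beta\in\Delta_{\mathrm{af}}^+\ \forall\beta\in(\Delta_J)_{\mathrm{af}}^+\}$. The semi-infinite Bruhat graph $\frac\infty2\mathrm{BG}^J$ has vertex set $(W^J)_{\mathrm{af}}$ and edges $x\xrightarrow{\beta}s_\beta x$ for $x,s_\beta x\in(W^J)_{\mathrm{af}}$, $\beta\in\Delta_{\mathrm{af}}^+$, $\ell^{\frac\infty2}(s_\beta x)=\ell^{\frac\infty2}(x)+1$. **Semi-infinite LS paths.** For rational $a\in(0,1]$, an $a$-chain of shape $\lambda$ from $x$ to $y$ is a directed path $x=y_0\xrightarrow{\beta_1}\cdots\xrightarrow{\beta_k}y_k=y$ in $\frac\infty2\mathrm{BG}^{J_\lambda}$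 with $a\langle\beta_m^\vee,y_{m-1}\lambda\rangle\in\mathbb Z$ for all $m$. A semi-infinite LS path of shape $\lambda$ is $\eta=(x_1,\dots,x_s;a_0,\dots,a_s)$ with $x_m\in(W^{J_\lambda})_{\mathrm{af}}$, rationals $0=a_0<a_1<\dots<a_s=1$, such that for $1\le m<s$ there is an $a_m$-chain of shape $\lambda$ of positive length from $x_{m+1}$ to $x_m$. $\frac\infty2\mathrm{LS}(\lambda)$ is the set of these. **Root operators.** For a semi-infinite LS path $\eta=(x_1,\dots,x_s;a_0,\dots,a_s)\in\frac\infty2\mathrm{LS}(\lambda)$ set $\mathrm{wt}(\eta)=\sum_{m=1}^s(a_m-a_{m-1})x_m\lambda\in P_{\mathrm{af}}$, let $\overline\eta(t)=\sum_{k<m}(a_k-a_{k-1})x_k\lambda+(t-a_{m-1})x_m\lambda$ for $a_{m-1}\le t\le a_m$, $H(t)=\langle\alpha_i^\vee,\overline\eta(t)\rangle$, and $m_i=\min_{t\in[0,1]}H(t)$ (a nonpositive integer), for $i\in I_{\mathrm{af}}$. Let $\boldsymbol 0$ be a formal symbol not in $\frac\infty2\mathrm{LS}(\lambda)$, with $e_i\boldsymbol0=f_i\boldsymbol0=\boldsymbol0$. If $m_i=0$, $e_i\eta=\boldsymbol 0$. Otherwise let $t_1=\min\{t\mid H(t)=m_i\}$, $t_0=\max\{t\in[0,t_1]\mid H(t)=m_i+1\}$; $t_1=a_q$ for some $q$, and choose $p\le q$ with $a_{p-1}\le t_0<a_p$; then $e_i\eta=(x_1,\dots,x_p,s_ix_p,\dots,s_ix_q,x_{q+1},\dots,x_s;\,a_0,\dots,a_{p-1},t_0,a_p,\dots,a_q=t_1,\dots,a_s)$,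 where one drops $x_p$ and $a_{p-1}$ if $t_0=a_{p-1}$, and drops $x_{q+1}$ and $a_q$ if $s_ix_q=x_{q+1}$. If $H(1)=m_i$, $f_i\eta=\boldsymbol 0$. Otherwise let $t_0=\max\{t\mid H(t)=m_i\}$, $t_1=\min\{t\in[t_0,1]\mid H(t)=m_i+1\}$; $t_0=a_p$ for some $p$, and choose $q\ge p$ with $a_q<t_1\le a_{q+1}$; then $f_i\eta=(x_1,\dots,x_p,s_ix_{p+1},\dots,s_ix_{q+1},x_{q+1},\dots,x_s;\,a_0,\dots,a_p=t_0,\dots,a_q,t_1,a_{q+1},\dots,a_s)$, where one drops $x_{q+1}$ and $a_{q+1}$ if $t_1=a_{q+1}$, and drops $x_p$ and $a_p$ if $s_ix_{p+1}=x_p$. Set $\varepsilon_i(\eta)=\max\{n\ge0\mid e_i^n\eta\ne\boldsymbol0\}$, $\varphi_i(\eta)=\max\{n\ge0\mid f_i^n\eta\neq\boldsymbol0\}$. *)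

(* Defs.v *)
From HB Require Import structures.
From mathcomp Require Import all_boot all_order all_algebra.
From mathcomp Require Import boolp classical_sets functions cardinality fsbigop.
From mathcomp Require Import reals.

Set Implicit Arguments.
Unset Strict Implicit.
Unset Printing Implicit Defensive.

Import Order.TTheory GRing.Theory Num.Theory.
Local Open Scope classical_set_scope.
Local Open Scope ring_scope.

(* In every case [l] is the rank of the finite part, so that
   I_af = {0, 1, ..., l}. *)
Inductive twisted_type : Type :=
| TwD2 (l : nat)      (* D_{l+1}^(2),  2 <= l *)
| TwA2odd (l : nat)   (* A_{2l-1}^(2), 3 <= l *)
| TwE62               (* E_6^(2) *)
| TwD43               (* D_4^(3) *)
| TwA2even (l : nat). (* A_{2l}^(2),   1 <= l *)

Definition admissible (X : twisted_type) : bool :=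
  match X with
  | TwD2 l => (2 <= l)%N
  | TwA2odd l => (3 <= l)%N
  | TwE62 => true
  | TwD43 => true
  | TwA2even l => (1 <= l)%N
  end.

Definition rank (X : twisted_type) : nat :=
  match X with
  | TwD2 l => l
  | TwA2odd l => l
  | TwE62 => 4
  | TwD43 => 2
  | TwA2even l => l
  end.

(* [cartan X i j] = < alpha_i^vee, alpha_j >; the numbering of the nodes is
     D_{l+1}^(2)   : 0 <= 1 -- 2 -- ... -- l-1 => l
     A_{2l-1}^(2)  : 0 -- 2, 1 -- 2 -- ... -- l-1 <= l
     E_6^(2)       : 0 -- 1 -- 2 <= 3 -- 4
     D_4^(3)       : 0 -- 1 <= 2  (triple bond)
     A_{2l}^(2)    : 0 => 1 -- 2 -- ... -- l-1 => l   (quadruple bond if l = 1)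
   where the arrows point towards the shorter root. *)
Definition cartan (X : twisted_type) (i j : nat) : int :=
  if i == j then 2 else
  match X with
  | TwD2 l =>
      if i.+1 == j then (if i == 0%N then - 2 else - 1)
      else if j.+1 == i then (if i == l then - 2 else - 1)
      else 0
  | TwA2odd l =>
      if ((i == 0) && (j == 2) || (i == 2) && (j == 0))%N then - 1
      else if ((i == 0) || (j == 0))%N then 0
      else if i.+1 == j then (if j == l then - 2 else - 1)
      else if j.+1 == i then - 1
      else 0
  | TwE62 =>
      if i.+1 == j then (if i == 2%N then - 2 else - 1)
      else if j.+1 == i then - 1
      else 0
  | TwD43 =>
      if i.+1 == j then (if i == 1%N then - 3 else - 1)
      else if j.+1 == i then - 1
      else 0
  | TwA2even l =>
      if i.+1 == j then - 1
      else if j.+1 == i then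
        - ((if j == 0%N then 2 else 1) * (if i == l then 2 else 1))
      else 0
  end.

(* The labels a_i, i.e. the positive coprime integers with
   \sum_j cartan i j * a_j = 0. *)
Definition mark (X : twisted_type) (i : nat) : nat :=
  match X with
  | TwD2 l => 1
  | TwA2odd l => if (i <= 1)%N || (i == l) then 1 else 2
  | TwE62 => nth 0 [:: 1; 2; 3; 2; 1] i
  | TwD43 => nth 0 [:: 1; 2; 1] i
  | TwA2even l => if i == 0 then 1 else 2
  end%N.

(* The labels a_i^vee, i.e. the positive coprime integers with
   \sum_i a_i^vee * cartan i j = 0. *)
Definition comark (X : twisted_type) (i : nat) : nat :=
  match X with
  | TwD2 l => if (i == 0) || (i == l) then 1 else 2
  | TwA2odd l => if (i <= 1)%N then 1 else 2
  | TwE62 => nth 0 [:: 1; 2; 3; 4; 2] i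
  | TwD43 => nth 0 [:: 1; 2; 3] i
  | TwA2even l => if i == l then 1 else 2
  end%N.

(* I = I_af \ {0}; [i : Ifin X] is the node [lift ord0 i], of value i.+1. *)
Definition Ifin (X : twisted_type) : Type := 'I_(rank X).
Definition node (X : twisted_type) (i : Ifin X) : 'I_(rank X).+1 := lift ord0 i.

(* Only used on sets having a least (resp. greatest) element. *)
Definition set_min (R : realType) (A : set R) : R :=
  xget 0 [set v | A v /\ lbound A v].
Definition set_max (R : realType) (A : set R) : R :=
  xget 0 [set v | A v /\ ubound A v].

Definition is_integer (R : realType) (v : R) : Prop := exists n : int, v = n%:~R.
Definition is_rational (R : realType) (v : R) : Prop := exists q : rat, v = ratr q.

Section RootDatum.
Context (R : realType) (X : twisted_type).

Local Notation l := (rank X).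
(* The real form R (x) P_af of h_af^*: column vectors of coordinates with
   respect to Lambda_0, ..., Lambda_l, delta.  The dual space is the space of
   row vectors of coordinates with respect to alpha_0^vee, ..., alpha_l^vee, d,
   where < d, alpha_i > = 1 if i = 0 and 0 otherwise, and < d, Lambda_i > = 0. *)
Local Notation hdual := 'cV[R]_l.+2.
Local Notation hsp := 'rV[R]_l.+2.
Local Notation endo := 'M[R]_l.+2.
Local Notation nodes := 'I_l.+1.

Definition pairing (h : hsp) (mu : hdual) : R := (h *m mu) ord0 ord0.

Definition simple_root (i : nodes) : hdual :=
  \col_(j < l.+2) (if (j <= l)%N then (cartan X j i)%:~R
                   else (i == ord0)%:R).
Definition simple_coroot (i : nodes) : hsp := delta_mx ord0 (widen_ord (leqnSn _) i).
Definition fund_weight (i : nodes) : hdual := delta_mx (widen_ord (leqnSn _) i) ord0.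
Definition null_root : hdual := \sum_(i : nodes) (mark X i)%:R *: simple_root i.

Definition Paf : set hdual :=
  [set mu | exists (m : nodes -> int) (n : int),
     mu = \sum_(i : nodes) (m i)%:~R *: fund_weight i + n%:~R *: null_root].

Definition reflection (b : hdual) (bv : hsp) : endo := 1%:M - b *m bv.
Definition simple_refl (i : nodes) : endo :=
  reflection (simple_root i) (simple_coroot i).
Definition word_prod (s : seq nodes) : endo := \prod_(i <- s) simple_refl i.

Definition Waf : set endo := [set x | exists s, x = word_prod s].

Definition weyl_length (x : endo) : nat :=
  xget 0%N [set n | (exists2 s, size s = n & x = word_prod s) /\
                    forall s, x = word_prod s -> (n <= size s)%N].

Definition real_root : set hdual :=
  [set b | exists2 x, Waf x & exists i, b = x *m simple_root i].

Definition pos_real_root : set hdual :=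
  [set b | real_root b /\
     exists c : nodes -> nat, b = \sum_(i : nodes) (c i)%:R *: simple_root i].

(* If b = x alpha_i with x in W_af then b^vee = x alpha_i^vee, where W_af acts
   on h_af contragrediently. *)
Definition coroot (b : hdual) : hsp :=
  xget 0 [set bv | exists2 x, Waf x &
            exists i, b = x *m simple_root i /\ bv = simple_coroot i *m invmx x].

Definition root_refl (b : hdual) : endo := reflection b (coroot b).

Definition QJ (J : {set Ifin X}) : set hdual :=
  [set b | exists c : Ifin X -> int,
     b = \sum_(j in J) (c j)%:~R *: simple_root (node j)].
Definition Qfin : set hdual := QJ [set: Ifin X].

Definition fin_pos_root : set hdual := pos_real_root `&` Qfin.

Definition rho_check : hsp :=
  2^-1 *: \sum_(a \in fin_pos_root) coroot a.

(* s_i |-> s_i for i in I, and s_0 |-> s_(theta_s) t_(- theta_s) ([semi_gen] below),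
   defines an isomorphism W_af ~ W |x Q. *)
Definition theta_s : hdual :=
  match X with
  | TwA2even _ => 2^-1 *: (null_root - simple_root ord0)
  | _ => null_root - simple_root ord0
  end.

(* The pair (w, xi) stands for the element w t_xi of the semidirect product
   W |x Q, so that (w t_xi) (v t_zeta) = w v t_(v^-1 xi + zeta). *)
Definition semi_mul (p q : endo * hdual) : endo * hdual :=
  (p.1 *m q.1, invmx q.1 *m p.2 + q.2).
Definition semi_gen (i : nodes) : endo * hdual :=
  if i == ord0 then (root_refl theta_s, - theta_s) else (simple_refl i, 0).
Definition semi_word (s : seq nodes) : endo * hdual :=
  foldr (fun i p => semi_mul (semi_gen i) p) (1%:M, 0) s.

(* The image of x in W |x Q; it does not depend on the word s. *)
Definition semi_decomp (x : endo) : endo * hdual :=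
  xget (1%:M, 0) [set p | exists2 s, x = word_prod s & p = semi_word s].

Definition semi_inf_length (x : endo) : R :=
  let p := semi_decomp x in
  (weyl_length p.1)%:R + 2 * pairing rho_check p.2.

Definition DeltaJ_af_pos (J : {set Ifin X}) : set hdual :=
  [set b | pos_real_root b /\
     exists2 g, QJ J g & exists n : int, b = g + n%:~R *: null_root].

Definition WJaf (J : {set Ifin X}) : set endo :=
  [set x | Waf x /\ forall b, DeltaJ_af_pos J b -> pos_real_root (x *m b)].

Definition siBG_edge (J : {set Ifin X}) (x : endo) (b : hdual) (y : endo) : Prop :=
  [/\ WJaf J x, WJaf J y, pos_real_root b, y = root_refl b *m x &
      semi_inf_length y = semi_inf_length x + 1].

Definition varpi (i : Ifin X) : hdual :=
  match X with
  | TwA2even n =>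
      (if (node i : nat) == n then 2 else 1) *: fund_weight (node i)
      - fund_weight ord0
  | _ => fund_weight (node i) - (comark X (node i))%:R *: fund_weight ord0
  end.

(* An element of P^0_+ is given by its coefficients m on the varpi_i. *)
Definition level0_weight (m : Ifin X -> nat) : hdual :=
  \sum_(i : Ifin X) (m i)%:R *: varpi i.
Definition Jset (m : Ifin X -> nat) : {set Ifin X} := [set i : Ifin X | m i == 0%N].

(* [achain m a x bs y]: the sequence bs of labels is an a-chain of shape
   level0_weight m from x to y, of length size bs. *)
Fixpoint achain (m : Ifin X -> nat) (a : R) (x : endo) (bs : seq hdual) (y : endo)
    : Prop :=
  match bs with
  | [::] => WJaf (Jset m) x /\ x = y
  | b :: bs' =>
      let z := root_refl b *m x in
      [/\ siBG_edge (Jset m) x b z,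
          is_integer (a * pairing (coroot b) (x *m level0_weight m)) &
          achain m a z bs' y]
  end.

(* (x_1, ..., x_s ; a_0, ..., a_s); with 0-based indices x_k is
   [nth 1%:M xs k.-1] and a_k is [as`_k]. *)
Record prepath := Prepath { dirs : seq endo; times : seq R }.

Definition is_siLS (m : Ifin X -> nat) (eta : prepath) : Prop :=
  let xs := dirs eta in
  let ts := times eta in
  let s := size xs in
  [/\ size ts = s.+1,
      forall k, (k < s)%N -> WJaf (Jset m) (nth 1%:M xs k),
      forall k, (k <= s)%N -> is_rational ts`_k,
      [/\ ts`_0 = 0, ts`_s = 1 & forall k, (k < s)%N -> ts`_k < ts`_k.+1] &
      forall k, (0 < k < s)%N ->
        exists2 bs, (0 < size bs)%N &
          achain m ts`_k (nth 1%:M xs k) bs (nth 1%:M xs k.-1)].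

Definition siLS (m : Ifin X -> nat) : Type := {eta : prepath | is_siLS m eta}.

Definition path_wt (m : Ifin X -> nat) (eta : prepath) : hdual :=
  \sum_(k < size (dirs eta))
    ((times eta)`_k.+1 - (times eta)`_k)
      *: (nth 1%:M (dirs eta) k *m level0_weight m).

(* k is the first index with t <= a_(k+1). *)
Definition path_at (m : Ifin X -> nat) (eta : prepath) (t : R) : hdual :=
  let xs := dirs eta in
  let ts := times eta in
  let k := find (fun a => t <= a) (behead ts) in
  \sum_(j < k) (ts`_j.+1 - ts`_j) *: (nth 1%:M xs j *m level0_weight m)
  + (t - ts`_k) *: (nth 1%:M xs k *m level0_weight m).

Definition Hfun (m : Ifin X -> nat) (i : nodes) (eta : prepath) (t : R) : R :=
  pairing (simple_coroot i) (path_at m eta t).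

Definition Hmin (m : Ifin X -> nat) (i : nodes) (eta : prepath) : R :=
  set_min [set v | exists2 t, 0 <= t <= 1 & v = Hfun m i eta t].

(* [None] is the formal symbol 0. *)
Definition e_raw (m : Ifin X -> nat) (i : nodes) (eta : prepath) : option prepath :=
  let H := Hfun m i eta in
  let mi := Hmin m i eta in
  let xs := dirs eta in
  let ts := times eta in
  let x k := nth 1%:M xs k.-1 in
  let si := simple_refl i in
  if mi == 0 then None else
  let t1 := set_min [set t | 0 <= t <= 1 /\ H t = mi] in
  let t0 := set_max [set t | 0 <= t <= t1 /\ H t = mi + 1] in
  let q := index t1 ts in                  (* t1 = a_q *)
  let p := find (fun a => t0 < a) ts in    (* a_(p-1) <= t0 < a_p *)
  let drop_p := t0 == ts`_p.-1 in
  let drop_q := (q < size xs)%N && (si *m x q == x q.+1) in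
  Some (Prepath
    (take (if drop_p then p.-1 else p) xs
       ++ [seq si *m z | z <- drop p.-1 (take q xs)]
       ++ drop (if drop_q then q.+1 else q) xs)
    (take (if drop_p then p.-1 else p) ts
       ++ t0 :: drop p (take (if drop_q then q else q.+1) ts)
       ++ drop q.+1 ts)).

Definition f_raw (m : Ifin X -> nat) (i : nodes) (eta : prepath) : option prepath :=
  let H := Hfun m i eta in
  let mi := Hmin m i eta in
  let xs := dirs eta in
  let ts := times eta in
  let x k := nth 1%:M xs k.-1 in
  let si := simple_refl i in
  if H 1 == mi then None else
  let t0 := set_max [set t | 0 <= t <= 1 /\ H t = mi] in
  let t1 := set_min [set t | t0 <= t <= 1 /\ H t = mi + 1] in
  let p := index t0 ts in                           (* t0 = a_p *)
  let q := (find (fun a => (t1 <= a)%R) ts).-1 in   (* a_q < t1 <= a_(q+1) *)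
  let drop_q := t1 == ts`_q.+1 in
  let drop_p := (0 < p)%N && (si *m x p.+1 == x p) in
  Some (Prepath
    (take (if drop_p then p.-1 else p) xs
       ++ [seq si *m z | z <- drop p (take q.+1 xs)]
       ++ drop (if drop_q then q.+1 else q) xs)
    (take (if drop_p then p else p.+1) ts
       ++ drop p.+1 (take q.+1 ts)
       ++ t1 :: drop (if drop_q then q.+2 else q.+1) ts)).

(* [None : option B] is the formal symbol 0 and [None : option int] is
   -oo. *)
Record is_crystal (B : Type) (wt : B -> hdual) (eps phi : nodes -> B -> option int)
    (e f : nodes -> B -> option B) : Prop := IsCrystal {
  crystal_wt_lattice : forall b, Paf (wt b);
  crystal_phi_eps : forall i b,
    match eps i b, phi i b with
    | Some u, Some v => v%:~R = u%:~R + pairing (simple_coroot i) (wt b)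
    | None, None => True
    | _, _ => False
    end;
  crystal_e : forall i b b', e i b = Some b' ->
    [/\ wt b' = wt b + simple_root i,
        eps i b' = omap (fun u => u - 1) (eps i b) &
        phi i b' = omap (fun u => u + 1) (phi i b)];
  crystal_f : forall i b b', f i b = Some b' ->
    [/\ wt b' = wt b - simple_root i,
        eps i b' = omap (fun u => u + 1) (eps i b) &
        phi i b' = omap (fun u => u - 1) (phi i b)];
  crystal_ef : forall i b b', f i b = Some b' <-> e i b' = Some b;
  crystal_ninfty : forall i b, phi i b = None -> e i b = None /\ f i b = None
}.

(* n = max {k | g^k b <> 0}, where g 0 = 0. *)
Definition is_max_iter (B : Type) (g : B -> option B) (b : B) (n : nat) : Prop :=
  iter n (obind g) (Some b) <> None /\
  forall k, iter k (obind g) (Some b) <> None -> (k <= n)%N.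

End RootDatum.

(* Main.v *)
(** The semi-infinite length of [x] is the sum over the positive roots [b] of the
    finite part of integers [chi x b].  For a Peterson representative the roots
    orthogonal to lambda contribute nothing, so the semi-infinite length equals a sum
    [wlen] which only depends on the coset of [x] modulo the stabilizer of lambda.
    A simple reflection s_i changes [wlen x] by the sign of
    [< alpha_i^vee, x lambda >], and the reflection in a positive real root b with
    [< b^vee, x lambda > > 0] strictly increases it.  Consequently, in the
    semi-infinite Bruhat graph an edge along which [x |-> < alpha_i^vee, x lambda >]
    drops from a nonnegative to a nonpositive value, not both zero, is labelled by
    alpha_i, and s_i maps an edge whose ends have values of the same nonzero sign to
    an edge.  Hence s_i reflects a-chains, or shortens them at one end.

    A path on which H has a nonzero minimum is a concatenation A B C, where H descends
    by one to its minimum along B; e_i replaces B by s_i B, and f_i undoes this.  Both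
    operators thus exchange the "low" path A B C and the "high" path A (s_i B) C, up
    to merging equal adjacent directions. *)

Require Import Defs.
From HB Require Import structures.
From mathcomp Require Import all_boot all_order all_algebra.
From mathcomp Require Import boolp classical_sets functions cardinality fsbigop.
From mathcomp Require Import reals.
From mathcomp Require Import ring lra zify.

Set Implicit Arguments.
Unset Strict Implicit.
Unset Printing Implicit Defensive.

Import Order.TTheory GRing.Theory Num.Theory.
Local Open Scope ring_scope.

(** All types are treated at once: only the Cartan matrix, the marks, the half norms and an integer
    [k] enter, where k theta_s = delta - alpha_0, so that [k] is 2 in type A_2l^(2) and 1 otherwise.
    The facts about real roots, beginning with the dichotomy between positive and negative ones, are
    deduced from the semidefinite invariant form.

    The obstacle in the edge argument is that s_i x need not be a Peterson representative when
    alpha_i^vee vanishes on x lambda, so that its semi-infinite length cannot be compared with that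
    of the other vertices. This is why [wlen] is defined on all words.

    The decomposition A B C exists because local minima of H are integers: there the slope changes
    sign along an a-chain, some edge of that chain is labelled alpha_i, and the integrality
    condition of this edge makes H integral. Hence H cannot turn back strictly between two
    consecutive integer levels next to its minimum. The same integrality makes the new break points
    rational and permits the additional alpha_i edge at one end of the reflected part. *)

Lemma int_gt0_ge1 (R : realType) (x : R) : x \is a Num.int -> 0 < x -> 1 <= x.
Proof. by move=> /intrP [z ->]; rewrite ltr0z ler1z; lia. Qed.

(** * Affine root systems and the semi-infinite length of a word *)

Section AffineCartan.
Context (R : realType) (n : nat).
Local Notation vec := 'cV[R]_n.+1.
Local Notation nodes := 'I_n.+1.

(* The [a i] are the marks, the [d i] half the squared lengths of the simple roots, and
   [k] is the integer such that [k theta_s = delta - alpha_0]. *)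
Record affine_cartan (A : nodes -> nodes -> R) (d a : nodes -> R) (k : R) : Prop :=
  AffineCartan {
  ac_int : forall i j, A i j \is a Num.int;
  ac_diag : forall i, A i i = 2;
  ac_off : forall i j, i != j -> A i j <= 0;
  ac_dint : forall i, d i \is a Num.int;
  ac_d1 : forall i, 1 <= d i;
  ac_sym : forall i j, d i * A i j = d j * A j i;
  ac_agt0 : forall i, 0 < a i;
  ac_a0 : a ord0 = 1;
  ac_ker : forall i, \sum_j A i j * a j = 0;
  ac_conn : forall y : nodes -> R,
    (forall i j, A i j != 0 -> y i = y j) -> forall i, y i = y ord0;
  ac_kint : k \is a Num.int;
  ac_kgt0 : 0 < k;
  ac_d0 : d ord0 = k ^+ 2;
  ac_ak : forall i, i != ord0 -> a i / k \is a Num.int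
}.

Context (A : nodes -> nodes -> R) (d a : nodes -> R) (k : R).
Hypothesis H : affine_cartan A d a k.

(** * The invariant form, simple reflections and words *)

Definition cpair (i : nodes) (v : vec) : R := \sum_j A i j * v j 0.
Definition form (u v : vec) : R := \sum_i u i 0 * (d i * cpair i v).
Definition bas (i : nodes) : vec := delta_mx i 0.
Definition srefl (i : nodes) (v : vec) : vec := v - cpair i v *: bas i.
(** Weyl group elements are handled as words; [word_prod_act] shows later that the action only
    depends on the matrix of the word. *)
Definition act (s : seq nodes) (v : vec) : vec := foldr srefl v s.
Definition delta : vec := \col_i a i.
Definition ht (v : vec) : R := \sum_i v i 0.
Definition root (b : vec) : Prop := exists s i, b = act s (bas i).
Definition posv (v : vec) : Prop := forall i, 0 <= v i 0.
Definition intv (v : vec) : Prop := forall i, v i 0 \is a Num.int.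

Lemma basE i j : bas i j 0 = (j == i)%:R.
Proof. by rewrite mxE eqxx andbT. Qed.

Lemma cpairD i u v : cpair i (u + v) = cpair i u + cpair i v.
Proof. by rewrite -big_split /=; apply: eq_bigr => j _; rewrite mxE mulrDr. Qed.
Lemma cpairZ i c v : cpair i (c *: v) = c * cpair i v.
Proof. by rewrite mulr_sumr; apply: eq_bigr => j _; rewrite mxE mulrCA. Qed.
Lemma cpairN i v : cpair i (- v) = - cpair i v.
Proof. by rewrite -scaleN1r cpairZ mulN1r. Qed.
Lemma cpairB i u v : cpair i (u - v) = cpair i u - cpair i v.
Proof. by rewrite cpairD cpairN. Qed.
Lemma cpair_bas i j : cpair i (bas j) = A i j.
Proof.
rewrite /cpair (bigD1 j) //= basE eqxx mulr1 big1 ?addr0 // => m mj.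
by rewrite basE (negbTE mj) mulr0.
Qed.
Lemma cpair_delta i : cpair i delta = 0.
Proof. by rewrite /cpair -[RHS](ac_ker H i); apply: eq_bigr => j _; rewrite mxE. Qed.
Lemma cpair_int i v : intv v -> cpair i v \is a Num.int.
Proof. by move=> vi; apply: rpred_sum => j _; apply: rpredM => //; exact: (ac_int H _ _). Qed.

Lemma formDl u v w : form (u + v) w = form u w + form v w.
Proof. by rewrite -big_split /=; apply: eq_bigr => j _; rewrite mxE mulrDl. Qed.
Lemma formZl c u v : form (c *: u) v = c * form u v.
Proof. by rewrite mulr_sumr; apply: eq_bigr => j _; rewrite mxE -mulrA. Qed.
Lemma formNl u v : form (- u) v = - form u v.
Proof. by rewrite -scaleN1r formZl mulN1r. Qed.
Lemma formBl u v w : form (u - v) w = form u w - form v w.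
Proof. by rewrite formDl formNl. Qed.
Lemma formC u v : form u v = form v u.
Proof.
rewrite /form /cpair.
under eq_bigr do rewrite mulr_sumr mulr_sumr.
under [RHS]eq_bigr do rewrite mulr_sumr mulr_sumr.
rewrite exchange_big; apply: eq_bigr => i _; apply: eq_bigr => j _.
by rewrite [d j * _]mulrA (ac_sym H j i); ring.
Qed.
Lemma formDr u v w : form w (u + v) = form w u + form w v.
Proof. by rewrite formC formDl !(formC w). Qed.
Lemma formZr c u v : form u (c *: v) = c * form u v.
Proof. by rewrite formC formZl formC. Qed.
Lemma formNr u v : form u (- v) = - form u v.
Proof. by rewrite formC formNl formC. Qed.
Lemma formBr u v w : form w (u - v) = form w u - form w v.
Proof. by rewrite formDr formNr. Qed.
Lemma form_basl i v : form (bas i) v = d i * cpair i v.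
Proof.
rewrite /form (bigD1 i) //= basE eqxx mul1r big1 ?addr0 // => j ji.
by rewrite basE (negbTE ji) mul0r.
Qed.
Lemma form_deltal v : form delta v = 0.
Proof. by rewrite formC /form big1 // => i _; rewrite cpair_delta !mulr0. Qed.
Lemma form_deltar v : form v delta = 0.
Proof. by rewrite formC form_deltal. Qed.
Lemma form_int u v : intv u -> intv v -> form u v \is a Num.int.
Proof.
move=> ui vi; apply: rpred_sum => i _; apply: rpredM => //.
by apply: rpredM; [exact: (ac_dint H _) | exact: cpair_int].
Qed.
Lemma d_gt0 i : 0 < d i.
Proof. by apply: lt_le_trans (ac_d1 H i); rewrite ltr01. Qed.
Lemma d_neq0 i : d i != 0. Proof. by rewrite gt_eqF ?d_gt0. Qed.
Lemma form_bas_norm i : form (bas i) (bas i) = 2 * d i.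
Proof. by rewrite form_basl cpair_bas (ac_diag H) mulrC. Qed.

Lemma sreflD i u v : srefl i (u + v) = srefl i u + srefl i v.
Proof. by rewrite /srefl cpairD scalerDl opprD addrACA. Qed.
Lemma sreflZ i c u : srefl i (c *: u) = c *: srefl i u.
Proof. by rewrite /srefl cpairZ scalerBr scalerA. Qed.
Lemma sreflK i : involutive (srefl i).
Proof.
move=> v; rewrite /srefl cpairB cpairZ cpair_bas (ac_diag H).
by rewrite -addrA -opprD -scalerDl (_ : _ + (_ - _) = 0 :> R) ?scale0r ?subr0 //; ring.
Qed.
Lemma srefl_delta i : srefl i delta = delta.
Proof. by rewrite /srefl cpair_delta scale0r subr0. Qed.
Lemma form_srefl i u v : form (srefl i u) (srefl i v) = form u v.
Proof.
rewrite /srefl formBl !formBr !formZl !formZr form_bas_norm (formC u (bas i)) !form_basl.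
by ring.
Qed.
Lemma srefl_bas i : srefl i (bas i) = - bas i.
Proof. by rewrite /srefl cpair_bas (ac_diag H) scaler_nat mulr2n opprD addrA subrr add0r. Qed.
Lemma srefl_coord i v j : j != i -> srefl i v j 0 = v j 0.
Proof. by move=> ji; rewrite !mxE (negbTE ji) mulr0 subr0. Qed.
Lemma srefl_int i v : intv v -> intv (srefl i v).
Proof.
move=> vi j; rewrite !mxE; apply: rpredB => //; apply: rpredM; first exact: cpair_int.
by rewrite rpred_nat.
Qed.

Lemma act_cat s t v : act (s ++ t) v = act s (act t v).
Proof. by rewrite /act foldr_cat. Qed.
Lemma act_cons i s v : act (i :: s) v = srefl i (act s v). Proof. by []. Qed.
Lemma actD s u v : act s (u + v) = act s u + act s v.
Proof. by elim: s => //= i s IH; rewrite IH sreflD. Qed.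
Lemma actZ s c u : act s (c *: u) = c *: act s u.
Proof. by elim: s => //= i s IH; rewrite IH sreflZ. Qed.
Lemma actN s u : act s (- u) = - act s u.
Proof. by rewrite -scaleN1r actZ scaleN1r. Qed.
Lemma actB s u v : act s (u - v) = act s u - act s v.
Proof. by rewrite actD actN. Qed.
Lemma act_rev s v : act (rev s) (act s v) = v.
Proof.
elim: s v => //= i s IH v; rewrite rev_cons -cats1 act_cat /= sreflK; exact: IH.
Qed.
Lemma act_revK s v : act s (act (rev s) v) = v.
Proof. by have := act_rev (rev s) v; rewrite revK. Qed.
Lemma act_delta s : act s delta = delta.
Proof. by elim: s => //= i s ->; rewrite srefl_delta. Qed.
Lemma form_act s u v : form (act s u) (act s v) = form u v.
Proof. by elim: s => //= i s <-; rewrite form_srefl. Qed.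
Lemma form_actl s u v : form (act s u) v = form u (act (rev s) v).
Proof. by rewrite -{1}[v](act_revK s) form_act. Qed.
Lemma act_int s v : intv v -> intv (act s v).
Proof. by move=> vi; elim: s => //= i s IH; apply: srefl_int. Qed.
Lemma act_inj s u v : act s u = act s v -> u = v.
Proof. by move=> /(congr1 (act (rev s))); rewrite !act_rev. Qed.

Lemma bas_int i : intv (bas i).
Proof. by move=> j; rewrite basE rpred_nat. Qed.
Lemma delta_int : intv delta.
Proof.
move=> i; rewrite mxE; case: (eqVneq i ord0) => [->|i0]; first by rewrite (ac_a0 H) rpred1.
rewrite -[a i](divfK (lt0r_neq0 (ac_kgt0 H))); apply: rpredM; first exact: (ac_ak H i0).
exact: (ac_kint H).
Qed.

Lemma root_bas i : root (bas i).
Proof. by exists [::], i. Qed.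
Lemma root_act s b : root b -> root (act s b).
Proof. by case=> t [i ->]; exists (s ++ t), i; rewrite act_cat. Qed.
Lemma root_opp b : root b -> root (- b).
Proof. by case=> t [i ->]; exists (t ++ [:: i]), i; rewrite act_cat /= srefl_bas actN. Qed.
Lemma root_int b : root b -> intv b.
Proof. by case=> s [i ->]; apply: act_int; apply: bas_int. Qed.

(** * Semidefiniteness of the form *)

Lemma form_sqr v : form v v =
  - 2^-1 * \sum_i \sum_j (d i * A i j * a i * a j) * (v i 0 / a i - v j 0 / a j) ^+ 2.
Proof.
have a0 i : a i != 0 by rewrite gt_eqF ?(ac_agt0 H).
(* The pure squares drop out because the marks lie in the kernel of [A]; only the cross terms
   survive, and their coefficients have a constant sign. *)
have Z1 : \sum_i \sum_j (d i * A i j * a i * a j) * (v i 0 / a i) ^+ 2 = 0.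
  apply: big1 => i _; transitivity (\sum_j (d i * a i * (v i 0 / a i) ^+ 2) * (A i j * a j)).
    by apply: eq_bigr => j _; ring.
  by rewrite -mulr_sumr (ac_ker H) mulr0.
have Z2 : \sum_i \sum_j (d i * A i j * a i * a j) * (v j 0 / a j) ^+ 2 = 0.
  rewrite exchange_big /= -[RHS]Z1; apply: eq_bigr => i _; apply: eq_bigr => j _.
  by rewrite (ac_sym H); ring.
have E : \sum_i \sum_j (d i * A i j * a i * a j) * (v i 0 / a i - v j 0 / a j) ^+ 2 =
  \sum_i \sum_j (d i * A i j * a i * a j) * (v i 0 / a i) ^+ 2 +
  \sum_i \sum_j (d i * A i j * a i * a j) * (v j 0 / a j) ^+ 2 - 2 * form v v.
  rewrite /form mulr_sumr -!sumrN -!big_split /=; apply: eq_bigr => i _.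
  rewrite /cpair !mulr_sumr -!sumrN -!big_split /=; apply: eq_bigr => j _.
  by field; rewrite !a0.
by rewrite E Z1 Z2; field.
Qed.

Lemma sqr_term_le0 (v : vec) i j :
  (d i * A i j * a i * a j) * (v i 0 / a i - v j 0 / a j) ^+ 2 <= 0.
Proof.
case: (eqVneq i j) => [->|ij]; first by rewrite subrr expr0n mulr0.
apply: mulr_le0_ge0; last exact: sqr_ge0.
apply: mulr_le0_ge0; last by rewrite ltW ?(ac_agt0 H).
apply: mulr_le0_ge0; last by rewrite ltW ?(ac_agt0 H).
by apply: mulr_ge0_le0; [rewrite ltW ?d_gt0 | exact: (ac_off H ij)].
Qed.

Lemma form_ge0 v : 0 <= form v v.
Proof.
rewrite form_sqr mulNr oppr_ge0; apply: mulr_ge0_le0; first by rewrite invr_ge0.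
by apply: sumr_le0 => i _; apply: sumr_le0 => j _; exact: sqr_term_le0.
Qed.

(** By [form_sqr] the quotients v_i / a_i agree at adjacent nodes, hence everywhere by
    connectedness. *)
Lemma form_eq0 v : form v v = 0 -> v = v ord0 0 *: delta.
Proof.
move=> v0; have a0 i : a i != 0 by rewrite gt_eqF ?(ac_agt0 H).
have S0 : \sum_i \sum_j - ((d i * A i j * a i * a j) * (v i 0 / a i - v j 0 / a j) ^+ 2) = 0.
  under eq_bigr do rewrite sumrN.
  rewrite sumrN; move: v0; rewrite form_sqr => /eqP; rewrite mulf_eq0 oppr_eq0 invr_eq0.
  by rewrite pnatr_eq0 /= => /eqP ->; rewrite oppr0.
have T i j : (d i * A i j * a i * a j) * (v i 0 / a i - v j 0 / a j) ^+ 2 = 0.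
  apply/eqP; rewrite -oppr_eq0; apply/eqP.
  apply: (psumr_eq0P _ (_ : \sum_j - ((d i * A i j * a i * a j) * (v i 0 / a i - v j 0 / a j) ^+ 2) = 0)) => //.
    by move=> m _; rewrite oppr_ge0 sqr_term_le0.
  apply: (psumr_eq0P _ S0) => // m _; apply: sumr_ge0 => m' _.
  by rewrite oppr_ge0 sqr_term_le0.
have C i j : A i j != 0 -> v i 0 / a i = v j 0 / a j.
  move=> Aij; move/eqP: (T i j).
  have c0 : d i * A i j * a i * a j != 0 by rewrite !mulf_neq0 ?d_neq0.
  rewrite mulf_eq0 (negbTE c0) /=.
  by rewrite expf_eq0 /= subr_eq0 => /eqP.
apply/matrixP => i j; rewrite ord1 !mxE.
by rewrite -[LHS](divfK (a0 i)) (ac_conn H C i) (ac_a0 H) divr1.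
Qed.


(** * Roots are positive or negative *)

Lemma sum_sym_split (f : nodes -> nodes -> R) : (forall i j, f i j = f j i) ->
  \sum_i \sum_j f i j = \sum_i f i i + 2 * \sum_(i : nodes) \sum_(j : nodes | (j < i)%N) f i j.
Proof.
move=> fC; have E (i : nodes) : \sum_j f i j =
    f i i + (\sum_(j : nodes | (j < i)%N) f i j + \sum_(j : nodes | (i < j)%N) f i j).
  rewrite (bigD1 i) //= (bigID (fun j : nodes => (j < i)%N)) /=; congr (_ + (_ + _)).
    by apply: eq_bigl => j; rewrite andb_idl // => ji; apply: contraTneq ji => ->; rewrite ltnn.
  apply: eq_bigl => j; rewrite -leqNgt [RHS]ltn_neqAle; congr (_ && _).
  by rewrite eq_sym.
rewrite (eq_bigr _ (fun i _ => E i)) !big_split /= mulr2n mulrDl !mul1r.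
congr (_ + (_ + _)).
rewrite (exchange_big_dep xpredT) //=; apply: eq_bigr => i _.
by apply: eq_bigr => j _; rewrite fC.
Qed.

(** Diagonal terms carry the factor A_ii = 2 and off-diagonal terms come in equal pairs, so the 2
    can be divided out; the division by [D] is absorbed by the coordinates of the first argument. *)
Lemma even_norm (v : vec) (D : R) : intv v ->
  (forall j, v j 0 * d j / D \is a Num.int) -> form v v / (2 * D) \is a Num.int.
Proof.
move=> vi vD; rewrite /form /cpair.
have [->|D0] := eqVneq D 0; first by rewrite mulr0 invr0 mulr0 rpred0.
under eq_bigr do rewrite mulr_sumr mulr_sumr.
rewrite sum_sym_split; last first.
  by move=> i j; rewrite [d i * _]mulrA (ac_sym H i j); ring.
rewrite mulrDl; apply: rpredD.
  rewrite mulr_suml; apply: rpred_sum => i _; rewrite (ac_diag H).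
  rewrite (_ : _ / _ = (v i 0 * d i / D) * v i 0); last by field.
  by apply: rpredM.
rewrite -mulf_div divff ?pnatr_eq0 // mul1r mulr_suml; apply: rpred_sum => i _.
rewrite mulr_suml; apply: rpred_sum => j _.
rewrite (_ : _ / _ = (v i 0 * d i / D) * A i j * v j 0); last by field.
by do 2?apply: rpredM => //; exact: (ac_int H).
Qed.

(** Normalised so that [dn (bas i)] is [d i]; the coroot of b is then the functional (b, .) / dn
    b. *)
Definition dn (b : vec) : R := form b b / 2.

Lemma dn_act s v : dn (act s v) = dn v.
Proof. by rewrite /dn form_act. Qed.
Lemma dn_bas i : dn (bas i) = d i.
Proof. by rewrite /dn form_bas_norm; field. Qed.
Lemma dnN v : dn (- v) = dn v.
Proof. by rewrite /dn formNl formNr opprK. Qed.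
Lemma formE_dn v : form v v = 2 * dn v.
Proof. by rewrite /dn; field. Qed.
Lemma root_dn b : root b -> exists i, dn b = d i.
Proof. by case=> s [i ->]; exists i; rewrite dn_act dn_bas. Qed.
Lemma root_dn_gt0 b : root b -> 0 < dn b.
Proof. by move=> /root_dn [i ->]; exact: d_gt0. Qed.
Lemma root_dn_ge1 b : root b -> 1 <= dn b.
Proof. by move=> /root_dn [i ->]; exact: (ac_d1 H). Qed.
Lemma root_dn_neq0 b : root b -> dn b != 0.
Proof. by move=> /root_dn_gt0; case: ltgtP. Qed.
Lemma root_neq0 b : root b -> b != 0.
Proof.
move=> /root_dn_neq0; apply: contraNneq => ->.
by rewrite /dn -(scale0r 0) formZl mul0r mul0r.
Qed.

(* The vectors having an integral coroot [2 b / form b b]; being sign-coherent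
   only depends on this integrality. *)
Definition colat (b : vec) : Prop :=
  [/\ 0 < dn b, intv b & forall j, b j 0 * d j / dn b \is a Num.int].

Lemma colat_opp b : colat b -> colat (- b).
Proof.
case=> b0 bi bd; split=> [|j|j]; rewrite ?dnN ?mxE ?rpredN //.
by rewrite !mulNr rpredN.
Qed.

Lemma colat_srefl i b : colat b -> colat (srefl i b).
Proof.
case=> b0 bi bd; split=> [||j]; [by rewrite -(dn_act [:: i]) in b0 | exact: srefl_int |].
rewrite [dn _](dn_act [:: i]) !mxE.
case: (eqVneq j i) => [->|ji]; last by rewrite mulr0 subr0 bd.
rewrite mulr1 mulrBl mulrBl rpredB ?bd //.
rewrite /cpair !mulr_suml rpred_sum // => q _.
rewrite (_ : _ / _ = A q i * (b q 0 * d q / dn b)); first by rewrite rpredM ?(ac_int H).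
have E := ac_sym H q i.
transitivity ((d i * A i q) * b q 0 / dn b); first by ring.
by rewrite -E; ring.
Qed.

Lemma root_colat b : root b -> colat b.
Proof.
case=> s [i ->]; elim: s => [|m s IH]; last exact: colat_srefl.
split=> [||j]; rewrite ?dn_bas ?d_gt0 //; first exact: bas_int.
by rewrite /= basE; case: eqP => [->|_]; rewrite ?mul1r ?mul0r ?divff ?d_neq0 ?rpred1 ?rpred0.
Qed.

Lemma coroot_int b v : colat b -> intv v -> form b v / dn b \is a Num.int.
Proof.
case=> b0 bi bd vi; rewrite /form mulr_suml rpred_sum // => j _.
rewrite (_ : _ / _ = (b j 0 * d j / dn b) * cpair j v); last by ring.
by rewrite rpredM ?cpair_int.
Qed.

Definition ppart (v : vec) : vec := \col_i Num.max (v i 0) 0.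

Lemma ppartB v : v = ppart v - ppart (- v).
Proof.
by apply/matrixP => i j; rewrite ord1 !mxE; case: (lerP (v i 0) 0); case: (lerP (- v i 0) 0); lra.
Qed.

Lemma ppart_disj v i : ppart v i 0 * ppart (- v) i 0 = 0.
Proof. by rewrite !mxE; case: (lerP (v i 0) 0); case: (lerP (- v i 0) 0); nra. Qed.

Lemma ppart_ge0 v i : 0 <= ppart v i 0.
Proof. by rewrite !mxE; case: (lerP (v i 0) 0); lra. Qed.

Lemma form_ppart_le0 v : form (ppart v) (ppart (- v)) <= 0.
Proof.
apply: sumr_le0 => i _; rewrite /cpair !mulr_sumr; apply: sumr_le0 => j _.
case: (eqVneq i j) => [->|ij].
  have -> : ppart v j 0 * (d j * (A j j * ppart (- v) j 0)) =
      d j * A j j * (ppart v j 0 * ppart (- v) j 0) by ring.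
  by rewrite ppart_disj mulr0.
rewrite mulrA; have := ac_off H ij; have := ppart_ge0 v i; have := ppart_ge0 (-v) j.
move: (d_gt0 i) => d0 v0 u0 A0; rewrite mulr_ge0_le0 ?mulr_ge0 ?(ltW d0) //.
by rewrite mulr_le0_ge0.
Qed.

(** The norm of the positive part is a multiple of 2 dn b by [even_norm]. If it vanishes, the
    positive part is a multiple of delta: either it is zero, or all its coordinates are positive. *)
Lemma ppart_norm b : colat b -> posv (- b) \/ 2 * dn b <= form (ppart b) (ppart b) \/ posv b.
Proof.
move=> [D0 ib db].
have := form_ge0 (ppart b); rewrite le_eqVlt => /predU1P [E|P].
  have E' := form_eq0 (esym E).
  have Ei i : ppart b i 0 = ppart b ord0 0 * a i by rewrite {1}E' !mxE.
  have [Z|P] := lerP (ppart b ord0 0) 0.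
    left=> i; have := Ei i; rewrite (_ : ppart b ord0 0 = 0) ?mul0r.
      by rewrite !mxE; case: (lerP (b i 0) 0); lra.
    by have := ppart_ge0 b ord0; lra.
  right; right=> i; have : 0 < ppart b i 0 by rewrite Ei mulr_gt0 ?(ac_agt0 H).
  by rewrite mxE; case: (lerP (b i 0) 0); lra.
right; left.
have : form (ppart b) (ppart b) / (2 * dn b) \is a Num.int.
  apply: even_norm => [i|j]; rewrite mxE.
    by case: lerP => _; rewrite ?rpred0 ?ib.
  by case: lerP => _; rewrite ?mul0r ?rpred0 ?db.
have P2 : 0 < form (ppart b) (ppart b) / (2 * dn b).
  by rewrite divr_gt0 // pmulr_rgt0 ?ltr0n.
move=> /Num.Theory.intrP [z zE]; rewrite zE ltr0z in P2.
have : 1 <= form (ppart b) (ppart b) / (2 * dn b) by rewrite zE ler1z; lia.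
have PD : 0 < 2 * dn b by rewrite pmulr_rgt0 ?ltr0n.
by rewrite (ler_pdivlMr _ _ PD) mul1r.
Qed.

(** Otherwise the positive and the negative part both have norm at least 2 dn b; their product being
    nonpositive, the norm of b would be at least 4 dn b instead of 2 dn b. *)
Lemma colat_sign b : colat b -> posv b \/ posv (- b).
Proof.
move=> rb; have [D0 _ _] := rb.
case: (ppart_norm rb) => [|[P1|]]; [by right| |by left].
case: (ppart_norm (colat_opp rb)) => [|[P2|]]; rewrite ?opprK; [by left| |by right].
move: P2; rewrite dnN => P2.
have E : form b b = 2 * dn b by exact: formE_dn.
have := form_ppart_le0 b; rewrite {1 2}(ppartB b) formBl !formBr in E.
rewrite [form (ppart (-b)) (ppart b)]formC in E; lra.
Qed.

Lemma root_sign b : root b -> posv b \/ posv (- b).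
Proof. by move=> /root_colat; exact: colat_sign. Qed.

Lemma posv_opp0 v : posv v -> posv (- v) -> v = 0.
Proof.
move=> P Q; apply/matrixP => i j; rewrite ord1 mxE; apply/eqP.
by rewrite eq_le P andbT; have := Q i; rewrite mxE oppr_ge0.
Qed.

Lemma root_pos_neg b : root b -> posv b -> ~ posv (- b).
Proof. by move=> /root_neq0 b0 P Q; move: b0; rewrite (posv_opp0 P Q) eqxx. Qed.

(** Only the coordinate i changes, so a negative image forces b = c alpha_i. Both c and c d_i / dn b
    are integers and their product is 1, whence c = 1. *)
Lemma colat_srefl_pos i b : colat b -> posv b -> b != bas i -> posv (srefl i b).
Proof.
move=> rb pb bi; have rs := colat_srefl i rb; have [D0 ib db] := rb.
case: (colat_sign rs) => // N; case/negP: bi; apply/eqP.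
have Z j : j != i -> b j 0 = 0.
  move=> ji; apply/eqP; rewrite eq_le pb andbT.
  by have := N j; rewrite mxE (srefl_coord _ ji) oppr_ge0.
have E : b = b i 0 *: bas i.
  apply/matrixP => j l; rewrite ord1 !mxE eqxx andbT.
  by case: (eqVneq j i) => [->|/Z ->]; rewrite ?mulr1 ?mulr0.
have ci := ib i; have cd := db i.
have D : dn b = b i 0 ^+ 2 * d i by rewrite /dn {1 2}E formZl formZr form_bas_norm; field.
have c0 : b i 0 != 0.
  by apply/eqP => c0; move: D0; rewrite D c0 expr0n /= mul0r ltxx.
have K : b i 0 * (b i 0 * d i / dn b) = 1.
  by rewrite D; field; rewrite c0 d_neq0.
have c1 : b i 0 = 1.
  move/Num.Theory.intrP: ci => [x xE]; move/Num.Theory.intrP: cd => [y yE]; move: K (pb i); rewrite yE xE.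
  rewrite -intrM ler0z => K x0; have {}K : (x * y = 1)%R by apply/eqP; rewrite -(eqr_int R) K.
  have y1 : (1 <= y)%R by nia.
  by have -> : x = 1 by nia.
by rewrite E c1 scale1r.
Qed.

Lemma srefl_pos i b : root b -> posv b -> b != bas i -> posv (srefl i b).
Proof. by move=> /root_colat; exact: colat_srefl_pos. Qed.

(** * The finite roots and theta *)

Definition fin (v : vec) : vec := v - v ord0 0 *: delta.
Definition theta : vec := k^-1 *: (delta - bas ord0).
(** The finite root system as the intersection of the real roots with Q, not as the orbit of the
    finite simple roots. *)
Definition droot (b : vec) : Prop := root b /\ b ord0 0 = 0.
Definition fword (s : seq nodes) : bool := all (fun i => i != ord0) s.

Lemma k_neq0 : k != 0. Proof. exact: lt0r_neq0 (ac_kgt0 H). Qed.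

Lemma delta0 : delta ord0 0 = 1. Proof. by rewrite mxE (ac_a0 H). Qed.
Lemma fin0 (v : vec) : fin v ord0 0 = 0.
Proof. by rewrite mxE mxE mxE delta0 mulr1 subrr. Qed.
Lemma fin_id (v : vec) : v ord0 0 = 0 -> fin v = v.
Proof. by rewrite /fin => ->; rewrite scale0r subr0. Qed.
Lemma finD u v : fin (u + v) = fin u + fin v.
Proof. by rewrite /fin mxE scalerDl opprD addrACA. Qed.
Lemma finZ c v : fin (c *: v) = c *: fin v.
Proof. by rewrite /fin mxE scalerBr scalerA. Qed.
Lemma finN v : fin (- v) = - fin v.
Proof. by rewrite -scaleN1r finZ scaleN1r. Qed.
Lemma fin_delta : fin delta = 0.
Proof. by rewrite /fin delta0 scale1r subrr. Qed.
Lemma htD u v : ht (u + v) = ht u + ht v.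
Proof. by rewrite /ht -big_split; apply: eq_bigr => i _; rewrite mxE. Qed.
Lemma htZ c v : ht (c *: v) = c * ht v.
Proof. by rewrite /ht mulr_sumr; apply: eq_bigr => i _; rewrite mxE. Qed.
Lemma htN v : ht (- v) = - ht v.
Proof. by rewrite -scaleN1r htZ mulN1r. Qed.
Lemma posv_ht v : posv v -> 0 <= ht v.
Proof. by move=> p; apply: sumr_ge0 => i _. Qed.
Lemma posv_ht0 v : posv v -> ht v = 0 -> v = 0.
Proof.
move=> p h; apply/matrixP => i j; rewrite ord1 [RHS]mxE.
by apply: (psumr_eq0P (P := xpredT) (F := fun i => v i 0)) => // m _; exact: p.
Qed.
Lemma root_ht_gt0 b : root b -> posv b <-> 0 < ht b.
Proof.
move=> rb; split=> [p|h].
  rewrite lt_neqAle posv_ht // andbT; apply/eqP => /esym /(posv_ht0 p) b0.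
  by have := root_neq0 rb; rewrite b0 eqxx.
by case: (root_sign rb) => // /posv_ht; rewrite htN; lra.
Qed.
Lemma root_ht_lt0 b : root b -> posv (- b) <-> ht b < 0.
Proof. by move=> /root_opp /root_ht_gt0 ->; rewrite htN oppr_gt0. Qed.
Lemma root_ht_neq0 b : root b -> ht b != 0.
Proof. by move=> rb; case: (root_sign rb) => [/(root_ht_gt0 rb)|/(root_ht_lt0 rb)]; case: ltgtP. Qed.
Lemma ht_bas i : ht (bas i) = 1.
Proof.
by rewrite /ht (bigD1 i) //= basE eqxx big1 ?addr0 // => j ji; rewrite basE (negbTE ji).
Qed.
Lemma posv_bas i : posv (bas i). Proof. by move=> j; rewrite basE ler0n. Qed.

Lemma fword_coord0 s (v : vec) : fword s -> act s v ord0 0 = v ord0 0.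
Proof.
elim: s => //= i s IH /andP[i0 /IH <-]; apply: srefl_coord; by rewrite eq_sym.
Qed.
Lemma fword_rev s : fword (rev s) = fword s. Proof. exact: all_rev. Qed.
Lemma droot_act s b : fword s -> droot b -> droot (act s b).
Proof. by move=> fs [rb b0]; split; [exact: root_act | rewrite fword_coord0]. Qed.
Lemma droot_opp b : droot b -> droot (- b).
Proof. by case=> rb b0; split; [exact: root_opp | rewrite mxE b0 oppr0]. Qed.
Lemma droot_bas i : i != ord0 -> droot (bas i).
Proof. by move=> i0; split; [exact: root_bas | rewrite basE eq_sym (negbTE i0)]. Qed.

Lemma bas0E : bas ord0 = delta - k *: theta.
Proof. by rewrite /theta scalerA divff ?k_neq0 // scale1r opprB addrC subrK. Qed.
Lemma theta0 : theta ord0 0 = 0.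
Proof. by rewrite !mxE (ac_a0 H) eqxx subrr mulr0. Qed.
Lemma theta_int : intv theta.
Proof.
move=> i; rewrite !mxE eqxx andbT; case: (eqVneq i ord0) => [->|i0].
  by rewrite (ac_a0 H) subrr mulr0 rpred0.
by rewrite subr0 mulrC (ac_ak H i0).
Qed.
Lemma form_thetal v : form theta v = - k * cpair ord0 v.
Proof.
rewrite /theta formZl formBl form_deltal form_basl (ac_d0 H).
by field; rewrite k_neq0.
Qed.
(** This comes from the normalisation d_0 = k^2; no root has a smaller half norm. *)
Lemma dn_theta : dn theta = 1.
Proof.
rewrite /dn form_thetal /theta cpairZ cpairB cpair_delta cpair_bas (ac_diag H).
by field; rewrite k_neq0.
Qed.

(* Lowering the height of a vector of minimal norm by simple reflections ends at
   a simple root. *)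
Lemma short_root (b : vec) : intv b -> b ord0 0 = 0 -> dn b = 1 -> posv b ->
  exists s i, [/\ fword s, i != ord0 & b = act s (bas i)].
Proof.
move=> bi b0 bn bp.
have [N] : exists N : nat, ht b <= N%:R.
  by exists (Num.truncn (ht b)).+1; rewrite ltW // truncnS_gt.
elim: N b bi b0 bn bp => [|N IH] b bi b0 bn bp hN.
  have : ht b = 0 by apply/eqP; rewrite eq_le hN posv_ht.
  by move=> /(posv_ht0 bp) bE; move: bn; rewrite /dn bE -(scale0r 0) formZl; lra.
(* As the norm of b is positive, some coordinate and the pairing with the same simple coroot are
   both positive; this reflection lowers the height. *)
have [i bi0 ci] : exists2 i, 0 < b i 0 & 0 < cpair i b.
  apply: contrapT => nex; have : form b b <= 0.
    apply: sumr_le0 => i _; have := bp i; rewrite le_eqVlt => /predU1P [<-|pi].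
      by rewrite mul0r.
    rewrite pmulr_rle0 // pmulr_rle0 ?d_gt0 // leNgt; apply/negP => ci.
    by apply: nex; exists i.
  by rewrite formE_dn bn; lra.
have i0 : i != ord0 by apply: contraTneq bi0 => ->; rewrite b0 ltxx.
have cb : colat b.
  by split=> // [|j]; rewrite bn // divr1 rpredM ?(ac_dint H).
have [->|bE] := eqVneq b (bas i); first by exists [::], i.
have pb' := colat_srefl_pos cb bp bE.
have [] := IH (srefl i b) => //; [exact: srefl_int| | | |].
- by rewrite srefl_coord // eq_sym.
- by rewrite -bn; exact: (dn_act [:: i]).
- have : 1 <= cpair i b.
    have [z zE] := intrP (cpair_int i bi); move: ci; rewrite zE ltr0z => z0.
    by rewrite ler1z; lia.
  by rewrite /srefl htD htN htZ ht_bas mulr1; move: hN; rewrite -natr1; lra.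
- move=> s [j [fs j0 E]]; exists (i :: s), j; split=> //; first by rewrite /= i0.
  by rewrite act_cons -E sreflK.
Qed.

Lemma theta_pos : posv theta.
Proof.
move=> i; rewrite !mxE eqxx andbT; apply: mulr_ge0; first by rewrite invr_ge0 ltW ?(ac_kgt0 H).
case: (eqVneq i ord0) => [->|i0]; first by rewrite (ac_a0 H) subrr.
by rewrite subr0 ltW ?(ac_agt0 H).
Qed.

(** Makes theta a root and its reflection a product of finite simple reflections, as needed to
    replace s_0 in the semidirect product. *)
Lemma theta_word : exists s i, [/\ fword s, i != ord0 & theta = act s (bas i)].
Proof.
by apply: short_root; [exact: theta_int|exact: theta0|exact: dn_theta|exact: theta_pos].
Qed.

Lemma droot_theta : droot theta.
Proof. by have [s [i [fs i0 ->]]] := theta_word; apply/droot_act/droot_bas. Qed.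

(** * Reflections and the decomposition into a finite part and a translation *)

Definition refl (b v : vec) : vec := v - (form b v / dn b) *: b.

Lemma srefl_refl i v : srefl i v = refl (bas i) v.
Proof. by rewrite /refl dn_bas form_basl mulrAC divff ?d_neq0 // mul1r. Qed.
Lemma refl_act s b v : refl (act s b) (act s v) = act s (refl b v).
Proof. by rewrite /refl form_act dn_act actB actZ. Qed.
Lemma refl_word s i v : refl (act s (bas i)) v = act (s ++ i :: rev s) v.
Proof. by rewrite act_cat act_cons srefl_refl -refl_act act_revK. Qed.
Lemma reflD b u v : refl b (u + v) = refl b u + refl b v.
Proof. by rewrite /refl formDr mulrDl scalerDl opprD addrACA. Qed.
Lemma reflZ b c v : refl b (c *: v) = c *: refl b v.
Proof. by rewrite /refl formZr scalerBr scalerA mulrA. Qed.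
Lemma refl_self b : dn b != 0 -> refl b b = - b.
Proof.
by move=> b0; rewrite /refl formE_dn mulfK // scaler_nat mulr2n opprD addrA subrr add0r.
Qed.
Lemma reflK b : dn b != 0 -> involutive (refl b).
Proof.
move=> b0 v; rewrite /refl formBr formZr formE_dn -addrA -opprD -scalerDl.
by rewrite (_ : _ + (_ - _) / _ = 0 :> R) ?scale0r ?subr0 //; field.
Qed.
Lemma form_refl b u v : dn b != 0 -> form (refl b u) (refl b v) = form u v.
Proof.
by move=> b0; rewrite /refl formBl !formBr !formZl !formZr formE_dn (formC u b); field.
Qed.
Lemma root_refl_root b c : root b -> root c -> root (refl b c).
Proof. by case=> s [i ->] rc; rewrite refl_word; exact: root_act. Qed.
Lemma refl_coord0 (b v : vec) : b ord0 0 = 0 -> v ord0 0 = 0 -> refl b v ord0 0 = 0.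
Proof. by move=> b0 v0; rewrite !mxE b0 v0 mulr0 subr0. Qed.
Lemma droot_refl b c : droot b -> droot c -> droot (refl b c).
Proof.
move=> [rb b0] [rc c0]; split; [exact: root_refl_root | exact: refl_coord0].
Qed.

(** The action of s_0 = s_theta t_(-theta): a translation moves vectors along delta only. *)
Lemma srefl0E v : srefl ord0 v = refl theta v + (form theta v / k) *: delta.
Proof.
rewrite /srefl /refl bas0E dn_theta divr1 form_thetal; set c := cpair _ v.
rewrite (_ : - k * c / k = - c); last by field; rewrite k_neq0.
by rewrite scalerBr scalerA mulNr !scaleNr opprK opprB addrA [c * k]mulrC.
Qed.

(* [s] represents [w t_xi]. *)
Definition dec (s w : seq nodes) (xi : vec) : Prop :=
  [/\ fword w, intv xi, xi ord0 0 = 0 &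
      forall v, act s v = act w v - (form v xi / k) *: delta].

Lemma dec_nil : dec [::] [::] 0.
Proof.
split=> // [i||v]; rewrite ?mxE ?rpred0 //.
by rewrite -(scale0r 0) formZr mul0r mul0r scale0r subr0.
Qed.

Lemma dec_cons i s w xi : i != ord0 -> dec s w xi -> dec (i :: s) (i :: w) xi.
Proof.
move=> i0 [fw xii xi0 E]; split=> // [|v]; first by rewrite /= i0.
by rewrite act_cons E -scaleNr sreflD sreflZ srefl_delta scaleNr.
Qed.

(** s_0 w t_xi = s_theta w t_(xi - w^-1 theta), and the palindrome [tw ++ ti :: rev tw] spells
    s_theta. *)
Lemma dec_cons0 s w xi tw ti : theta = act tw (bas ti) -> fword tw -> ti != ord0 ->
  dec s w xi -> dec (ord0 :: s) ((tw ++ ti :: rev tw) ++ w) (xi - act (rev w) theta).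
Proof.
move=> tE ft ti0 [fw xii xi0 E]; split=> [|||v].
- by rewrite /fword !all_cat /= all_rev ti0 [all _ tw]ft [all _ w]fw.
- by move=> i; rewrite !mxE rpredB //; apply: act_int; exact: theta_int.
- by rewrite !mxE fword_coord0 ?fword_rev // theta0 xi0 subr0.
rewrite act_cons E act_cat -refl_word -tE -scaleNr sreflD sreflZ srefl_delta srefl0E.
rewrite -addrA -scalerDl; congr (_ + _); rewrite -scaleNr; congr (_ *: _).
by rewrite formBr [form v (act _ _)]formC form_actl revK; ring.
Qed.

Lemma dec_exists s : exists w xi, dec s w xi.
Proof.
have [tw [ti [ft ti0 tE]]] := theta_word.
elim: s => [|i s [w [xi D]]]; first by exists [::], 0; exact: dec_nil.
have [->|i0] := eqVneq i ord0; last by exists (i :: w), xi; exact: dec_cons.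
exists ((tw ++ ti :: rev tw) ++ w), (xi - act (rev w) theta).
exact: dec_cons0.
Qed.

(** * Finiteness of the finite root system *)

Lemma root_dn_le b : root b -> dn b <= \sum_i d i.
Proof.
move=> /root_dn [i ->]; rewrite (bigD1 i) //= lerDl; apply: sumr_ge0 => j _.
exact: ltW (d_gt0 j).
Qed.

(** The form is nonnegative on alpha_i + b and on alpha_i - b, which bounds |(alpha_i, b)| by d_i +
    dn b. *)
Lemma cpair_bound i b : root b -> `|cpair i b| <= 1 + \sum_i d i.
Proof.
move=> rb; have := form_ge0 (bas i - b); have := form_ge0 (bas i + b).
rewrite !formBl !formDl !formBr !formDr [form b (bas i)]formC form_bas_norm form_basl.
rewrite formE_dn => h1 h2; have := root_dn_le rb; have := ac_d1 H i; have := root_dn_ge1 rb.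
set S := \sum_i _ => b1 d1 bS; rewrite ler_norml.
have d0 := d_gt0 i; apply/andP; split.
  rewrite -(ler_pM2l d0) mulrN; nra.
by rewrite -(ler_pM2l d0); nra.
Qed.

(** The difference is isotropic, so it is a multiple of delta, and its coefficient at alpha_0
    vanishes. *)
Lemma droot_eq (b c : vec) : b ord0 0 = 0 -> c ord0 0 = 0 ->
  (forall i, i != ord0 -> cpair i b = cpair i c) -> b = c.
Proof.
move=> b0 c0 E; apply/eqP; rewrite -subr_eq0; apply/eqP.
have e0 : (b - c) ord0 0 = 0 by rewrite !mxE b0 c0 subrr.
rewrite [LHS]form_eq0 ?e0 ?scale0r //; apply: big1 => i _.
have [->|i0] := eqVneq i ord0; first by rewrite e0 mul0r.
by rewrite cpairB E // subrr !mulr0.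
Qed.

Lemma droot_enum : exists E : seq vec, uniq E /\ forall b, b \in E <-> droot b /\ posv b.
Proof.
pose B := (Num.truncn (1 + \sum_i d i)).+1.
have hB : 1 + \sum_i d i <= B%:R by rewrite ltW // truncnS_gt.
(* Pairings with the simple coroots, shifted by the bound [B] into 0, ..., 2B; by [droot_eq] they
   determine the root, so there are finitely many. *)
pose F (b : vec) := [ffun i : nodes => (inord (Num.truncn (cpair i b + B%:R)) : 'I_(B + B).+1)].
pose S := [set b | droot b /\ posv b]%classic.
pose g f := xget 0 [set b | S b /\ F b = f]%classic.
have Finj b c : S b -> S c -> F b = F c -> b = c.
  move=> [[rb b0] pb] [[rc c0] pc] /ffunP FE; apply: droot_eq => // i _.
  have P x : root x -> cpair i x + B%:R \is a Num.nat /\ cpair i x + B%:R <= (B + B)%:R.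
    move=> rx; have := cpair_bound i rx; rewrite ler_norml => /andP[h1 h2].
    split; last by rewrite natrD; lra.
    rewrite natrEint rpredD ?cpair_int ?rpred_nat ?root_int //=; first by lra.
    exact: root_int.
  have [[b1 b2] [c1 c2]] := (P b rb, P c rc).
  have K x : Num.truncn (cpair i x + B%:R) = F x i :> nat \/ ~ root x.
    have [rx|] := pselect (root x); [left|by right].
    rewrite ffunE inordK // ltnS -(ler_nat R) truncnK; by have [] := P x rx.
  have [Kb|//] := K b; have [Kc|//] := K c.
  apply: (addIr B%:R); rewrite -(truncnK b1) -(truncnK c1) Kb Kc.
  by rewrite FE.
have fS : finite_set S.
  apply: (@sub_finite_set _ _ (range g)%classic); last exact: finite_image.
  move=> b Sb; exists (F b) => //.
  by apply: Finj => //; have [] := @xgetI _ 0 [set c | S c /\ F c = F b]%classic b (conj Sb erefl).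
have /finite_seqP [E EE] := fS; exists (undup E); split; first exact: undup_uniq.
by move=> b; rewrite mem_undup; have -> : (b \in E : Prop) = S b by rewrite EE.
Qed.

Lemma sum_indic (E : seq vec) (P : pred vec) g : uniq E ->
  \sum_(b <- E | P b) ((b == g)%:R : R) = ((g \in E) && P g)%:R.
Proof.
move=> uE; have [gE|gE] /= := boolP (g \in E); last first.
  rewrite big_seq_cond big1 // => b /andP[bE _].
  by case: eqP => // bg; rewrite -bg bE in gE.
have [Pg|Pg] := boolP (P g).
  rewrite big_mkcond (bigD1_seq g) //= Pg eqxx big1 ?addr0 // => b /negbTE ->.
  by rewrite if_same.
by rewrite big1 // => b Pb; case: eqP => // bg; rewrite -bg Pb in Pg.
Qed.

(** * The effect of one more letter on [chi] *)

Definition neg (v : vec) : bool := ht v < 0.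

(* For [s] representing [w t_xi], the first summand is the integer [form b xi / dn b],
   and the second one tells whether [w b] is negative. *)
Definition chi (s : seq nodes) (b : vec) : R :=
  - (act s b ord0 0) * k / dn b + (neg (fin (act s b)))%:R.

Lemma dec_coord0 s w xi (v : vec) : dec s w xi -> v ord0 0 = 0 -> act s v ord0 0 = - (form v xi / k).
Proof. by case=> fw _ _ -> v0; rewrite !mxE fword_coord0 // v0 (ac_a0 H) mulr1 add0r. Qed.

Lemma dec_fin s w xi (v : vec) : dec s w xi -> v ord0 0 = 0 -> fin (act s v) = act w v.
Proof.
case=> fw _ _ -> v0; rewrite -scaleNr finD finZ fin_delta scaler0 addr0.
by rewrite fin_id // fword_coord0.
Qed.

Lemma chi_dec s w xi b : dec s w xi -> droot b ->
  chi s b = form b xi / dn b + (neg (act w b))%:R.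
Proof.
move=> D [rb b0]; rewrite /chi (dec_coord0 D b0) (dec_fin D b0) opprK.
by congr (_ + _); field; rewrite root_dn_neq0 // k_neq0.
Qed.

(** Up to sign this is the integer <b^vee, xi> for s = w t_xi. It lets every strict change of this
    quantity count for at least 1. *)
Lemma coord0_int s b : droot b -> act s b ord0 0 * k / dn b \is a Num.int.
Proof.
move=> [rb b0]; have [w [xi D]] := dec_exists s; rewrite (dec_coord0 D b0).
have [_ xii _ _] := D; have := coroot_int (root_colat rb) xii; rewrite -rpredN.
by rewrite (_ : - (form b xi / k) * k / dn b = - (form b xi / dn b)) //; field;
   rewrite root_dn_neq0 // k_neq0.
Qed.

(** The finite part of alpha_i, up to the positive factor k when i = 0. *)
Definition fbas (i : nodes) : vec := if i == ord0 then - theta else bas i.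

Lemma droot_fbas i : droot (fbas i).
Proof.
rewrite /fbas; case: eqVneq => [_|]; first exact: droot_opp droot_theta.
exact: droot_bas.
Qed.

Lemma opp_neq (b : vec) : root b -> (b == - b) = false.
Proof.
move=> rb; apply/eqP => /(congr1 ht); rewrite htN => E.
by have /eqP := root_ht_neq0 rb; apply; lra.
Qed.

(** A simple reflection permutes the positive roots other than its own. *)
Lemma sgn_srefl i b : root b ->
  (neg (srefl i b))%:R - (neg b)%:R = (b == bas i)%:R - (b == - bas i)%:R :> R.
Proof.
rewrite /neg => rb; have rs : root (srefl i b) := root_act [:: i] rb.
have [->|bi] := eqVneq b (bas i).
  rewrite (opp_neq (root_bas i)) srefl_bas htN ht_bas.
  by rewrite ltrN10 ltNge ler01.
have [->|bi'] := eqVneq b (- bas i).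
  rewrite -[- bas i]scaleN1r sreflZ srefl_bas scalerN scaleN1r opprK htN ht_bas.
  by rewrite ltrN10 ltNge ler01.
rewrite subrr; apply/eqP; rewrite subr_eq0 eqr_nat; apply/eqP; congr nat_of_bool.
apply/idP/idP => h.
  case: (root_sign rb) => [pb|/(root_ht_lt0 rb) //].
  by have /(root_ht_gt0 rs) := srefl_pos rb pb bi; rewrite ltNge (ltW h).
apply/(root_ht_lt0 rs); rewrite -scaleN1r -sreflZ scaleN1r; apply: srefl_pos.
- exact: root_opp.
- exact/(root_ht_lt0 rb).
- by apply: contra bi' => /eqP <-; rewrite opprK.
Qed.

Lemma srefl0_coord0 (v : vec) : v ord0 0 = 0 -> srefl ord0 v ord0 0 = form theta v / k.
Proof. by move=> v0; rewrite srefl0E mxE refl_coord0 ?theta0 // mxE delta0 mulr1 add0r. Qed.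

(** Dominance of theta is read off from s_0: if b were negative, s_0 (-b) would be a positive root,
    although its coefficient at alpha_0 is - (theta, b) / k < 0. *)
Lemma theta_side b : droot b -> 0 < form theta b -> posv b.
Proof.
move=> [rb b0] h; case: (root_sign rb) => // N.
have bN : - b != bas ord0.
  by apply/eqP => /matrixP /(_ ord0 0); rewrite basE mxE b0 oppr0 eqxx => /eqP; rewrite eq_sym oner_eq0.
have := srefl_pos (root_opp rb) N bN ord0.
rewrite srefl0_coord0 ?mxE ?b0 ?oppr0 // formNr mulNr oppr_ge0 leNgt.
by rewrite divr_gt0 // (ac_kgt0 H).
Qed.

(** The counterpart of [sgn_srefl] for s_0. As theta is shortest, <b^vee, theta> is -1, 0 or 1
    unless b is theta or -theta; when it is nonzero, [theta_side] gives the signs of b and of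
    s_theta b. *)
Lemma sgn_theta b : droot b ->
  - (form b theta / dn b) + (neg (refl theta b))%:R - (neg b)%:R =
  (b == - theta)%:R - (b == theta)%:R.
Proof.
rewrite /neg; have rt := droot_theta; have [rt1 rt0] := rt.
have ht_t : 0 < ht theta by apply/(root_ht_gt0 rt1); exact: theta_pos.
have n1 : dn theta != 0 by rewrite dn_theta oner_eq0.
move=> rb; have [rb1 rb0] := rb.
have [->|bt] := eqVneq b theta.
  rewrite (opp_neq rt1) refl_self // htN oppr_lt0 ht_t ltNge ltW //= formE_dn dn_theta; lra.
have [->|bt'] := eqVneq b (- theta).
  rewrite -[- theta]scaleN1r reflZ refl_self // scalerN scaleN1r opprK htN oppr_lt0 ht_t.
  by rewrite [ht theta < 0]ltNge ltW //= dnN formNl formE_dn dn_theta; lra.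
have pos (c : vec) : c != 0 -> c ord0 0 = 0 -> 0 < form c c.
  move=> c0 cz; rewrite lt_neqAle form_ge0 andbT; apply: contra c0 => /eqP /esym.
  by move=> /form_eq0 ->; rewrite cz scale0r.
have := pos (b - theta); rewrite subr_eq0 => /(_ bt).
rewrite mxE rb0 mxE theta0 subr0 => /(_ erefl); rewrite formBl !formBr [form theta b]formC.
have := pos (b + theta); rewrite addr_eq0 => /(_ bt').
rewrite mxE rb0 theta0 addr0 => /(_ erefl); rewrite formDl !formDr [form theta b]formC.
rewrite !formE_dn dn_theta => h1 h2.
have d1 := root_dn_ge1 rb1; have d0 := root_dn_gt0 rb1.
have /intrP [z zE] : form b theta / dn b \is a Num.int.
  by apply: coroot_int; [exact: root_colat | exact: theta_int].
have fE : form b theta = z%:~R * dn b by rewrite -zE divfK // root_dn_neq0.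
have z1 : z < 2.
  by rewrite -(ltr_int R) -(ltr_pM2r d0) -fE; lra.
have z2 : -2 < z.
  by rewrite -(ltr_int R) -(ltr_pM2r d0) -fE intrN; lra.
have rr : root (refl theta b) by exact: root_refl_root.
have S c : droot c -> 0 < form theta c -> posv c /\ posv (- refl theta c).
  move=> rc fc; split; first exact: theta_side.
  apply: theta_side; first by apply: droot_opp; exact: droot_refl.
  by rewrite formNr /refl formBr formZr formE_dn dn_theta divr1; lra.
rewrite zE; have [z0|[z0|z0]] : z = 0 \/ (z = 1 \/ z = -1) by lia.
- have -> : refl theta b = b by rewrite /refl formC fE z0 !mul0r scale0r subr0.
  by rewrite z0 addrK mulr0z oppr0.
- have [|/(root_ht_gt0 rb1) p /(root_ht_lt0 rr) q] := S b rb.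
    by rewrite formC fE z0 mul1r.
  by rewrite q [ht b < 0]ltNge ltW // z0 /=; lra.
have [|/(root_ht_lt0 rb1) p] := S (- b) (droot_opp rb).
  by rewrite formNr formC fE z0 mulNr mul1r opprK.
rewrite -{1}[- b]scaleN1r reflZ scaleN1r opprK => /(root_ht_gt0 rr) q.
by rewrite p [ht (refl _ _) < 0]ltNge ltW // z0 /=; lra.
Qed.

Lemma chi_cons i s w xi b : dec s w xi -> droot b ->
  chi (i :: s) b = chi s b + ((act w b == fbas i)%:R - (act w b == - fbas i)%:R).
Proof.
move=> D rb; have [fw xii xi0 _] := D; have rwb := droot_act fw rb.
rewrite (chi_dec D rb) /fbas; have [->|i0] := eqVneq i ord0.
  have [tw [ti [ft ti0 tE]]] := theta_word.
  rewrite (chi_dec (dec_cons0 tE ft ti0 D) rb) act_cat -refl_word -tE opprK -sgn_theta //.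
  by rewrite dn_act formBr form_actl [form b (act _ _)]formC; ring.
rewrite (chi_dec (dec_cons i0 D) rb) act_cons -sgn_srefl; last by case: rwb.
by ring.
Qed.

(** * Inversions among the positive finite roots *)

Context (E : seq vec) (uE : uniq E).
Hypothesis EP : forall b, b \in E <-> droot b /\ posv b.

Definition ninv (s : seq nodes) : nat := count (fun b => neg (act s b)) E.

Lemma ninv_nil : ninv [::] = 0%N.
Proof.
apply/eqP; rewrite eqn0Ngt -has_count; apply/hasPn => b /EP [_ pb].
by rewrite /neg -leNgt posv_ht.
Qed.

Lemma neg_srefl i b : root b -> b != bas i -> neg (srefl i b) -> neg b.
Proof.
move=> rb bi; have rs : root (srefl i b) := root_act [:: i] rb.
rewrite /neg => /(root_ht_lt0 rs) N; apply/(root_ht_lt0 rb).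
by case: (root_sign rb) => // pb; case: (root_pos_neg rs (srefl_pos rb pb bi)).
Qed.

Lemma count_le1 g : (count (pred1 g) E <= 1)%N.
Proof. by rewrite count_uniq_mem // leq_b1. Qed.

Lemma count_sub_in (P Q : pred vec) :
  (forall b, b \in E -> P b -> Q b) -> (count P E <= count Q E)%N.
Proof.
move=> PQ; rewrite (eq_in_count (a2 := predI P Q)); first by apply: sub_count => b /andP[].
by move=> b bE /=; rewrite andb_idr //; exact: PQ.
Qed.

(** The only root that can become negative is s^-1 alpha_i. *)
Lemma ninv_cons_le i s : (ninv (i :: s) <= (ninv s).+1)%N.
Proof.
pose g := act (rev s) (bas i).
apply: (@leq_trans (count (predU (fun b => neg (act s b)) (pred1 g)) E)).
  apply: count_sub_in => b /EP [[rb _] _] /=; rewrite -/(act s b) => h.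
  have [bg|bg] := eqVneq b g; first by rewrite orbT.
  rewrite orbF; apply: neg_srefl h; first exact: root_act.
  by apply: contra bg => /eqP bE; rewrite /g -bE act_rev.
rewrite -(addn1 (ninv s)); apply: leq_trans (leq_add (leqnn _) (count_le1 g)).
by rewrite -count_predUI leq_addr.
Qed.

Lemma ninv_le_size s : (ninv s <= size s)%N.
Proof.
elim: s => [|i s IH]; first by rewrite ninv_nil.
by apply: leq_trans (ninv_cons_le i s) _.
Qed.

(** The root s^-1 alpha_i becomes an inversion, and none is lost: only - s^-1 alpha_i could be, and
    it is not positive. *)
Lemma ninv_cons_gt i s : fword s -> i != ord0 -> posv (act (rev s) (bas i)) ->
  (ninv s < ninv (i :: s))%N.
Proof.
move=> fs i0 pg; pose g := act (rev s) (bas i).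
have rg : droot g by apply: droot_act; [rewrite fword_rev | exact: droot_bas].
have gE : g \in E by apply/EP.
rewrite -(addn1 (ninv s)) -[1%N]/(true : nat) -gE -count_uniq_mem // -count_predUI.
rewrite [X in (_ + X)%N](_ : _ = 0%N) ?addn0; last first.
  apply/eqP; rewrite eqn0Ngt -has_count; apply/hasPn => b _ /=.
  rewrite andbC; have [->|//] := eqVneq b g.
  by rewrite /g act_revK /neg ht_bas -leNgt ler01.
apply: count_sub_in => b /EP [[rb _] pb] /= /orP[|/eqP ->]; last first.
  by rewrite act_revK srefl_bas /neg htN ht_bas ltrN10.
rewrite -/(act s b) => h; have ra : root (act s b) by exact: root_act.
have := @neg_srefl i (srefl i (act s b)) (root_act [:: i] ra).
rewrite sreflK; apply=> //; apply: contraTneq h => /(congr1 (srefl i)).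
rewrite sreflK srefl_bas => E'; exfalso.
move: pg; rewrite -/g => pg; apply: (root_pos_neg rb pb).
by rewrite -[b](act_rev s) E' actN opprK.
Qed.

Lemma sum_bool_count (P : pred vec) : \sum_(b <- E) ((P b)%:R : R) = (count P E)%:R.
Proof. by rewrite -natr_sum -sum1_count [in RHS]big_mkcond. Qed.

Lemma sum_chi_dec s w xi : dec s w xi ->
  \sum_(b <- E) chi s b = (ninv w)%:R + \sum_(b <- E) form b xi / dn b.
Proof.
move=> D; rewrite /ninv -sum_bool_count -big_split /= big_seq [RHS]big_seq.
by apply: eq_bigr => b /EP [rb _]; rewrite (chi_dec D rb) addrC.
Qed.

(** * The level-zero functional and the length of a coset *)

Context (ell : nodes -> R).
Hypothesis ell_ge0 : forall i, i != ord0 -> 0 <= ell i.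
Hypothesis ell_lev0 : \sum_i a i * ell i = 0.

(** The product with the level-zero weight, [ell i] standing for (alpha_i, lambda). *)
Definition Lam (v : vec) : R := \sum_i v i 0 * ell i.

Lemma LamD u v : Lam (u + v) = Lam u + Lam v.
Proof. by rewrite -big_split /=; apply: eq_bigr => j _; rewrite mxE mulrDl. Qed.
Lemma LamZ c u : Lam (c *: u) = c * Lam u.
Proof. by rewrite mulr_sumr; apply: eq_bigr => j _; rewrite mxE -mulrA. Qed.
Lemma LamN u : Lam (- u) = - Lam u.
Proof. by rewrite -scaleN1r LamZ mulN1r. Qed.
Lemma Lam_delta : Lam delta = 0.
Proof. by rewrite -[RHS]ell_lev0; apply: eq_bigr => i _; rewrite mxE. Qed.
Lemma Lam_fpos (b : vec) : b ord0 0 = 0 -> posv b -> 0 <= Lam b.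
Proof.
move=> b0 pb; apply: sumr_ge0 => i _; have [->|i0] := eqVneq i ord0.
  by rewrite b0 mul0r.
by rewrite mulr_ge0 ?ell_ge0.
Qed.
Lemma Lam_gt0_mem b : droot b -> 0 < Lam b -> b \in E.
Proof.
move=> [rb b0] h; apply/EP; split=> //; case: (root_sign rb) => // N.
have := Lam_fpos _ N; rewrite mxE b0 oppr0 LamN => /(_ erefl); lra.
Qed.

(* The part of the semi-infinite length which only depends on the coset of the
   element modulo the stabilizer of the level-zero weight. *)
Definition wlen (s : seq nodes) : R := \sum_(b <- E | 0 < Lam b) chi s b.

(** By [chi_cons] only the summands at g and -g change, where g = w^-1 (fbas i), and at most one of
    these roots has positive [Lam]. *)
Lemma wlen_cons_dec i s w xi : dec s w xi ->
  wlen (i :: s) = wlen s + ((0 < Lam (act (rev w) (fbas i)))%R%:R -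
                            (Lam (act (rev w) (fbas i)) < 0)%R%:R).
Proof.
move=> D; have [fw _ _ _] := D; set g := act (rev w) (fbas i).
have rg : droot g by apply: droot_act; [rewrite fword_rev | exact: droot_fbas].
have memE c : droot c -> ((c \in E) && (0 < Lam c)) = (0 < Lam c).
  by move=> rc; apply: andb_idl; exact: Lam_gt0_mem.
have -> : wlen (i :: s) = \sum_(b <- E | 0 < Lam b)
    (chi s b + ((b == g)%:R - (b == - g)%:R)).
  rewrite /wlen big_seq_cond [RHS]big_seq_cond; apply: eq_bigr => b /andP[/EP [rb _] _].
  rewrite (chi_cons i D rb); congr (_ + (_%:R - _%:R)).
    by congr nat_of_bool; apply/eqP/eqP => [e|->]; rewrite /g ?act_revK // -e act_rev.
  by congr nat_of_bool; apply/eqP/eqP => [e|->]; rewrite /g -?actN ?act_revK // -e act_rev.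
rewrite big_split /= sumrB !sum_indic // memE // memE; last exact: droot_opp.
by rewrite LamN oppr_gt0.
Qed.

(** The translation part adds multiples of delta, on which [Lam] vanishes; c is k for i = 0 and 1
    otherwise. *)
Lemma Lam_simple i s w xi : dec s w xi ->
  exists2 c, 0 < c & Lam (act (rev s) (bas i)) = c * Lam (act (rev w) (fbas i)).
Proof.
move=> [fw _ _ DE].
have e : Lam (act (rev s) (fbas i)) = Lam (act (rev w) (fbas i)).
  have := DE (act (rev w) (fbas i)); rewrite act_revK => /(congr1 (act (rev s))).
  rewrite act_rev actB actZ act_delta => /(congr1 Lam).
  by rewrite LamD LamN LamZ Lam_delta mulr0 subr0.
rewrite -e /fbas; case: eqP => [->|_]; last by exists 1; rewrite ?ltr01 ?mul1r.
exists k; first exact: (ac_kgt0 H).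
by rewrite bas0E -scalerN actD act_delta actZ LamD Lam_delta add0r LamZ.
Qed.

Lemma wlen_cons_gt i s : 0 < Lam (act (rev s) (bas i)) -> wlen (i :: s) = wlen s + 1.
Proof.
have [w [xi D]] := dec_exists s; have [c c0 ->] := Lam_simple i D.
by rewrite pmulr_rgt0 // (wlen_cons_dec i D) => h; rewrite h [_ < 0]ltNge ltW //= subr0.
Qed.
Lemma wlen_cons_lt i s : Lam (act (rev s) (bas i)) < 0 -> wlen (i :: s) = wlen s - 1.
Proof.
have [w [xi D]] := dec_exists s; have [c c0 ->] := Lam_simple i D.
by rewrite pmulr_rlt0 // (wlen_cons_dec i D) => h; rewrite h [0 < _]ltNge ltW //= sub0r.
Qed.
Lemma wlen_cons_eq i s : Lam (act (rev s) (bas i)) = 0 -> wlen (i :: s) = wlen s.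
Proof.
have [w [xi D]] := dec_exists s; have [c c0 ->] := Lam_simple i D.
move/eqP; rewrite mulf_eq0 gt_eqF //= (wlen_cons_dec i D) => /eqP ->.
by rewrite ltxx subrr addr0.
Qed.

(** * Reflections in positive real roots *)

Lemma coord0D (u v : vec) : (u + v) ord0 0 = u ord0 0 + v ord0 0.
Proof. by rewrite mxE. Qed.
Lemma coord0N (v : vec) : (- v) ord0 0 = - v ord0 0.
Proof. by rewrite mxE. Qed.
Lemma coord0Z c (v : vec) : (c *: v) ord0 0 = c * v ord0 0.
Proof. by rewrite mxE. Qed.

(** The factor c is k for images of alpha_0 = delta - k theta, whose finite part is k times a root,
    and 1 for images of the other simple roots. *)
Lemma root_split b : root b -> exists g c z,
  [/\ droot g, 0 < c, z \is a Num.int & b = c *: (g + (z * dn g / k) *: delta)].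
Proof.
case=> s [j ->]; have [w [xi [fw xii xi0 DE]]] := dec_exists s.
have [->|j0] := eqVneq j ord0; last first.
  exists (act w (bas j)), 1, (- (form (bas j) xi / dn (bas j))); split=> //.
  - by apply: droot_act => //; exact: droot_bas.
  - by rewrite rpredN coroot_int //; apply: root_colat; exact: root_bas.
  rewrite scale1r DE dn_act -scaleNr; congr (_ + _ *: _).
  by field; rewrite k_neq0 root_dn_neq0 //; exact: root_bas.
have [rt t0] := droot_theta.
exists (- act w theta), k, (1 + form theta xi); split; first by apply/droot_opp/droot_act.
- exact: (ac_kgt0 H).
- by rewrite rpredD ?rpred1 // form_int //; exact: theta_int.
rewrite bas0E -scaleNr actD actZ act_delta DE dnN dn_act dn_theta.
apply/matrixP => p q; rewrite ord1 !mxE; move: (act w theta p 0) => x.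
by field; rewrite k_neq0.
Qed.

(** The reflection is an involution of the index set: images stay in [E] because [Lam] is positive
    on them. *)
Lemma sum_refl_inv (F : vec -> R) g : droot g ->
  \sum_(b <- E | (0 < Lam b) && (0 < Lam (refl g b))) F (refl g b) =
  \sum_(b <- E | (0 < Lam b) && (0 < Lam (refl g b))) F b.
Proof.
move=> rg; have [rg1 _] := rg; have gK := reflK (root_dn_neq0 rg1).
rewrite -big_filter -[RHS]big_filter -(big_map (refl g) xpredT F).
apply: perm_big; apply: uniq_perm; rewrite ?filter_uniq // ?map_inj_uniq ?filter_uniq //.
  exact: inv_inj.
move=> b; apply/mapP/idP => [[c]|].
  rewrite !mem_filter => /andP[/andP[c1 c2] cE] ->; rewrite c2 gK c1 /=.
  by apply: Lam_gt0_mem => //; apply: droot_refl => //; have [] := (EP c).1 cE.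
rewrite mem_filter => /andP[/andP[b1 b2] bE]; exists (refl g b); last by rewrite gK.
rewrite mem_filter b2 gK b1 /=; apply: Lam_gt0_mem => //.
by apply: droot_refl => //; have [] := (EP b).1 bE.
Qed.

(* The roots [c] of [E] with [Lam c > 0] kept positive by the reflection contribute
   nothing in total; each of the others gains, and [g] gains strictly. *)
Lemma wlen_refl s t b : root b -> posv b -> 0 < Lam (act (rev s) b) ->
  (forall v, act t v = refl b (act s v)) -> wlen s < wlen t.
Proof.
move=> rb pb Lb tE; set e := act (rev s) b in Lb.
have re : root e by exact: root_act.
have [g [c [z [rg c0 zi eE]]]] := root_split re; have [rg1 g0] := rg.
have bE : b = act s e by rewrite act_revK.
have dg0 := root_dn_gt0 rg1; have dgn := root_dn_neq0 rg1.
have de : dn e = c ^+ 2 * dn g.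
  by rewrite /dn {1 2}eE formZl formZr formDl !formDr !formZl !formZr !form_deltar form_deltal; ring.
have fe v : form e v = c * form g v.
  by rewrite {1}eE formZl formDl formZl form_deltal mulr0 addr0.
have Lg : 0 < Lam g.
  by move: Lb; rewrite eE LamZ LamD LamZ Lam_delta mulr0 addr0 pmulr_rgt0.
have cn : c != 0 by rewrite gt_eqF.
(* With e = s^-1 b one has t = s s_e, and s_e is s_g up to a shift along delta. *)
have tact v : act t v = act s (refl g v) - (z * form g v / k) *: delta.
  rewrite tE bE refl_act -(act_delta s) -actZ -actB; congr (act s _).
  rewrite /refl fe de eE scalerA scalerDr scalerA opprD addrA.
  by congr (_ - _ *: _ - _ *: _); field; rewrite cn dgn ?k_neq0.
have chit x : droot x -> chi t x = chi s (refl g x) + z * (form g x / dn x).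
  move=> [rx x0]; rewrite /chi tact finD -scaleNr finZ fin_delta scaler0 addr0.
  rewrite coord0D coord0Z delta0 mulr1 {2}/dn form_refl // -/(dn x).
  by field; rewrite root_dn_neq0 // k_neq0.
have p0 : 0 < dn b by exact: root_dn_gt0.
have b0 : 0 <= b ord0 0 by exact: pb.
have htb : 0 < ht b by apply/(root_ht_gt0 rb).
have fb v : form b (act s v) = c * form g v by rewrite bE form_act fe.
have db : dn b = c ^+ 2 * dn g by rewrite bE dn_act.
rewrite -subr_gt0 /wlen -sumrB (bigID (fun x => 0 < Lam (refl g x))) /=.
rewrite [X in _ < X + _](_ : _ = 0) ?add0r; last first.
  (* s_g preserves the index set and changes the sign of (g, x). *)
  have X0 : \sum_(x <- E | (0 < Lam x) && (0 < Lam (refl g x))) form g x / dn x = 0.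
    have := sum_refl_inv (fun x => form g x / dn x) rg.
    under eq_bigr => x _.
      rewrite /dn form_refl // -/(dn _) -[form g _]formC -{2}[g](reflK dgn) form_refl //.
      rewrite refl_self // formNr mulNr formC.
      over.
    by rewrite sumrN => h; lra.
  transitivity (\sum_(x <- E | (0 < Lam x) && (0 < Lam (refl g x)))
     (chi s (refl g x) + z * (form g x / dn x) - chi s x)).
    rewrite big_seq_cond [RHS]big_seq_cond; apply: eq_bigr => x /andP[/EP [rx _] _].
    by rewrite chit.
  by rewrite sumrB big_split /= -mulr_sumr X0 sum_refl_inv // mulr0 addr0 subrr.
have intm x u : droot x -> act u x ord0 0 * k / dn x \is a Num.int := @coord0_int u x.
(* Here (g, x) > 0, so t x arises from s x by subtracting a positive multiple of b. If alpha_0 does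
   not occur in b, this can only turn the sign term from 0 to 1; otherwise the integer summand grows
   by at least 1, which compensates for a loss of the sign term. *)
have cmp x : droot x -> 0 < Lam x -> ~~ (0 < Lam (refl g x)) -> 0 <= chi t x - chi s x.
  move=> rx Lx; rewrite -leNgt /refl LamD LamN LamZ => Lr; have [rx1 x0] := rx.
  have fx : 0 < form g x.
    by move: Lr; rewrite leNgt; apply: contraNT; rewrite -leNgt => h;
       rewrite subr_gt0; apply: le_lt_trans Lx; rewrite pmulr_lle0 // pmulr_lle0 ?invr_gt0.
  have := intm x s rx; have := intm x t rx; rewrite /chi !tE /refl; set v := act s x.
  set p := form b v / dn b; have p1 : 0 < p by rewrite /p fb divr_gt0 // mulr_gt0.
  have dx0 := root_dn_gt0 rx1; have k0 := ac_kgt0 H.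
  rewrite !(coord0D, coord0N, coord0Z).
  move: b0; rewrite le_eqVlt => /predU1P [b0|b0] i1 i2.
    rewrite -b0 mulr0 subr0 opprD addrACA subrr add0r subr_ge0 ler_nat /neg.
    rewrite finD finN finZ (fin_id (esym b0)) htD htN htZ.
    case: (ltP (ht (fin v)) 0) => // h; rewrite (_ : _ < 0) //.
    by have := mulr_gt0 p1 htb; lra.
  have : 1 <= v ord0 0 * k / dn x - (v ord0 0 - p * b ord0 0) * k / dn x.
    apply: int_gt0_ge1; first by rewrite rpredB.
    by rewrite -!mulrBl opprB addrC subrK divr_gt0 // (mulr_gt0 (mulr_gt0 p1 b0) k0).
  by rewrite !mulNr; case: (neg _); case: (neg _) => /=; lra.
(* Strict gain at g, where s_b reverses the component along b: either the sign term passes from 0 to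
   1, or the integer summand grows by twice a positive integer and the sign term loses at most 1. *)
have gin : g \in E by exact: Lam_gt0_mem.
have Lgr : ~~ (0 < Lam (refl g g)) by rewrite refl_self // LamN oppr_gt0 -leNgt ltW.
rewrite big_mkcond (bigD1_seq g) //= Lg Lgr /=.
apply: ltr_pwDl; last first.
  rewrite big_seq_cond; apply: sumr_ge0 => x /andP[/EP [rx _] _].
  by case: ifP => // /andP[h1 h2]; exact: cmp.
have := intm g s rg; rewrite /chi tE; set v := act s g.
have vE : b = c *: (v + (z * dn g / k) *: delta).
  by rewrite bE {1}eE actZ actD actZ act_delta.
have k0 := ac_kgt0 H.
have vE2 : v = c^-1 *: b - (z * dn g / k) *: delta.
  by rewrite vE scalerA mulVf // scale1r addrK.
have rv : refl b v = - (c^-1 *: b) - (z * dn g / k) *: delta.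
  rewrite /refl fb db formE_dn (_ : c * _ / _ = c^-1 + c^-1); last by field; rewrite cn dgn.
  rewrite scalerDl {1}vE2; move: (c^-1 *: b) (_ *: delta) => x y.
  by rewrite opprD addrA [x - y - x]addrAC subrr add0r addrC.
rewrite rv [in X in _ < X - _]finD [in X in _ < X - _]finN finN finZ finZ fin_delta scaler0 subr0.
have fv : fin v = c^-1 *: fin b.
  by rewrite vE2 finD finN !finZ fin_delta scaler0 subr0.
rewrite fv /neg htN !htZ => i1.
rewrite !(coord0D, coord0N, coord0Z) delta0 mulr1.
have v0 : v ord0 0 = c^-1 * b ord0 0 - z * dn g / k.
  by rewrite vE2 !(coord0D, coord0N, coord0Z) delta0 mulr1.
move: b0; rewrite le_eqVlt => /predU1P [b0|b0].
  rewrite v0 -b0 mulr0 oppr0 !add0r (fin_id (esym b0)).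
  have h : 0 < c^-1 * ht b by rewrite mulr_gt0 ?invr_gt0.
  by rewrite oppr_lt0 h [_ < 0]ltNge ltW //=; lra.
have : 1 <= c^-1 * b ord0 0 * k / dn g.
  have e1 : c^-1 * b ord0 0 * k / dn g = v ord0 0 * k / dn g + z.
    by rewrite v0; field; rewrite cn dgn k_neq0.
  apply: int_gt0_ge1; first by rewrite e1 rpredD.
  by rewrite divr_gt0 // !mulr_gt0 // invr_gt0.
rewrite v0 (_ : - (- (c^-1 * b ord0 0) - z * dn g / k) * k / dn g = c^-1 * b ord0 0 * k / dn g + z); last first.
  by field; rewrite cn dgn k_neq0.
rewrite (_ : - (c^-1 * b ord0 0 - z * dn g / k) * k / dn g = - (c^-1 * b ord0 0 * k / dn g) + z); last first.
  by field; rewrite cn dgn k_neq0.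
by move: (c^-1 * _ * k / _) => y y1; case: (_ < 0)%R; case: (_ < 0)%R => /=; lra.
Qed.

(** * Vanishing of [chi] at roots orthogonal to the weight *)

Lemma act_theta_nonorth j : exists u, form (act u theta) (bas j) != 0.
Proof.
(* The nodes not orthogonal to the whole orbit of theta. They include 0 and are closed under
   adjacency; connectedness is applied to the indicator function. *)
pose K i := `[< exists u, form (act u theta) (bas i) != 0 >].
have K0 : K ord0.
  apply/asboolP; exists [::]; rewrite /= formC bas0E -scaleNr formDl formZl form_deltal add0r.
  by rewrite formE_dn dn_theta mulr1 mulf_neq0 ?oppr_eq0 ?k_neq0 ?pnatr_eq0.
have adj i i' : A i i' != 0 -> K i -> K i'.
  move=> Aii /asboolP [u ui]; apply/asboolP.
  have [z|nz] := eqVneq (form (act u theta) (bas i')) 0; last by exists u.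
  exists (i :: u); rewrite act_cons /srefl formDl z add0r formNl formZl oppr_eq0.
  rewrite mulf_neq0 //; last by rewrite form_basl cpair_bas mulf_neq0 ?d_neq0.
  by apply: contraNneq ui => c0; rewrite formC form_basl c0 mulr0.
have Asym i i' : A i i' != 0 -> A i' i != 0.
  by apply: contraNneq => Z; have := ac_sym H i i'; rewrite Z mulr0 => /eqP; rewrite mulf_eq0 (negbTE (d_neq0 i)).
apply/asboolP; rewrite -/(K j).
have := ac_conn H (y := fun i => (K i)%:R) _ j.
rewrite K0 => hK; case Kj: (K j) hK => // hK; exfalso.
have /hK : forall i i', A i i' != 0 -> (K i)%:R = (K i')%:R :> R.
  move=> i i' Aii; congr (nat_of_bool _)%:R; apply/idP/idP; first exact: adj.
  exact/adj/Asym.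
by move/eqP; rewrite eq_sym oner_eq0.
Qed.

(** The word of u (s_theta s_0) u^-1. *)
Lemma theta_translation u : exists t, forall v,
  act t v = v + (form (act u theta) v / k) *: delta.
Proof.
have [tw [ti [ft ti0 tE]]] := theta_word.
exists (u ++ ((tw ++ ti :: rev tw) ++ [:: ord0]) ++ rev u) => v.
rewrite act_cat (act_cat _ (rev u)) (act_cat (tw ++ ti :: rev tw) [:: ord0]).
rewrite -refl_word -tE /= srefl0E reflD reflZ.
rewrite (reflK (_ : dn theta != 0)) ?dn_theta ?oner_eq0 //.
rewrite /refl form_deltar mul0r scale0r subr0 actD actZ act_delta act_revK.
by rewrite form_actl.
Qed.

(** Some conjugate of theta is not orthogonal to g, and it may be taken under the finite group since
    delta is in the radical. By [sgn_theta], either g is itself a conjugate up to sign or <g^vee, u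
    theta> is 1 or -1; s_theta corrects the sign. *)
Lemma pm_theta_or g : droot g ->
  (exists u, g = act u theta) \/ exists u, form (act u theta) g = - dn g.
Proof.
have [tw [ti [ft ti0 tE]]] := theta_word.
have flip u : act (u ++ (tw ++ ti :: rev tw)) theta = - act u theta.
  by rewrite act_cat -refl_word -tE refl_self ?actN // dn_theta oner_eq0.
move=> [rg g0]; have [s [j gE]] := rg.
have [u uj] := act_theta_nonorth j.
have ug : form (act (s ++ u) theta) g != 0 by rewrite gE act_cat form_act.
have [w [xi D]] := dec_exists (s ++ u); have [fw _ _ DE] := D.
rewrite DE formBl formZl form_deltal mulr0 subr0 in ug.
set b := act (rev w) g.
have rb : droot b by apply: droot_act; rewrite ?fword_rev.
have fb : form theta b = form (act w theta) g by rewrite form_actl.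
have [bt|bt] := eqVneq b theta; first by left; exists w; rewrite -bt act_revK.
have [bt'|bt'] := eqVneq b (- theta).
  by left; exists (w ++ (tw ++ ti :: rev tw)); rewrite flip -actN -bt' act_revK.
have := sgn_theta rb; rewrite (negbTE bt) (negbTE bt') subrr => hE.
have dg : dn b = dn g by rewrite dn_act.
have dg0 := root_dn_gt0 rg.
have V : form (act w theta) g / dn g = 1 \/ form (act w theta) g / dn g = -1.
  have nz : form (act w theta) g / dn g != 0 by rewrite mulf_neq0 // invr_neq0 // root_dn_neq0.
  move: hE nz; rewrite [form b theta]formC fb dg; move: (_ / _) => x.
  by case: (neg _); case: (neg _) => /= hE nz; [| left|right|]; try lra;
     exfalso; move/eqP: nz; apply; lra.
right; case: V => V; last first.
  by exists w; rewrite -[LHS](divfK (lt0r_neq0 dg0)) V mulN1r.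
exists (w ++ (tw ++ ti :: rev tw)).
by rewrite flip formNl -[form _ _](divfK (lt0r_neq0 dg0)) V mul1r.
Qed.

(** A root one step along delta from -g, up to scaling: an image of alpha_0 if g is conjugate to
    theta, otherwise a translate of -g. It serves as the second test root in [chi_eq0]. *)
Lemma aff_shift g : droot g -> exists2 c, 0 < c & root (c *: (- g + (dn g / k) *: delta)).
Proof.
move=> rg; case: (pm_theta_or rg) => [[u gE]|[u ug]].
  exists k; first exact: (ac_kgt0 H).
  suff -> : k *: (- g + (dn g / k) *: delta) = act u (bas ord0) by exists u, ord0.
  rewrite bas0E -scaleNr actD actZ act_delta -gE gE dn_act dn_theta.
  by rewrite scalerDr scalerN scaleNr scalerA mul1r divff ?k_neq0 // scale1r addrC.
exists 1; rewrite ?ltr01 // scale1r; have [t tE] := theta_translation u.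
have := root_act t (root_opp (proj1 rg)); rewrite tE formNr ug opprK; exact.
Qed.

(** Positivity of the two images squeezes the integer [m] between 0 and 1. For m = 0 the finite part
    of s g is positive, for m = 1 it is negative, and the two summands of [chi] cancel. *)
Lemma chi_eq0 s g : droot g -> posv (act s g) ->
  (forall c, 0 < c -> root (c *: (- g + (dn g / k) *: delta)) ->
     posv (act s (c *: (- g + (dn g / k) *: delta)))) ->
  chi s g = 0.
Proof.
move=> rg p1 p2; have [rg1 g0] := rg; have [c c0 rc] := aff_shift rg.
have q := p2 c c0 rc; have ra := root_act s rc.
have M := coord0_int s rg; have dg0 := root_dn_gt0 rg1; have k0 := ac_kgt0 H.
have c0' := root_act s rg1.
move: q ra; rewrite actZ actD actN actZ act_delta; move: p1 c0' M; rewrite /chi.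
set v := act s g => p1 rv M q rq.
have q0 := q ord0; rewrite coord0Z coord0D coord0N coord0Z delta0 mulr1 pmulr_rge0 // in q0.
have fpos (x : vec) : root x -> posv x -> x ord0 0 = 0 -> 0 < ht (fin x).
  by move=> rx px x0; rewrite fin_id //; apply/(root_ht_gt0 rx).
have v0 := p1 ord0; set m := v ord0 0 * k / dn g in M.
have m0 : 0 <= m by rewrite /m divr_ge0 ?(ltW dg0) // mulr_ge0 // ltW.
have m1 : m <= 1.
  by rewrite ler_pdivrMr // mul1r -ler_pdivlMr //; lra.
rewrite !mulNr -/m.
have [mz|mz] := eqVneq m 0.
  have vz : v ord0 0 = 0.
    by apply/eqP; move/eqP: mz; rewrite /m !mulf_eq0 invr_eq0 (gt_eqF k0) (gt_eqF dg0) !orbF.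
  by rewrite mz oppr0 add0r /neg ltNge ltW // fpos.
have me : m = 1.
  have : 1 <= m by apply: int_gt0_ge1 => //; rewrite lt_neqAle eq_sym mz.
  by move=> ?; apply/eqP; rewrite eq_le m1.
have vz : v ord0 0 = dn g / k.
  by rewrite -[dn g]mul1r -me /m; field; rewrite !gt_eqF.
have := fpos _ rq q; rewrite coord0Z coord0D coord0N coord0Z delta0 mulr1 vz addrC subrr mulr0.
move=> /(_ erefl); rewrite finZ finD finN finZ fin_delta scaler0 addr0 htZ htN pmulr_rgt0 //.
by rewrite oppr_gt0 me /neg => ->; rewrite addrC subrr.
Qed.

(** Up to sign the finite part has nonnegative coefficients, so [Lam] is a sum of nonnegative terms
    which must all vanish. *)
Lemma Lam_eq0_coord (b : vec) : root b -> Lam b = 0 ->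
  forall i, i != ord0 -> 0 < ell i -> fin b i 0 = 0.
Proof.
move=> rb Lb i i0 li; have [g [c [z [[rg g0] c0 zi bE]]]] := root_split rb.
have Lg : Lam g = 0.
  by apply/eqP; move/eqP: Lb; rewrite bE LamZ LamD LamZ Lam_delta mulr0 addr0 mulf_eq0 gt_eqF.
have fb : fin b = c *: g by rewrite bE finZ finD finZ fin_delta scaler0 addr0 fin_id.
rewrite fb mxE; suff -> : g i 0 = 0 by rewrite mulr0.
wlog pg : g {rg} g0 Lg {bE fb} / posv g.
  move=> W; case: (root_sign rg) => pg; first exact: W.
  have := W (- g); rewrite !mxE LamN g0 Lg oppr0 => /(_ erefl erefl pg) /eqP.
  by rewrite oppr_eq0 => /eqP.
have T : forall i, true -> 0 <= g i 0 * ell i.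
  move=> m _; have [->|m0] := eqVneq m ord0; first by rewrite g0 mul0r.
  by rewrite mulr_ge0 ?ell_ge0.
have := psumr_eq0P T Lg; move=> /(_ i isT) /eqP.
by rewrite mulf_eq0 (gt_eqF li) orbF => /eqP.
Qed.

Lemma wlen_full s : (forall b, b \in E -> Lam b = 0 -> chi s b = 0) ->
  \sum_(b <- E) chi s b = wlen s.
Proof.
move=> Z; rewrite /wlen [RHS]big_mkcond /= big_seq [RHS]big_seq; apply: eq_bigr => b bE.
case: ifP => // Lb; apply: Z => //; have [[_ b0] pb] := (EP b).1 bE.
by apply/eqP; rewrite eq_le Lam_fpos // andbT leNgt Lb.
Qed.

End AffineCartan.

(** * The twisted affine Cartan matrices *)

Section TypeData.
Context (X : twisted_type) (hX : admissible X).

(* Half the squared lengths of the simple roots, the shortest one of the finite part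
   having length 2. *)
Definition half_norm (i : nat) : nat :=
  match X with
  | TwD2 l => if (i == 0) || (i == l) then 1 else 2
  | TwA2odd l => if i == l then 2 else 1
  | TwE62 => nth 0 [:: 1; 1; 1; 2; 2] i
  | TwD43 => nth 0 [:: 1; 1; 3] i
  | TwA2even l => if i == 0 then 4 else if i == l then 1 else 2
  end%N.

Definition theta_mult : nat := match X with TwA2even _ => 2 | _ => 1 end%N.

Lemma half_norm_gt0 i : (i <= rank X)%N -> (0 < half_norm i)%N.
Proof.
rewrite /half_norm /rank; case: X => [l|l|||l] hi; try by do ?case: ifP.
  by case: i hi => [|[|[|[|[|]]]]].
by case: i hi => [|[|[|]]].
Qed.

Lemma mark_gt0 i : (i <= rank X)%N -> (0 < mark X i)%N.
Proof.
rewrite /mark /rank; case: X => [l|l|||l] hi; try by do ?case: ifP.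
  by case: i hi => [|[|[|[|[|]]]]].
by case: i hi => [|[|[|]]].
Qed.

Lemma mark0 : mark X 0 = 1%N. Proof. by rewrite /mark; case: X. Qed.

Lemma cartan_diag i : cartan X i i = 2.
Proof. by rewrite /cartan eqxx. Qed.

Lemma cartan_off i j : i != j -> cartan X i j <= 0.
Proof.
move=> /negbTE ij; rewrite /cartan ij; case: X => [l|l|||l]; do ?case: ifP => //.
Qed.

Lemma half_norm_sym i j : (i <= rank X)%N -> (j <= rank X)%N ->
  (half_norm i)%:Z * cartan X i j = (half_norm j)%:Z * cartan X j i.
Proof.
have [-> //|ij] := eqVneq i j; have ji : (j == i) = false by rewrite eq_sym (negbTE ij).
rewrite /cartan /half_norm (negbTE ij) ji; move: hX ij {ji}.
case: X => [l|l|||l] /= hl ij hi hj.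
- by do ?case: ifP => ?; lia.
- by do ?case: ifP => ?; lia.
- by case: i ij hi => [|[|[|[|[|i]]]]] // ij hi; case: j ij hj => [|[|[|[|[|j]]]]].
- by case: i ij hi => [|[|[|i]]] // ij hi; case: j ij hj => [|[|[|j]]].
- by do ?case: ifP => ?; lia.
Qed.

(** Restricts a row of the Cartan matrix to a node and its neighbours, so that sums over a symbolic
    rank become explicit. *)
Lemma sum_support (N : nat) (f : nat -> int) (L : seq nat) : uniq L -> all (fun j => j < N)%N L ->
  (forall j, (j < N)%N -> j \notin L -> f j = 0) -> \sum_(j < N) f j = \sum_(j <- L) f j.
Proof.
move=> uL aL fL; rewrite -(big_mkord xpredT) (bigID (mem L)) /= [X in _ + X]big1_seq ?addr0.
  rewrite -big_filter; apply: perm_big; apply: uniq_perm => //.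
    by rewrite filter_uniq // iota_uniq.
  move=> j; rewrite mem_filter mem_index_iota /=; apply: andb_idr => /(allP aL); exact.
by move=> j /andP[jL]; rewrite mem_index_iota /= => jN; exact: fL.
Qed.

Lemma cartan_mark i : (i <= rank X)%N ->
  \sum_(j < (rank X).+1) cartan X i j * (mark X j)%:Z = 0.
Proof.
move: hX; case: X => [l|l|||l] /= hl hi.
- pose L := if i == 0%N then [:: 0; 1]%N else if i == l then [:: l.-1; l] else [:: i.-1; i; i.+1].
  apply: (etrans (sum_support (f := fun j => cartan (TwD2 l) i j * (mark (TwD2 l) j)%:Z) (L := L) _ _ _)); rewrite /L.
  + by do ?[case: ifP => ?] => /=; rewrite ?inE; lia.
  + by do ?[case: ifP => ?] => /=; lia.
  + move=> j jl; rewrite /cartan /mark; do ?[case: ifP => ?]; rewrite ?inE; lia.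
  + do ?[case: ifP => ?]; rewrite !big_cons big_nil /cartan /mark; do ?[case: ifP => ?]; lia.
- case: i hi => [|[|[|i]]] hi.
  apply: (etrans (sum_support (f := fun j => cartan (TwA2odd l) _ j * (mark (TwA2odd l) j)%:Z) (L := [:: 0; 2]%N) _ _ _)) => /=.
  + by rewrite ?inE; lia.
  + by lia.
  + move=> j jl; rewrite /cartan /mark ?inE /=; do ?[case: ifP => ? /=]; lia.
  + rewrite !big_cons big_nil /cartan /mark /=; do ?[case: ifP => ? /=]; lia.
  apply: (etrans (sum_support (f := fun j => cartan (TwA2odd l) _ j * (mark (TwA2odd l) j)%:Z) (L := [:: 1; 2]%N) _ _ _)) => /=.
  + by rewrite ?inE; lia.
  + by lia.
  + move=> j jl; rewrite /cartan /mark ?inE /=; do ?[case: ifP => ? /=]; lia.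
  + rewrite !big_cons big_nil /cartan /mark /=; do ?[case: ifP => ? /=]; lia.
  apply: (etrans (sum_support (f := fun j => cartan (TwA2odd l) _ j * (mark (TwA2odd l) j)%:Z) (L := [:: 0; 1; 2; 3]%N) _ _ _)) => /=.
  + by rewrite ?inE; lia.
  + by lia.
  + move=> j jl; rewrite /cartan /mark ?inE /=; do ?[case: ifP => ? /=]; lia.
  + rewrite !big_cons big_nil /cartan /mark /=; do ?[case: ifP => ? /=]; lia.
  have [il|il] := eqVneq i.+3 l.
  apply: (etrans (sum_support (f := fun j => cartan (TwA2odd l) _ j * (mark (TwA2odd l) j)%:Z) (L := [:: i.+2; i.+3]) _ _ _)) => /=.
  + by rewrite ?inE; lia.
  + by lia.
  + move=> j jl; rewrite /cartan /mark ?inE /=; do ?[case: ifP => ? /=]; lia.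
  + rewrite !big_cons big_nil /cartan /mark /=; do ?[case: ifP => ? /=]; lia.
  apply: (etrans (sum_support (f := fun j => cartan (TwA2odd l) _ j * (mark (TwA2odd l) j)%:Z) (L := [:: i.+2; i.+3; i.+4]) _ _ _)) => /=.
  + by rewrite ?inE; lia.
  + by lia.
  + move=> j jl; rewrite /cartan /mark ?inE /=; do ?[case: ifP => ? /=]; lia.
  + rewrite !big_cons big_nil /cartan /mark /=; do ?[case: ifP => ? /=]; lia.
- by rewrite !big_ord_recl big_ord0; case: i hi => [|[|[|[|[|]]]]].
- by rewrite !big_ord_recl big_ord0; case: i hi => [|[|[|]]].
- case: i hi => [|i] hi.
  apply: (etrans (sum_support (f := fun j => cartan (TwA2even l) _ j * (mark (TwA2even l) j)%:Z) (L := [:: 0; 1]%N) _ _ _)) => /=.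
  + by rewrite ?inE; lia.
  + by lia.
  + move=> j jl; rewrite /cartan /mark ?inE /=; do ?[case: ifP => ? /=]; lia.
  + rewrite !big_cons big_nil /cartan /mark /=; do ?[case: ifP => ? /=]; lia.
  have [il|il] := eqVneq i.+1 l.
  apply: (etrans (sum_support (f := fun j => cartan (TwA2even l) _ j * (mark (TwA2even l) j)%:Z) (L := [:: i; i.+1]) _ _ _)) => /=.
  + by rewrite ?inE; lia.
  + by lia.
  + move=> j jl; rewrite /cartan /mark ?inE /=; do ?[case: ifP => ? /=]; lia.
  + rewrite !big_cons big_nil /cartan /mark /=; do ?[case: ifP => ? /=]; lia.
  apply: (etrans (sum_support (f := fun j => cartan (TwA2even l) _ j * (mark (TwA2even l) j)%:Z) (L := [:: i; i.+1; i.+2]) _ _ _)) => /=.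
  + by rewrite ?inE; lia.
  + by lia.
  + move=> j jl; rewrite /cartan /mark ?inE /=; do ?[case: ifP => ? /=]; lia.
  + rewrite !big_cons big_nil /cartan /mark /=; do ?[case: ifP => ? /=]; lia.
Qed.

(* A neighbour of [i] one step closer to the node 0. *)
Definition parent (i : nat) : nat :=
  match X with
  | TwA2odd _ => if i == 2 then 0 else if i == 1 then 2 else i.-1
  | _ => i.-1
  end%N.

Lemma cartan_parent i : (0 < i <= rank X)%N -> cartan X i (parent i) != 0.
Proof.
rewrite /cartan /parent; move: hX; case: X => [l|l|||l] /= hl hi.
- by do ?[case: ifP => ?]; lia.
- by case: i hi => [|[|[|i]]] hi //=; do ?[case: ifP => ? /=]; lia.
- by do ?[case: ifP => ?]; lia.
- by do ?[case: ifP => ?]; lia.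
- by do ?[case: ifP => ?]; lia.
Qed.

Lemma conn_nat (T : Type) (y : nat -> T) :
  (forall i j, (i <= rank X)%N -> (j <= rank X)%N -> cartan X i j != 0 -> y i = y j) ->
  forall i, (i <= rank X)%N -> y i = y 0%N.
Proof.
move=> yE; have st i : (0 < i <= rank X)%N -> y i = y (parent i).
  move=> /andP[i0 hi]; apply: yE; rewrite ?hi //.
    rewrite /parent; move: hX hi i0; case: X => [l|l|||l] /= *; do ?[case: ifP => ?]; lia.
  by apply: cartan_parent; rewrite i0.
elim/ltn_ind => -[//|i] IH hi; rewrite st //.
(* In type A_(2l-1)^(2) the parent of node 1 is node 2, which is larger; two steps lead from there
   to 0. *)
have [i1|i1] := eqVneq i 0%N.
  move: hX hi st; rewrite i1 /parent; case: X => [l|l|||l] //= hl hi st.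
  by rewrite st //=; lia.
by apply: IH; rewrite /parent; case: X hi => [l|l|||l] /= *; do ?[case: ifP => ?]; lia.
Qed.

Lemma half_norm0 : half_norm 0 = (theta_mult ^ 2)%N.
Proof. by rewrite /half_norm /theta_mult; move: hX; case: X => [l|l|||l] //=; case: ifP => //; case: l. Qed.

Lemma mark_theta_mult i : (0 < i <= rank X)%N -> (theta_mult %| mark X i)%N.
Proof. by rewrite /theta_mult /mark; case: X => [l|l|||l] //= ; case: i. Qed.

(** The relation k a_i^vee = a_i (alpha_i, alpha_i) / 2, through which the central element acts as
    delta under the invariant form. *)
Lemma comark_half_norm i : (i <= rank X)%N ->
  (comark X i * theta_mult)%N = (half_norm i * mark X i)%N.
Proof.
rewrite /comark /theta_mult /half_norm /mark; move: hX; case: X => [l|l|||l] /= hl hi.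
- by do ?case: ifP => ?; lia.
- by do ?[case: ifP => ? /=]; lia.
- by case: i hi => [|[|[|[|[|]]]]].
- by case: i hi => [|[|[|]]].
- by do ?case: ifP => ?; lia.
Qed.

Lemma affine_cartan_twisted (R : realType) :
  affine_cartan (fun i j : 'I_(rank X).+1 => (cartan X i j)%:~R : R)
    (fun i => (half_norm i)%:R) (fun i => (mark X i)%:R) theta_mult%:R.
Proof.
have lt (i : 'I_(rank X).+1) : (i <= rank X)%N by rewrite -ltnS.
split=> /=.
- by move=> i j; rewrite intr_int.
- by move=> i; rewrite cartan_diag.
- by move=> i j ij; rewrite lerz0 cartan_off.
- by move=> i; rewrite rpred_nat.
- by move=> i; rewrite ler1n half_norm_gt0.
- move=> i j; have := half_norm_sym (lt i) (lt j) => /(congr1 (fun z : int => z%:~R : R)).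
  by rewrite !intrM.
- by move=> i; rewrite ltr0n mark_gt0.
- by rewrite mark0.
- move=> i; have := cartan_mark (lt i) => /(congr1 (fun z : int => z%:~R : R)).
  rewrite rmorph_sum /= => E; rewrite -[RHS]E; apply: eq_bigr => j _.
  by rewrite intrM.
- move=> y yE i; have := @conn_nat R (fun j => y (inord j)) _ i (lt i).
  rewrite inord_val => ->; first by congr y; apply: val_inj; rewrite /= inordK.
  by move=> p q hp hq pq; apply: yE; rewrite !inordK // intr_eq0.
- by rewrite rpred_nat.
- by rewrite ltr0n /theta_mult; case: X.
- by rewrite half_norm0 natrX.
- move=> i i0; have hi : (0 < i <= rank X)%N by rewrite lt lt0n i0.
  have /dvdnP [q ->] := mark_theta_mult hi.
  by rewrite natrM mulfK ?rpred_nat // pnatr_eq0 /theta_mult; case: X.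
Qed.

End TypeData.

Lemma theta_s_mult (R : realType) (X : twisted_type) :
  theta_s R X = (theta_mult X)%:R^-1 *: (null_root R X - simple_root R ord0).
Proof. by case: X => [l|l|||l]; rewrite /theta_s /theta_mult ?invr1 ?scale1r. Qed.

(** A shape common to all types. The equation between the coefficients says that the level is zero;
    c is 2 only at node l in type A_2l^(2). *)
Lemma varpi_coef (R : realType) (X : twisted_type) (hX : admissible X) (i : Ifin X) :
  exists c e : nat, [/\ (0 < c)%N, (c * comark X (node i) = e * comark X 0)%N &
    varpi R i = c%:R *: fund_weight R (node i) - e%:R *: fund_weight R ord0].
Proof.
case: X hX i => [l|l|||l] hX i.
- exists 1%N, (comark (TwD2 l) (node i)); split=> //; first by rewrite mul1n muln1.
  by rewrite /varpi scale1r.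
- exists 1%N, (comark (TwA2odd l) (node i)); split=> //; first by rewrite mul1n muln1.
  by rewrite /varpi scale1r.
- exists 1%N, (comark TwE62 (node i)); split=> //; first by rewrite mul1n muln1.
  by rewrite /varpi scale1r.
- exists 1%N, (comark TwD43 (node i)); split=> //; first by rewrite mul1n muln1.
  by rewrite /varpi scale1r.
exists (if (node i : nat) == l then 2 else 1)%N, 1%N; split; first by case: ifP.
  by rewrite /comark; case: l hX i => // l _ i; case: ifP.
by rewrite /varpi scale1r; case: ifP.
Qed.

(** * The semi-infinite Bruhat graph *)

Section Realization.
Context (R : realType) (X : twisted_type) (hX : admissible X).
Local Notation nodes := 'I_(rank X).+1.
Local Notation vec := 'cV[R]_(rank X).+1.
Local Notation hdual := 'cV[R]_(rank X).+2.
Local Notation hsp := 'rV[R]_(rank X).+2.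
Local Notation endo := ('M[R]_((rank X).+2)).

Definition cA : nodes -> nodes -> R := fun i j => (cartan X i j)%:~R.
Definition cd : nodes -> R := fun i => (half_norm X i)%:R.
Definition ca : nodes -> R := fun i => (mark X i)%:R.
Definition ck : R := (theta_mult X)%:R.
Lemma HA : affine_cartan cA cd ca ck. Proof. exact: affine_cartan_twisted. Qed.

Local Notation act := (act cA).
Local Notation srefl := (srefl cA).
Local Notation form := (form cA cd).
Local Notation root := (root cA).
Local Notation dn := (dn cA cd).
Local Notation delta := (delta ca).

Lemma pairingDr (h : hsp) u v : pairing h (u + v) = pairing h u + pairing h v :> R.
Proof. by rewrite /pairing mulmxDr mxE. Qed.
Lemma pairingZr (h : hsp) c v : pairing h (c *: v) = c * pairing h v :> R.
Proof. by rewrite /pairing -scalemxAr mxE. Qed.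
Lemma pairingNr (h : hsp) v : pairing h (- v) = - pairing h v :> R.
Proof. by rewrite /pairing mulmxN mxE. Qed.
Lemma pairing0r (h : hsp) : pairing h 0 = 0 :> R.
Proof. by rewrite /pairing mulmx0 mxE. Qed.
Lemma pairingZl c (h : hsp) v : pairing (c *: h) v = c * pairing h v :> R.
Proof. by rewrite /pairing -scalemxAl mxE. Qed.
Lemma pairing_suml (I : Type) (r : seq I) (P : pred I) (F : I -> hsp) (v : hdual) :
  pairing (\sum_(i <- r | P i) F i) v = \sum_(i <- r | P i) pairing (F i) v.
Proof. by rewrite /pairing mulmx_suml summxE. Qed.
Lemma pairing_sumr (I : Type) (r : seq I) (P : pred I) (F : I -> hdual) (h : hsp) :
  pairing h (\sum_(i <- r | P i) F i) = \sum_(i <- r | P i) pairing h (F i).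
Proof. by rewrite /pairing mulmx_sumr summxE. Qed.
Lemma pairing_mulmx (h : hsp) (x : endo) v : pairing (h *m x) v = pairing h (x *m v).
Proof. by rewrite /pairing mulmxA. Qed.

Lemma pairing_coroot (i : nodes) (mu : hdual) :
  pairing (simple_coroot R i) mu = mu (widen_ord (leqnSn _) i) 0.
Proof. by rewrite /pairing /simple_coroot -rowE mxE. Qed.
Lemma pairing_simple (i j : nodes) : pairing (simple_coroot R i) (simple_root R j) = cA i j.
Proof. by rewrite pairing_coroot mxE /= -ltnS ltn_ord. Qed.

(** * The affine root lattice inside the weight space *)

Definition RT (v : vec) : hdual := \sum_i v i 0 *: simple_root R i.
(** The identification of roots with coroots by the invariant form: the coroot of c is [cov c]
    divided by [dn c]. *)
Definition cov (v : vec) : hsp := \sum_i (v i 0 * cd i) *: simple_coroot R i.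

Lemma RTD u v : RT (u + v) = RT u + RT v.
Proof. by rewrite -big_split; apply: eq_bigr => i _; rewrite mxE scalerDl. Qed.
Lemma RTZ c v : RT (c *: v) = c *: RT v.
Proof. by rewrite scaler_sumr; apply: eq_bigr => i _; rewrite mxE scalerA. Qed.
Lemma RTN v : RT (- v) = - RT v.
Proof. by rewrite -scaleN1r RTZ scaleN1r. Qed.
Lemma RTB u v : RT (u - v) = RT u - RT v.
Proof. by rewrite RTD RTN. Qed.
Lemma RT0 : RT 0 = 0.
Proof. by rewrite -(scale0r 0) RTZ scale0r. Qed.
Lemma RT_bas i : RT (bas R i) = simple_root R i.
Proof.
rewrite /RT (bigD1 i) //= (basE) eqxx scale1r big1 ?addr0 // => j ji.
by rewrite basE (negbTE ji) scale0r.
Qed.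
Lemma covD u v : cov (u + v) = cov u + cov v.
Proof. by rewrite -big_split; apply: eq_bigr => i _; rewrite mxE mulrDl scalerDl. Qed.
Lemma covZ c v : cov (c *: v) = c *: cov v.
Proof. by rewrite scaler_sumr; apply: eq_bigr => i _; rewrite mxE scalerA mulrA. Qed.
Lemma cov_bas i : cov (bas R i) = cd i *: simple_coroot R i.
Proof.
rewrite /cov (bigD1 i) //= basE eqxx mul1r big1 ?addr0 // => j ji.
by rewrite basE (negbTE ji) mul0r scale0r.
Qed.

Lemma pairing_RT i v : pairing (simple_coroot R i) (RT v) = cpair cA i v.
Proof.
by rewrite pairing_sumr; apply: eq_bigr => j _; rewrite pairingZr pairing_simple mulrC.
Qed.
Lemma pairing_cov u v : pairing (cov u) (RT v) = form u v.
Proof.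
by rewrite pairing_suml; apply: eq_bigr => j _; rewrite pairingZl pairing_RT mulrA.
Qed.
Lemma null_rootE : null_root R X = RT delta.
Proof. by apply: eq_bigr => i _; rewrite mxE. Qed.
Lemma RT_last v : RT v ord_max 0 = v ord0 0.
Proof.
rewrite /RT summxE (bigD1 ord0) //= big1 => [|i i0]; rewrite !mxE /= ltnn.
  by rewrite mulr1 addr0.
by rewrite (negbTE i0) mulr0.
Qed.
(** A vector in the kernel is isotropic, hence a multiple of delta, which is detected by the last
    coordinate. *)
Lemma RT_inj : injective RT.
Proof.
move=> u v E; apply/eqP; rewrite -subr_eq0; apply/eqP.
have Z : RT (u - v) = 0 by rewrite RTB E subrr.
have f0 : form (u - v) (u - v) = 0 by rewrite -pairing_cov Z pairing0r.
by rewrite (form_eq0 HA f0) -RT_last Z mxE scale0r.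
Qed.

(** * Words as matrices, real roots and coroots *)

Lemma reflection_mul (b : hdual) (bv : hsp) mu : reflection b bv *m mu = mu - pairing bv mu *: b.
Proof.
rewrite /reflection mulmxBl mul1mx -mulmxA [bv *m mu]mx11_scalar mul_mx_scalar.
by congr (_ - _).
Qed.
Lemma mul_reflection (h : hsp) b bv : h *m reflection b bv = h - pairing h b *: bv :> hsp.
Proof.
rewrite /reflection mulmxBr mulmx1 mulmxA [h *m b]mx11_scalar mul_scalar_mx.
by congr (_ - _).
Qed.

Lemma mul_reflection_mx (x : endo) b bv : x *m reflection b bv = x - x *m b *m bv.
Proof. by rewrite /reflection mulmxBr mulmx1 mulmxA. Qed.

Lemma word_prod_nil : word_prod R ([::] : seq nodes) = 1%:M.
Proof. by rewrite /word_prod big_nil. Qed.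
Lemma word_prod_cons (i : nodes) s : word_prod R (i :: s) = simple_refl R i *m word_prod R s.
Proof. by rewrite /word_prod big_cons. Qed.
Lemma word_prod_cat (s t : seq nodes) : word_prod R (s ++ t) = word_prod R s *m word_prod R t.
Proof. by rewrite /word_prod big_cat. Qed.
Lemma word_prod1 (i : nodes) : word_prod R [:: i] = simple_refl R i.
Proof. by rewrite word_prod_cons word_prod_nil mulmx1. Qed.

Lemma simple_reflK (i : nodes) : simple_refl R i *m simple_refl R i = 1%:M.
Proof.
rewrite /simple_refl mul_reflection_mx reflection_mul pairing_simple.
rewrite (_ : cA i i = 2); last exact: (ac_diag HA).
rewrite scaler_nat mulr2n opprD addrA subrr sub0r mulNmx opprK /reflection.
by rewrite subrK.
Qed.
Lemma word_prod_revr (s : seq nodes) : word_prod R s *m word_prod R (rev s) = 1%:M.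
Proof.
elim: s => [|i s IH]; first by rewrite word_prod_nil mulmx1.
rewrite rev_cons -cats1 word_prod_cat word_prod1 word_prod_cons mulmxA.
by rewrite -[_ *m _ *m _ (rev s)]mulmxA IH mulmx1 simple_reflK.
Qed.
Lemma word_prod_revl (s : seq nodes) : word_prod R (rev s) *m word_prod R s = 1%:M.
Proof. by have := word_prod_revr (rev s); rewrite revK. Qed.
Lemma word_prod_unit (s : seq nodes) : word_prod R s \in unitmx.
Proof. by have [] := mulmx1_unit (word_prod_revr s). Qed.
Lemma word_prod_inv (s : seq nodes) : invmx (word_prod R s) = word_prod R (rev s).
Proof.
by rewrite -[LHS]mulmx1 -(word_prod_revr s) mulmxA mulVmx ?word_prod_unit // mul1mx.
Qed.

Lemma simple_refl_RT i v : simple_refl R i *m RT v = RT (srefl i v).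
Proof. by rewrite reflection_mul pairing_RT RTB RTZ RT_bas. Qed.
Lemma word_prod_RT s v : word_prod R s *m RT v = RT (act s v).
Proof.
elim: s => [|i s IH]; first by rewrite word_prod_nil mul1mx.
by rewrite word_prod_cons -mulmxA IH simple_refl_RT.
Qed.
Lemma cov_simple_refl i v : cov v *m simple_refl R i = cov (srefl i v).
Proof.
rewrite mul_reflection -[simple_root R i]RT_bas pairing_cov (formC HA).
by rewrite form_basl /srefl -[in RHS]scaleNr covD covZ cov_bas scalerA mulNr scaleNr mulrC.
Qed.
Lemma cov_word s v : cov v *m word_prod R s = cov (act (rev s) v).
Proof.
elim: s v => [|i s IH] v; first by rewrite word_prod_nil mulmx1.
by rewrite word_prod_cons mulmxA cov_simple_refl IH rev_cons -cats1 act_cat.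
Qed.

(** The passage from words to group elements: [act], and with it [chi] and [ninv], is well defined
    on matrices. *)
Lemma word_prod_act s t : word_prod R s = word_prod R t -> act s =1 act t.
Proof. by move=> E v; apply: RT_inj; rewrite -!word_prod_RT E. Qed.

Lemma real_rootP (b : hdual) : real_root b <-> exists2 c, root c & b = RT c.
Proof.
split=> [[x [s ->] [i ->]]|[c [s [i ->]] ->]].
  by exists (act s (bas R i)); [exists s, i | rewrite -RT_bas word_prod_RT].
by exists (word_prod R s); [exists s | exists i; rewrite -RT_bas word_prod_RT].
Qed.

Lemma pos_real_rootP c : pos_real_root (RT c) <-> root c /\ posv c.
Proof.
split=> [[/real_rootP [c' rc /RT_inj cc'] [e eE]]|[rc pc]].
  rewrite cc'; split=> //; rewrite -cc'.
  have -> : c = \col_i (e i)%:R.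
    by apply: RT_inj; rewrite eE; apply: eq_bigr => i _; rewrite mxE.
  by move=> i; rewrite mxE ler0n.
split; first by apply/real_rootP; exists c.
exists (fun i => Num.truncn (c i 0)); apply: eq_bigr => i _.
by rewrite truncnK // natrEint pc (root_int HA rc).
Qed.
Lemma pos_real_root_exP b : pos_real_root b <-> exists c, [/\ root c, posv c & b = RT c].
Proof.
split=> [pb|[c [rc pc ->]]]; last exact/pos_real_rootP.
have [/real_rootP [c rc bE] _] := pb; exists c.
by move: pb; rewrite bE => /pos_real_rootP [].
Qed.

(** All presentations of the root give the same coroot because [cov] is equivariant, so the choice
    made by [xget] is determined. *)
Lemma coroot_RT c : root c -> coroot (RT c) = (dn c)^-1 *: cov c.
Proof.
move=> rc; rewrite /coroot; apply: xget_unique.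
  have [s [i cE]] := rc; exists (word_prod R s); first by exists s.
  exists i; rewrite cE -word_prod_RT RT_bas; split=> //.
  rewrite word_prod_inv -[in cov _](revK s) -cov_word cov_bas (dn_act HA) (dn_bas HA).
  by rewrite -scalemxAl scalerA mulVf ?scale1r // (d_neq0 HA).
move=> bv [x [s ->] [i [cE ->]]].
have {}cE : c = act s (bas R i) by apply: RT_inj; rewrite cE -RT_bas word_prod_RT.
rewrite word_prod_inv cE -[in cov _](revK s) -cov_word cov_bas (dn_act HA) (dn_bas HA).
by rewrite -scalemxAl scalerA mulVf ?scale1r // (d_neq0 HA).
Qed.

Lemma coroot_word s i : coroot (RT (act s (bas R i))) = simple_coroot R i *m word_prod R (rev s).
Proof.
rewrite coroot_RT; last by exists s, i.
rewrite -[in cov _](revK s) -cov_word cov_bas (dn_act HA) (dn_bas HA).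
by rewrite -scalemxAl scalerA mulVf ?scale1r // (d_neq0 HA).
Qed.
Lemma coroot_simple (i : nodes) : coroot (simple_root R i) = simple_coroot R i.
Proof. by rewrite -RT_bas (coroot_word [::]) word_prod_nil mulmx1. Qed.

Lemma root_refl_word s i :
  root_refl (RT (act s (bas R i))) = word_prod R (s ++ i :: rev s).
Proof.
rewrite /root_refl coroot_word -word_prod_RT RT_bas word_prod_cat word_prod_cons /reflection.
rewrite /simple_refl /reflection mulmxBl mulmxBr mul1mx word_prod_revr.
by rewrite !mulmxA.
Qed.
Lemma root_refl_simple (i : nodes) : root_refl (simple_root R i) = simple_refl R i.
Proof. by rewrite /root_refl coroot_simple. Qed.
Lemma root_reflP c : root c -> exists2 u, root_refl (RT c) = word_prod R u &
  forall v, act u v = refl cA cd c v.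
Proof.
case=> s [i ->]; exists (s ++ i :: rev s); first exact: root_refl_word.
by move=> v; rewrite (refl_word HA).
Qed.
Lemma root_refl_conj s c : root c ->
  word_prod R s *m root_refl (RT c) = root_refl (RT (act s c)) *m word_prod R s.
Proof.
case=> t [i ->]; rewrite -act_cat !root_refl_word rev_cat -cat_cons catA.
rewrite [in RHS]word_prod_cat -[RHS]mulmxA word_prod_revl mulmx1 -catA.
by rewrite [RHS]word_prod_cat.
Qed.

(** * Length and semi-infinite length of group elements *)

Local Notation theta := (theta ca ck).
Local Notation dec := (dec cA cd ca ck).
Local Notation chi := (chi cA cd ca ck).

Lemma theta_sE : theta_s R X = RT theta.
Proof. by rewrite theta_s_mult RTZ RTB RT_bas -null_rootE. Qed.

Lemma semi_word_dec s : exists w xi,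
  [/\ dec s w xi, (semi_word R s).1 = word_prod R w & (semi_word R s).2 = RT xi].
Proof.
have [tw [ti [ft ti0 tE]]] := theta_word HA.
elim: s => [|i s [w [xi [D E1 E2]]]].
  by exists [::], 0; split; [exact: (dec_nil HA) | rewrite word_prod_nil | rewrite RT0].
rewrite /= /semi_gen; have [->|i0] := eqVneq i ord0; last first.
  exists (i :: w), xi; split; first exact: (dec_cons HA).
    by rewrite /= E1 word_prod_cons.
  by rewrite /= E2 E1 mulmx0 add0r.
exists ((tw ++ ti :: rev tw) ++ w), (xi - act (rev w) theta); split.
- exact: (dec_cons0 HA).
- by rewrite /= E1 theta_sE {1}tE root_refl_word [RHS]word_prod_cat.
rewrite /= E1 E2 theta_sE word_prod_inv mulmxN word_prod_RT RTB.
by rewrite addrC.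
Qed.


(** The exchange condition: b is carried through the letters of t while it stays positive; the
    letter whose simple root it meets is deleted. *)
Lemma exchange t b : fword t -> root b -> posv b -> posv (- act (rev t) b) ->
  exists t', [/\ fword t', size t = (size t').+1 &
    root_refl (RT b) *m word_prod R t = word_prod R t'].
Proof.
elim: t b => [|j t IH] b; first by move=> _ rb pb /(root_pos_neg HA rb pb).
move=> /= /andP[j0 ft] rb pb nb; have [bj|bj] := eqVneq b (bas R j).
  exists t; split=> //; rewrite bj RT_bas root_refl_simple word_prod_cons mulmxA.
  by rewrite simple_reflK mul1mx.
have pb' := srefl_pos HA rb pb bj.
have rb' : root (srefl j b) := root_act [:: j] rb.
have [] := IH (srefl j b) ft rb' pb'.
  by move: nb; rewrite rev_cons -cats1 act_cat.
move=> t' [ft' st tE]; exists (j :: t'); split; rewrite /= ?j0 ?st //.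
have := root_refl_conj [:: j] rb'; rewrite word_prod1 /= (sreflK HA) => C.
by rewrite !word_prod_cons -tE !mulmxA C.
Qed.

Context (E : seq vec) (uE : uniq E).
Hypothesis EP : forall b, b \in E <-> droot cA b /\ posv b.
Local Notation ninv := (ninv cA E).

Lemma ninv_eq s t : word_prod R s = word_prod R t -> ninv s = ninv t.
Proof. by move=> /word_prod_act e; apply: eq_count => b; rewrite e. Qed.

(** A letter for which w^-1 alpha_i is negative is absorbed by [exchange] instead of being
    prepended, so the size never exceeds the number of inversions. *)
Lemma reduced_word w : fword w -> exists t,
  [/\ fword t, word_prod R t = word_prod R w & (size t <= ninv w)%N].
Proof.
elim: w => [|i w IH]; first by exists [::].
move=> /= /andP[i0 fw]; have [t [ft tE st]] := IH fw.
have rg : root (act (rev w) (bas R i)) by apply: root_act; exact: root_bas.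
have iE : word_prod R (i :: t) = word_prod R (i :: w) by rewrite !word_prod_cons tE.
case: (root_sign HA rg) => pg.
  exists (i :: t); split=> //=; first by rewrite i0.
  apply: leq_ltn_trans st _; exact: (ninv_cons_gt HA uE EP).
have [|t' [ft' st' t'E]] := exchange ft (root_bas cA i) (@posv_bas _ _ i).
  have -> // : act (rev t) (bas R i) = act (rev w) (bas R i).
  by apply: word_prod_act; rewrite -!word_prod_inv tE.
exists t'; split=> //; first by rewrite -t'E RT_bas root_refl_simple -word_prod_cons.
have := ninv_cons_le HA uE EP i (i :: w).
have -> : ninv (i :: i :: w) = ninv w.
  by apply: ninv_eq; rewrite !word_prod_cons mulmxA simple_reflK mul1mx.
by move: st; rewrite st'; lia.
Qed.

(** [weyl_length] minimises over words in all affine simple reflections, so the lower bound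
    [ninv_le_size] is applied to words that may contain s_0. *)
Lemma weyl_length_word w : fword w -> weyl_length (word_prod R w) = ninv w.
Proof.
move=> fw; have [t [ft tE st]] := reduced_word fw.
have lb s : word_prod R w = word_prod R s -> (ninv w <= size s)%N.
  by move=> /ninv_eq ->; exact: (ninv_le_size HA uE EP).
apply: xget_unique.
  split=> //; exists t => //; apply/eqP; rewrite eqn_leq st.
  exact: lb.
move=> y [[s sy ws] ymin]; apply/eqP; rewrite eqn_leq -{2}sy lb // andbT.
by apply: leq_trans (ymin _ (esym tE)) st.
Qed.

Lemma rho_check_sum : rho_check R X = 2^-1 *: \sum_(b <- E) (dn b)^-1 *: cov b.
Proof.
rewrite /rho_check; congr (_ *: _).
have -> : (fin_pos_root (R := R) (X := X) = [set` map RT E])%classic.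
  apply/seteqP; split=> [b [/pos_real_root_exP [c [rc pc ->]] [e eE]]|b /=].
    rewrite /= mem_map ?EP; last exact: RT_inj.
    split=> //; split=> //; rewrite -RT_last eE summxE big1 // => j _.
    by rewrite !mxE ltnn /= mulr0.
  move=> /mapP [c /EP [[rc c0] pc] ->]; split; first exact/pos_real_rootP.
  exists (fun j => Num.floor (c (node j) 0)).
  rewrite /RT big_ord_recl c0 scale0r add0r [RHS]big_mkcond /=; apply: eq_bigr => j _.
  by rewrite inE /node floorK // (root_int HA rc).
rewrite -fsbig_seq ?map_inj_uniq //; last exact: RT_inj.
rewrite big_map big_seq [RHS]big_seq; apply: eq_bigr => b /EP [[rb _] _].
exact: coroot_RT.
Qed.

Lemma semi_inf_length_word s :
  semi_inf_length (word_prod R s) = \sum_(b <- E) chi s b.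
Proof.
rewrite /semi_inf_length.
(* [semi_decomp] is computed from some word t of the same element; by [word_prod_act] it gives the
   same [chi] as s. *)
have [t tE dE] : exists2 t, word_prod R s = word_prod R t &
    semi_decomp (word_prod R s) = semi_word R t.
  have [|t tE dE] := @xgetPex _ (1%:M, 0)
      [set p | exists2 t, word_prod R s = word_prod R t & p = semi_word R t]%classic.
    by exists (semi_word R s), s.
  by exists t.
have [w [xi [D E1 E2]]] := semi_word_dec t; have [fw _ _ _] := D.
rewrite dE E1 E2 weyl_length_word //.
transitivity (\sum_(b <- E) chi t b); last first.
  by apply: eq_bigr => b _; rewrite /chi (word_prod_act tE).
rewrite (sum_chi_dec HA EP D); congr (_ + _).
rewrite rho_check_sum pairingZl mulrA divff ?pnatr_eq0 // mul1r pairing_suml.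
by apply: eq_bigr => b _; rewrite pairingZl pairing_cov mulrC.
Qed.

(** * The level-zero weight and Peterson representatives *)

Context (m : Ifin X -> nat).
Local Notation lam := (level0_weight R m).
Local Notation J := (Jset m).

Definition ell (i : nodes) : R := cd i * pairing (simple_coroot R i) lam.
Local Notation Lam := (Lam ell).
Local Notation wlen := (wlen cA cd ca ck E ell).

Lemma pairing_fund (i j : nodes) : pairing (simple_coroot R i) (fund_weight R j) = (i == j)%:R.
Proof.
by rewrite pairing_coroot mxE andbT.
Qed.

Lemma Lam_cov v : Lam v = pairing (cov v) lam.
Proof.
by rewrite /cov pairing_suml; apply: eq_bigr => i _; rewrite pairingZl mulrA.
Qed.

(** The factor c is the coefficient of Lambda_j in varpi_j, equal to 2 at node l in type
    A_2l^(2). *)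
Lemma pairing_node (j : Ifin X) : exists2 c : nat, (0 < c)%N &
  pairing (simple_coroot R (node j)) lam = (m j * c)%:R.
Proof.
have [c [e [c0 _ jE]]] := varpi_coef R hX j; exists c => //.
rewrite pairing_sumr (bigD1 j) //= [X in _ + X]big1 => [|i ij].
  rewrite addr0 pairingZr jE pairingDr pairingNr !pairingZr !pairing_fund eqxx.
  by rewrite mulr0 subr0 mulr1 natrM.
have [c' [e' [_ _ ->]]] := varpi_coef R hX i.
rewrite pairingZr pairingDr pairingNr !pairingZr !pairing_fund.
rewrite (_ : (node j == node i) = false) ?mulr0 ?subr0 ?mulr0 //.
by rewrite /node (inj_eq lift_inj) eq_sym (negbTE ij).
Qed.

Lemma node_exists (i : nodes) : i != ord0 -> exists j : Ifin X, i = node j.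
Proof. by case: (unliftP ord0 i) => [j ->|->]; [exists j | rewrite eqxx]. Qed.

Lemma cd_gt0 i : 0 < cd i.
Proof. exact: (d_gt0 HA). Qed.

Lemma ell_node_ge0 i : i != ord0 -> 0 <= ell i.
Proof.
move=> /node_exists [j ->]; have [c _ E'] := pairing_node j.
by rewrite /ell E' mulr_ge0 ?ler0n // ltW ?cd_gt0.
Qed.

Lemma ell_node_gt0 j : (0 < ell (node j)) = (j \notin J).
Proof.
have [c c0 E'] := pairing_node j.
by rewrite /ell E' pmulr_rgt0 ?cd_gt0 // ltr0n muln_gt0 c0 andbT inE lt0n.
Qed.

(** Up to the factor k this is <K, lambda>, because a_i d_i = k a_i^vee. *)
Lemma level_zero : \sum_i ca i * ell i = 0.
Proof.
have cm i : ca i * cd i = (comark X i)%:R * ck.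
  by rewrite /ca /cd /ck -!natrM comark_half_norm ?[(mark _ _ * _)%N]mulnC // -ltnS.
have fw j : \sum_i (ca i * cd i) * pairing (simple_coroot R i) (fund_weight R j) =
    (comark X j)%:R * ck.
  rewrite (bigD1 j) //= pairing_fund eqxx mulr1 cm big1 ?addr0 // => i ij.
  by rewrite pairing_fund (negbTE ij) mulr0.
transitivity (\sum_i \sum_j (ca i * cd i) * ((m j)%:R * pairing (simple_coroot R i) (varpi R j))).
  apply: eq_bigr => i _; rewrite /ell mulrA pairing_sumr mulr_sumr.
  by apply: eq_bigr => j _; rewrite pairingZr.
rewrite exchange_big big1 // => j _.
have [c [e [_ ce ->]]] := varpi_coef R hX j.
transitivity ((m j)%:R * (c%:R * \sum_i (ca i * cd i) * pairing (simple_coroot R i) (fund_weight R (node j)) -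
  e%:R * \sum_i (ca i * cd i) * pairing (simple_coroot R i) (fund_weight R ord0))).
  rewrite !mulr_sumr -sumrB mulr_sumr; apply: eq_bigr => i _.
  by rewrite pairingDr pairingNr !pairingZr; ring.
by rewrite !fw !mulrA -!natrM ce subrr mulr0.
Qed.

(** The slope of H along a segment of direction x. *)
Definition pw (i : nodes) (x : endo) : R := pairing (simple_coroot R i) (x *m lam).

Lemma pw_word i s : pw i (word_prod R s) = (cd i)^-1 * Lam (act (rev s) (bas R i)).
Proof.
rewrite Lam_cov -cov_word cov_bas -scalemxAl pairingZl mulKf ?(d_neq0 HA) //.
by rewrite pairing_mulmx.
Qed.
Lemma Lam_pw i s : Lam (act (rev s) (bas R i)) = cd i * pw i (word_prod R s).
Proof. by rewrite pw_word mulVKf // (d_neq0 HA). Qed.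

Lemma pw_simple_refl i x : pw i (simple_refl R i *m x) = - pw i x.
Proof.
rewrite /pw -mulmxA reflection_mul pairingDr pairingNr pairingZr pairing_simple.
by rewrite (_ : cA i i = 2) ?(ac_diag HA) //; ring.
Qed.

Lemma simple_refl_mulK (i : nodes) (x : endo) : simple_refl R i *m (simple_refl R i *m x) = x.
Proof. by rewrite mulmxA simple_reflK mul1mx. Qed.

Lemma QJ_RT v : intv v -> v ord0 0 = 0 -> (forall i, i != ord0 -> 0 < ell i -> v i 0 = 0) ->
  QJ J (RT v).
Proof.
move=> vi v0 vJ; exists (fun j => Num.floor (v (node j) 0)).
rewrite /RT big_ord_recl v0 scale0r add0r [RHS]big_mkcond /=; apply: eq_bigr => j _.
case: ifP => jJ; first by rewrite floorK.
by rewrite -/(node j) vJ ?scale0r // ell_node_gt0 jJ.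
Qed.

(** Together with [DeltaJ_Lam] this identifies (Delta_J)_af^+ with the positive real roots
    orthogonal to lambda; [Lam_eq0_coord] puts the finite part in Q_J. *)
Lemma DeltaJ_RT b : root b -> posv b -> Lam b = 0 -> DeltaJ_af_pos J (RT b).
Proof.
move=> rb pb Lb; split; first exact/pos_real_rootP.
have bi := root_int HA rb.
exists (RT (fin ca b)).
  apply: QJ_RT; [|exact: (fin0 HA)|].
    move=> i; rewrite mxE mxE mxE rpredB // rpredM //.
    exact: (delta_int HA).
  exact: (Lam_eq0_coord HA ell_node_ge0 level_zero).
exists (Num.floor (b ord0 0)); rewrite floorK // null_rootE -RTZ -RTD.
by rewrite /fin subrK.
Qed.

Lemma DeltaJ_Lam b : DeltaJ_af_pos J (RT b) -> Lam b = 0.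
Proof.
case=> _ [g [c ->] [n E']].
have gE : \sum_(j in J) (c j)%:~R *: simple_root R (node j) =
    RT (\sum_(j in J) (c j)%:~R *: bas R (node j)).
  rewrite (big_morph RT RTD RT0); apply: eq_bigr => j _.
  by rewrite RTZ RT_bas.
have -> : b = \sum_(j in J) (c j)%:~R *: bas R (node j) + n%:~R *: delta.
  by apply: RT_inj; rewrite E' gE null_rootE -RTZ -RTD.
rewrite (LamD _) LamZ (Lam_delta level_zero) mulr0 addr0.
rewrite (big_morph Lam (LamD _) (_ : Lam 0 = 0)); last first.
  by rewrite -(scale0r 0) LamZ mul0r.
apply: big1 => j jJ; rewrite LamZ Lam_cov cov_bas pairingZl.
have [c' _ ->] := pairing_node j; move: jJ; rewrite inE => /eqP ->.
by rewrite mul0n !mulr0.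
Qed.

Lemma WJaf_pos s b : WJaf J (word_prod R s) -> root b -> posv b -> Lam b = 0 -> posv (act s b).
Proof.
move=> [_ W] rb pb Lb; have := W _ (DeltaJ_RT rb pb Lb).
by rewrite word_prod_RT => /pos_real_rootP [].
Qed.

(** For a finite root orthogonal to lambda, both test roots of [chi_eq0] belong to (Delta_J)_af^+,
    and a Peterson representative keeps them positive. *)
Lemma semi_inf_length_wlen s : WJaf J (word_prod R s) ->
  semi_inf_length (word_prod R s) = wlen s.
Proof.
move=> W; rewrite semi_inf_length_word; apply: (wlen_full EP ell_node_ge0) => b bE Lb.
have [rb pb] := (EP b).1 bE; have [rb1 b0] := rb.
apply: (chi_eq0 HA rb); first exact: WJaf_pos.
move=> c c0 rc; apply: WJaf_pos => //.
  case: (root_sign HA rc) => // /(_ ord0); rewrite coord0N coord0Z coord0D coord0N b0.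
  rewrite coord0Z (delta0 HA) oppr0 add0r mulr1 oppr_ge0 leNgt mulr_gt0 //.
  by rewrite divr_gt0 ?(root_dn_gt0 HA) // (ac_kgt0 HA).
by rewrite LamZ LamD LamN LamZ (Lam_delta level_zero) Lb oppr0 mulr0 addr0 mulr0.
Qed.

Lemma WJaf_word x : WJaf J x -> exists s, x = word_prod R s.
Proof. by case=> [[s ->]] _; exists s. Qed.

(** s_i could only spoil the positivity of x c if x c = alpha_i, and then <alpha_i^vee, x lambda>
    would vanish with (c, lambda). *)
Lemma WJaf_simple_refl i x : WJaf J x -> pw i x != 0 -> WJaf J (simple_refl R i *m x).
Proof.
move=> W; have [s xE] := WJaf_word W; rewrite xE in W *.
move=> px; split; first by exists (i :: s); rewrite word_prod_cons.
move=> b Db; have [/pos_real_root_exP [c [rc pc bE]] _] := Db; rewrite bE in Db *.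
have [_ /(_ _ Db)] := W; rewrite word_prod_RT => /pos_real_rootP [rsc psc].
rewrite -word_prod_cons word_prod_RT; apply/pos_real_rootP; split.
  exact: root_act.
apply: (srefl_pos HA rsc psc); apply/eqP => cE; move/eqP: px; apply.
by rewrite pw_word -cE (act_rev HA) (DeltaJ_Lam Db) mulr0.
Qed.

(** * Simple reflections and edges *)

Lemma len_gt i x : WJaf J x -> 0 < pw i x ->
  semi_inf_length (simple_refl R i *m x) = semi_inf_length x + 1.
Proof.
move=> W px; have [s xE] := WJaf_word W.
have W' := WJaf_simple_refl W (lt0r_neq0 px); rewrite xE in W W' px *.
rewrite -word_prod_cons in W' *; rewrite !semi_inf_length_wlen //.
apply: (wlen_cons_gt HA uE EP ell_node_ge0 level_zero).
by rewrite Lam_pw mulr_gt0 ?cd_gt0.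
Qed.
Lemma len_lt i x : WJaf J x -> pw i x < 0 ->
  semi_inf_length (simple_refl R i *m x) = semi_inf_length x - 1.
Proof.
move=> W px; have W' := WJaf_simple_refl W (ltr0_neq0 px).
have := len_gt W' (i := i); rewrite pw_simple_refl oppr_gt0 simple_refl_mulK => /(_ px) ->.
by rewrite addrK.
Qed.

Lemma edge_simple i x : WJaf J x -> 0 < pw i x ->
  siBG_edge J x (simple_root R i) (simple_refl R i *m x).
Proof.
move=> W px; split=> //.
- by apply: WJaf_simple_refl => //; rewrite gt_eqF.
- by rewrite -RT_bas; apply/pos_real_rootP; split; [exact: root_bas | exact: posv_bas].
- by rewrite root_refl_simple.
- exact: len_gt.
Qed.

Lemma root_refl_comm i c (x : endo) : root c ->
  root_refl (RT (srefl i c)) *m (simple_refl R i *m x) =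
  simple_refl R i *m (root_refl (RT c) *m x).
Proof.
move=> rc; have := root_refl_conj [:: i] rc; rewrite word_prod1 /= => C.
by rewrite !mulmxA C.
Qed.

(* For a label other than [alpha_i], reflecting the edge would exhibit two vertices
   of the same coset length joined by an increasing reflection. *)
Lemma edge_cross i x b y : siBG_edge J x b y -> 0 <= pw i x -> pw i y <= 0 ->
  0 < pw i x \/ pw i y < 0 -> b = simple_root R i /\ y = simple_refl R i *m x.
Proof.
case=> Wx Wy /pos_real_root_exP [c [rc pc ->]] yE len px py pxy.
have [ci|ci] := eqVneq c (bas R i).
  by rewrite yE ci RT_bas root_refl_simple.
exfalso; have [u uE' uv] := root_reflP rc.
have [s xE] := WJaf_word Wx; rewrite xE uE' -word_prod_cat in yE.
rewrite xE in Wx len px pxy; rewrite yE in Wy len py pxy.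
rewrite !semi_inf_length_wlen // in len.
have su v : act (u ++ s) v = refl cA cd c (act s v) by rewrite act_cat uv.
have dc := root_dn_neq0 HA rc.
have us v : act s v = refl cA cd c (act (u ++ s) v) by rewrite su (reflK HA).
have Lneg : Lam (act (rev (u ++ s)) c) = - Lam (act (rev s) c).
  rewrite -LamN; congr Lam; apply: (act_inj HA (s := u ++ s)).
  rewrite (act_revK HA) su actN (act_revK HA) -scaleN1r (reflZ HA) (refl_self) //.
  by rewrite scaleN1r opprK.
(* If the value were zero, s^-1 c would be in (Delta_J)_af^+ up to sign, while x sends it to c and y
   to -c, so one of them would not be a Peterson representative. If it were negative, passing from y
   back to x would increase [wlen]. *)
have Lpos : 0 < Lam (act (rev s) c).
  rewrite ltNge; apply/negP; rewrite le_eqVlt => /predU1P [L0|L0].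
    have re : root (act (rev s) c) by exact: root_act.
    have pe : posv (act (rev s) c).
      case: (root_sign HA re) => // ne; exfalso.
      have := WJaf_pos Wx (root_opp HA re) ne; rewrite LamN L0 oppr0 => /(_ erefl).
      by rewrite actN (act_revK HA); exact: (root_pos_neg HA rc).
    have := WJaf_pos Wy re pe L0; rewrite su (act_revK HA) (refl_self) //.
    exact: (root_pos_neg HA rc).
  have := wlen_refl HA uE EP ell_node_ge0 level_zero rc pc _ us.
  by rewrite Lneg oppr_gt0 => /(_ L0); rewrite len; lra.
have rc' : root (srefl i c) := root_act [:: i] rc.
have pc' : posv (srefl i c) := srefl_pos HA rc pc ci.
(* s_i y is the reflection of s_i x in the positive root s_i c. Yet s_i does not lower [wlen] at x
   nor raise it at y, and it changes at least one of the two values, which uses up the gain of 1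
   along the edge. Since s_i x or s_i y may leave the Peterson representatives, only [wlen] is
   available here. *)
have : wlen (i :: s) < wlen (i :: (u ++ s)).
  apply: (wlen_refl HA uE EP ell_node_ge0 level_zero rc' pc').
    by rewrite rev_cons -cats1 act_cat /= (sreflK HA).
  by move=> v; rewrite act_cons su; exact: esym (refl_act HA [:: i] c (act s v)).
have hx : wlen (i :: s) = wlen s + (0 < pw i (word_prod R s))%R%:R.
  move: px; rewrite le_eqVlt => /predU1P [p0|p0].
    rewrite -p0 ltxx addr0; apply: (wlen_cons_eq HA uE EP ell_node_ge0 level_zero).
    by rewrite Lam_pw -p0 mulr0.
  rewrite p0; apply: (wlen_cons_gt HA uE EP ell_node_ge0 level_zero).
  by rewrite Lam_pw mulr_gt0 ?cd_gt0.
have hy : wlen (i :: (u ++ s)) = wlen (u ++ s) - (pw i (word_prod R (u ++ s)) < 0)%R%:R.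
  move: py; rewrite le_eqVlt => /predU1P [p0|p0].
    rewrite p0 ltxx subr0; apply: (wlen_cons_eq HA uE EP ell_node_ge0 level_zero).
    by rewrite Lam_pw p0 mulr0.
  rewrite p0; apply: (wlen_cons_lt HA uE EP ell_node_ge0 level_zero).
  by rewrite Lam_pw pmulr_rlt0 ?cd_gt0.
rewrite hx hy len; move: pxy; case: (0 < pw i (word_prod R s));
  case: (pw i (word_prod R (u ++ s)) < 0) => -[] // _; rewrite /=; lra.
Qed.

(** Equal signs exclude the label alpha_i, so the reflected label stays positive, and both lengths
    are shifted by the same amount. *)
Lemma edge_refl i x b y : siBG_edge J x b y -> 0 < pw i x * pw i y ->
  siBG_edge J (simple_refl R i *m x) (simple_refl R i *m b) (simple_refl R i *m y).
Proof.
case=> Wx Wy /pos_real_root_exP [c [rc pc ->]] yE len pxy.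
have pz : pw i x != 0 /\ pw i y != 0.
  by split; apply: contraTneq pxy => ->; rewrite ?mulr0 ?mul0r ltxx.
have ci : c != bas R i.
  apply: contraTneq pxy => ci; rewrite yE ci RT_bas root_refl_simple pw_simple_refl.
  by rewrite mulrN oppr_gt0 -leNgt -expr2 sqr_ge0.
split.
- by apply: WJaf_simple_refl => //; case: pz.
- by apply: WJaf_simple_refl => //; case: pz.
- rewrite simple_refl_RT; apply/pos_real_rootP; split; first exact: (root_act [:: i] rc).
  exact: (srefl_pos HA).
- by rewrite simple_refl_RT root_refl_comm // -yE.
have [p|p|p] := ltgtP (pw i x) 0; last by case: pz; rewrite p eqxx.
  by move: pxy; rewrite nmulr_rgt0 // => q; rewrite !len_lt // len; ring.
by move: pxy; rewrite pmulr_rgt0 // => q; rewrite !len_gt // len; ring.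
Qed.

Lemma coroot_srefl (i : nodes) (b : hdual) : real_root b ->
  coroot (simple_refl R i *m b) = coroot b *m simple_refl R i.
Proof.
move=> /real_rootP [c rc ->]; have rc' : root (srefl i c) := root_act [:: i] rc.
by rewrite simple_refl_RT !coroot_RT // (dn_act HA [:: i]) -scalemxAl cov_simple_refl.
Qed.

(** * Simple reflections and a-chains *)

Local Notation chain := (@achain R X m).

Lemma is_integerE (v : R) : is_integer v <-> v \is a Num.int.
Proof. by split=> [[n ->]|/intrP //]; exact: intr_int. Qed.

Lemma achain_WJ a x bs y : chain a x bs y -> WJaf J x /\ WJaf J y.
Proof.
elim: bs x => [|b bs IH] x /=; first by case=> W <-.
by case=> -[Wx _ _ _ _] _ /IH [].
Qed.

Lemma achain_len a x bs y : chain a x bs y ->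
  semi_inf_length y = semi_inf_length x + (size bs)%:R.
Proof.
elim: bs x => [|b bs IH] x /=; first by case=> _ <-; rewrite addr0.
by case=> -[_ _ _ _ l] _ /IH ->; rewrite l -addrA -natr1 [1 + _]addrC.
Qed.

Lemma achain_cat a x bs y cs z : chain a x bs y -> chain a y cs z -> chain a x (bs ++ cs) z.
Proof.
elim: bs x => [|b bs IH] x /=; first by case=> _ <-.
by case=> e ai /IH h /h.
Qed.

Lemma achain_irrefl a x bs : chain a x bs x -> bs = [::].
Proof.
move=> /achain_len /eqP; rewrite -subr_eq0 opprD addrA subrr sub0r oppr_eq0 pnatr_eq0.
by move/eqP/size0nil.
Qed.

Lemma edge_int a x b : pos_real_root b -> is_integer (a * pairing (coroot b) (x *m lam)) ->
  exists2 c : vec, intv c & a *: (x *m lam - root_refl b *m x *m lam) = RT c.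
Proof.
move=> /pos_real_root_exP [c [rc _ ->]] /is_integerE ai.
exists ((a * pairing (coroot (RT c)) (x *m lam)) *: c).
  by move=> i; rewrite mxE rpredM // (root_int HA rc).
by rewrite -[in LHS]mulmxA reflection_mul subKr scalerA RTZ.
Qed.

(** Each edge contributes its label times the integer a <b^vee, x lambda>. *)
Lemma achain_int a x bs y : chain a x bs y ->
  exists2 c : vec, intv c & a *: (x *m lam - y *m lam) = RT c.
Proof.
elim: bs x => [|b bs IH] x /=.
  case=> _ <-; exists 0; first by move=> i; rewrite mxE rpred0.
  by rewrite subrr scaler0 RT0.
case=> -[_ _ pb _ _] ai /IH [c ci cE]; have [e ei eE] := edge_int pb ai.
exists (e + c); first by move=> i; rewrite mxE rpredD.
by rewrite RTD -cE -eE -scalerDr addrA subrK.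
Qed.

Lemma achain_pw_int a x bs y i : chain a x bs y -> a * (pw i x - pw i y) \is a Num.int.
Proof.
move=> /achain_int [c ci cE].
suff -> : a * (pw i x - pw i y) = cpair cA i c by exact: (cpair_int HA).
by rewrite -pairing_RT -cE pairingZr pairingDr pairingNr.
Qed.

Lemma achain_simple a x bs y i : WJaf J x -> 0 < pw i x -> a * pw i x \is a Num.int ->
  chain a (simple_refl R i *m x) bs y -> chain a x (simple_root R i :: bs) y.
Proof.
move=> W px ai C /=; rewrite root_refl_simple coroot_simple; split=> //; last exact/is_integerE.
exact: edge_simple.
Qed.

Lemma achain_refl a x b bs y i : siBG_edge J x b (root_refl b *m x) ->
  is_integer (a * pairing (coroot b) (x *m lam)) ->
  0 < pw i x * pw i (root_refl b *m x) ->
  chain a (simple_refl R i *m (root_refl b *m x)) bs y ->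
  chain a (simple_refl R i *m x) (simple_refl R i *m b :: bs) y.
Proof.
move=> e ai p C /=; have e' := edge_refl e p; have [_ _ pb _ _] := e.
have E' : root_refl (simple_refl R i *m b) *m (simple_refl R i *m x) =
    simple_refl R i *m (root_refl b *m x) by case: e'.
rewrite E'; split=> //; rewrite coroot_srefl; last by case: pb.
by rewrite pairing_mulmx -[simple_refl R i *m x *m _]mulmxA mulmxA simple_reflK mul1mx.
Qed.

Lemma pw_prod_gt0 i x y : (pw i x < 0 /\ pw i y < 0) \/ (0 < pw i x /\ 0 < pw i y) ->
  0 < pw i x * pw i y.
Proof. by case=> -[h1 h2]; [rewrite nmulr_rgt0 | rewrite pmulr_rgt0]. Qed.

(** The two claims need a common induction: a chain between negative values may visit nonnegative
    ones, and then returns along an edge labelled alpha_i. *)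
Lemma achain_neg_aux a i bs x y : chain a x bs y -> pw i y < 0 ->
  (pw i x < 0 -> exists2 cs, size cs = size bs &
     chain a (simple_refl R i *m x) cs (simple_refl R i *m y)) /\
  (0 <= pw i x -> a * pw i y \is a Num.int /\
     exists2 cs, size bs = (size cs).+1 & chain a x cs (simple_refl R i *m y)).
Proof.
elim: bs x => [|b bs IH] x C py.
  have [W xy] := C; split=> px; last by move: px; rewrite xy leNgt py.
  by exists [::] => //; split; [apply: WJaf_simple_refl; rewrite // lt_eqF | rewrite xy].
have Cpw := achain_pw_int i C.
move: C => /= [e ai C]; set z := root_refl b *m x in e C.
have [IHn IHp] := IH z C py; have [Wx Wz _ _ _] := e.
split=> px.
  have [pz|pz] := ltP (pw i z) 0.
    have [cs sc Cs] := IHn pz; exists (simple_refl R i *m b :: cs); first by rewrite /= sc.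
    by apply: achain_refl => //; apply: pw_prod_gt0; left.
  have [iy [cs sc Cs]] := IHp pz.
  (* The tail, shortened by its returning edge, is preceded by the edge s_i x -> x, so the length is
     preserved. *)
  exists (simple_root R i :: b :: cs); first by rewrite /= sc.
  apply: achain_simple.
  - by apply: WJaf_simple_refl; rewrite // lt_eqF.
  - by rewrite pw_simple_refl oppr_gt0.
  - rewrite pw_simple_refl mulrN rpredN -[pw i x](subrK (pw i y)) mulrDr.
    exact: rpredD.
  by rewrite simple_refl_mulK; split.
have [pz|pz] := ltP (pw i z) 0; last first.
  have [iy [cs sc Cs]] := IHp pz; split=> //; exists (b :: cs); first by rewrite /= sc.
  by split.
have [bE zE] := edge_cross e px (ltW pz) (or_intror pz).
have [cs sc Cs] := IHn pz; split; last first.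
  by exists cs; rewrite ?sc // -(simple_refl_mulK i x) -zE.
move/is_integerE: ai; rewrite bE coroot_simple -/(pw i x) => ai.
rewrite -[pw i y](subrK (pw i x)) mulrDr rpredD // -rpredN -mulrN opprB.
exact: Cpw.
Qed.

Lemma achain_neg a i bs x y : chain a x bs y -> pw i x < 0 -> pw i y < 0 ->
  exists2 cs, size cs = size bs & chain a (simple_refl R i *m x) cs (simple_refl R i *m y).
Proof. by move=> C px py; have [h _] := achain_neg_aux C py; exact: h. Qed.

Lemma achain_cross_end a i bs x y : chain a x bs y -> 0 <= pw i x -> pw i y < 0 ->
  a * pw i y \is a Num.int /\
  exists2 cs, size bs = (size cs).+1 & chain a x cs (simple_refl R i *m y).
Proof. by move=> C px py; have [_ h] := achain_neg_aux C py; exact: h. Qed.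

(** The chain is reflected up to the first edge that reaches a nonpositive value; this edge is
    labelled alpha_i and is dropped. *)
Lemma achain_cross_start a i bs x y : chain a x bs y -> 0 < pw i x -> pw i y <= 0 ->
  a * pw i x \is a Num.int /\
  exists2 cs, size bs = (size cs).+1 & chain a (simple_refl R i *m x) cs y.
Proof.
elim: bs x => [|b bs IH] x C px py; first by have [_ xy] := C; move: px; rewrite xy ltNge py.
move: C => /= [e ai C]; set z := root_refl b *m x in e C.
have [pz|pz] := ltP 0 (pw i z).
  have [iz [cs sc Cs]] := IH z C pz py; split.
    rewrite -[pw i x](subrK (pw i z)) mulrDr rpredD //.
    apply: (@achain_pw_int _ _ [:: b]); split=> //; split=> //.
    by have [] := e.
  exists (simple_refl R i *m b :: cs); first by rewrite /= sc.
  by apply: achain_refl => //; apply: pw_prod_gt0; right.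
have [bE zE] := edge_cross e (ltW px) pz (or_introl px).
split; first by move/is_integerE: ai; rewrite bE coroot_simple.
by exists bs; rewrite // -zE.
Qed.

Lemma achain_pos a i bs x y : chain a x bs y -> 0 < pw i x -> 0 < pw i y ->
  exists2 cs, size cs = size bs & chain a (simple_refl R i *m x) cs (simple_refl R i *m y).
Proof.
elim: bs x => [|b bs IH] x C px py.
  have [W xy] := C; exists [::] => //.
  by split; [apply: WJaf_simple_refl; rewrite // gt_eqF | rewrite xy].
have Cpw := achain_pw_int i C; have [_ Wy] := achain_WJ C.
move: C => /= [e ai C]; set z := root_refl b *m x in e C.
have [pz|pz] := ltP 0 (pw i z).
  have [cs sc Cs] := IH z C pz py; exists (simple_refl R i *m b :: cs); first by rewrite /= sc.
  by apply: achain_refl => //; apply: pw_prod_gt0; right.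
have [bE zE] := edge_cross e (ltW px) pz (or_introl px).
(* The alpha_i edge dropped at the start is put back at the end, from y to s_i y. *)
exists (bs ++ [:: simple_root R i]); first by rewrite size_cat addn1.
rewrite -zE; apply: achain_cat C _; apply: achain_simple => //.
  rewrite -[pw i y](subrK (pw i x)) mulrDr rpredD //.
    by rewrite -rpredN -mulrN opprB.
  by move/is_integerE: ai; rewrite bE coroot_simple.
by split=> //; apply: WJaf_simple_refl; rewrite // gt_eqF.
Qed.

Lemma pw_int i x : Waf x -> pw i x \is a Num.int.
Proof.
case=> s ->; rewrite pw_word Lam_cov.
suff li : forall j, pairing (simple_coroot R j) lam \is a Num.int.
  have rg : root (act (rev s) (bas R i)) by apply: root_act; exact: root_bas.
  have [_ _ rd] := root_colat HA rg; rewrite -(dn_bas HA i) -(dn_act HA (rev s)).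
  rewrite pairing_suml mulr_sumr rpred_sum // => j _; rewrite pairingZl mulrA.
  by rewrite rpredM // mulrC -/(cd j).
move=> j; rewrite pairing_sumr rpred_sum // => q _.
have [c [e [_ _ ->]]] := varpi_coef R hX q.
rewrite pairingZr pairingDr pairingNr !pairingZr !pairing_fund.
by rewrite rpredM ?rpred_nat // rpredB // rpredM ?rpred_nat.
Qed.

End Realization.

(** * Chains of positive length *)

Section DirectedChains.
Context (R : realType) (X : twisted_type) (hX : admissible X) (m : Ifin X -> nat).
Local Notation nodes := 'I_(rank X).+1.
Local Notation endo := ('M[R]_((rank X).+2)).
Local Notation W := (WJaf (R := R) (Jset m)).

Definition dchain (a : R) (x y : endo) : Prop :=
  exists2 bs, (0 < size bs)%N & achain m a x bs y.

Context (i : nodes).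
Local Notation p := (pw m i).

Definition sdir (x : endo) : endo := simple_refl R i *m x.
Local Notation s := sdir.

Lemma sdirK : involutive s.
Proof. by move=> x; exact: simple_refl_mulK. Qed.
Lemma pw_sdir x : p (s x) = - p x.
Proof. exact: pw_simple_refl. Qed.
Lemma W_sdir x : W x -> p x != 0 -> W (s x).
Proof. exact: WJaf_simple_refl. Qed.
Lemma pwW_int x : W x -> p x \is a Num.int.
Proof. by case=> wx _; exact: pw_int. Qed.

(** The semi-infinite length increases along every edge. This is why adjacent directions of a path
    differ. *)
Lemma dchain_irrefl a x : ~ dchain a x x.
Proof. by case=> bs + /achain_irrefl b0; rewrite b0. Qed.
Lemma dchain_trans a x y z : dchain a x y -> dchain a y z -> dchain a x z.
Proof.
move=> [bs b0 C] [cs _ C']; exists (bs ++ cs); last exact: achain_cat C C'.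
by rewrite size_cat addn_gt0 b0.
Qed.
Lemma dchain_int a x y : dchain a x y -> a * (p x - p y) \is a Num.int.
Proof. by case=> bs _; exact: achain_pw_int. Qed.

Lemma achain_dchain a x bs y : achain m a x bs y -> x = y \/ dchain a x y.
Proof.
case: bs => [[_ xy]|b bs C]; first by left.
by right; exists (b :: bs).
Qed.

Lemma dchain_simple a x : W x -> 0 < p x -> a * p x \is a Num.int -> dchain a x (s x).
Proof.
(* The enumeration of the positive finite roots is introduced inside each proof, which keeps it out
   of the statements below. *)
have [E [uE EP]] := droot_enum (HA R hX).
move=> Wx px ai; exists [:: simple_root R i] => //.
apply: (achain_simple hX uE EP) => //; split=> //.
by apply: W_sdir; rewrite // gt_eqF.
Qed.
Lemma dchain_simple' a x : W x -> p x < 0 -> a * p x \is a Num.int -> dchain a (s x) x.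
Proof.
move=> Wx px ai; rewrite -{2}[x]sdirK; apply: dchain_simple.
- by apply: W_sdir; rewrite // lt_eqF.
- by rewrite pw_sdir oppr_gt0.
- by rewrite pw_sdir mulrN rpredN.
Qed.
Lemma dchain_neg a x y : dchain a x y -> p x < 0 -> p y < 0 -> dchain a (s x) (s y).
Proof.
have [E [uE EP]] := droot_enum (HA R hX).
move=> [bs b0 C] px py; have [cs cb C'] := achain_neg hX uE EP C px py.
by exists cs; rewrite ?cb.
Qed.
Lemma dchain_pos a x y : dchain a x y -> 0 < p x -> 0 < p y -> dchain a (s x) (s y).
Proof.
have [E [uE EP]] := droot_enum (HA R hX).
move=> [bs b0 C] px py; have [cs cb C'] := achain_pos hX uE EP C px py.
by exists cs; rewrite ?cb.
Qed.
(** Equality covers the case where dropping the alpha_i edge leaves an empty chain. *)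
Lemma dchain_cross_end a x y : dchain a x y -> 0 <= p x -> p y < 0 ->
  a * p y \is a Num.int /\ (x = s y \/ dchain a x (s y)).
Proof.
have [E [uE EP]] := droot_enum (HA R hX).
move=> [bs b0 C] px py; have [ai [cs _ C']] := achain_cross_end hX uE EP C px py.
by split=> //; exact: achain_dchain C'.
Qed.
Lemma dchain_cross_start a x y : dchain a x y -> 0 < p x -> p y <= 0 ->
  a * p x \is a Num.int /\ (s x = y \/ dchain a (s x) y).
Proof.
have [E [uE EP]] := droot_enum (HA R hX).
move=> [bs b0 C] px py; have [ai [cs _ C']] := achain_cross_start hX uE EP C px py.
by split=> //; exact: achain_dchain C'.
Qed.

End DirectedChains.

(** * Paths and root operators *)

Section SegmentLists.
Context (R : realType) (X : twisted_type) (hX : admissible X) (m : Ifin X -> nat).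
Context (i : 'I_(rank X).+1).
Local Notation endo := ('M[R]_((rank X).+2)).
Local Notation hdual := 'cV[R]_(rank X).+2.
Local Notation W := (WJaf (R := R) (Jset m)).
Local Notation p := (pw m i).
Local Notation s := (sdir i).
Local Notation lam := (level0_weight R m).
Local Notation dchain := (dchain m).

(* A path is encoded by the list of its directions, each with the time at which
   it ends. *)
Local Notation seg := (endo * R)%type.
Definition seg_path (g : seq seg) : prepath R X := Prepath (unzip1 g) (0 :: unzip2 g).

(** Truncation by [Num.min] makes the height defined at all times and constant outside the interval
    covered by [g], so it is additive under concatenation. *)
Fixpoint hgt (a : R) (g : seq seg) (t : R) : R :=
  if g is (x, b) :: g' then (Num.min t b - Num.min t a) * p x + hgt b g' t else 0.
Fixpoint pvec (a : R) (g : seq seg) (t : R) : hdual :=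
  if g is (x, b) :: g' then (Num.min t b - Num.min t a) *: (x *m lam) + pvec b g' t else 0.
Fixpoint tot (a : R) (g : seq seg) : R :=
  if g is (x, b) :: g' then (b - a) * p x + tot b g' else 0.

Definition ends (a : R) (g : seq seg) : R := last a (unzip2 g).

Lemma pairing_pvec a g t : pairing (simple_coroot R i) (pvec a g t) = hgt a g t.
Proof.
elim: g a => [|[x b] g IH] a /=; first by rewrite pairing0r.
by rewrite pairingDr pairingZr IH.
Qed.

Lemma ends_cat a g h : ends a (g ++ h) = ends (ends a g) h.
Proof. by rewrite /ends /unzip2 map_cat last_cat. Qed.
Lemma hgt_cat a g h t : hgt a (g ++ h) t = hgt a g t + hgt (ends a g) h t.
Proof. by elim: g a => [|[x b] g IH] a /=; rewrite ?add0r // IH addrA. Qed.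
Lemma pvec_cat a g h t : pvec a (g ++ h) t = pvec a g t + pvec (ends a g) h t.
Proof. by elim: g a => [|[x b] g IH] a /=; rewrite ?add0r // IH addrA. Qed.
Lemma tot_cat a g h : tot a (g ++ h) = tot a g + tot (ends a g) h.
Proof. by elim: g a => [|[x b] g IH] a /=; rewrite ?add0r // IH addrA. Qed.

Definition incr (a : R) (g : seq seg) : bool := path <%R a (unzip2 g).

Lemma incr_cat a g h : incr a (g ++ h) = incr a g && incr (ends a g) h.
Proof. by rewrite /incr /unzip2 map_cat cat_path. Qed.
Lemma incr_ends a g : incr a g -> a <= ends a g.
Proof.
elim: g a => [|[x b] g IH] a //= /andP[ab /IH h]; exact: le_trans (ltW ab) h.
Qed.
Lemma incr_ends_lt a g : incr a g -> g != [::] -> a < ends a g.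
Proof. by case: g => [|[x b] g] //= /andP[ab /incr_ends h] _; exact: lt_le_trans ab h. Qed.

Lemma hgt_before a g t : incr a g -> t <= a -> hgt a g t = 0.
Proof.
elim: g a => [|[x b] g IH] a //= /andP[ab gi] ta.
rewrite IH //; last exact: le_trans ta (ltW ab).
by rewrite !min_l ?subrr ?mul0r ?addr0 // (le_trans ta (ltW ab)).
Qed.
Lemma hgt_after a g t : incr a g -> ends a g <= t -> hgt a g t = tot a g.
Proof.
elim: g a => [|[x b] g IH] a //= /andP[ab gi] bt; rewrite IH //.
have bt' : b <= t by apply: le_trans (incr_ends gi) bt.
by rewrite !min_r // (le_trans (ltW ab)).
Qed.
Lemma pvec_before a g t : incr a g -> t <= a -> pvec a g t = 0.
Proof.
elim: g a => [|[x b] g IH] a //= /andP[ab gi] ta.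
rewrite IH //; last exact: le_trans ta (ltW ab).
by rewrite !min_l ?subrr ?scale0r ?addr0 // (le_trans ta (ltW ab)).
Qed.

(** A piecewise linear function is bounded below by its values at the break points. *)
Lemma hgt_ge c a g t : incr a g ->
  (forall k, (k <= size g)%N -> c <= tot a (take k g)) -> c <= hgt a g t.
Proof.
elim: g a c => [|[x b] g IH] a c /=; first by move=> _ /(_ 0%N); exact.
move=> /andP[ab gi] hc; have c0 := hc 0%N isT.
have c1 : c <= (b - a) * p x by have := hc 1%N isT; rewrite /= take0 addr0.
have [tb|bt] := leP t b.
  rewrite hgt_before // addr0.
  have [ta|at_] := leP t a; first by rewrite subrr mul0r.
  have [px|px] := leP 0 (p x); first by apply: le_trans c0 _; rewrite mulr_ge0 // subr_ge0 ltW.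
  by apply: le_trans c1 _; rewrite ler_nM2r // lerD2r.
rewrite min_r; last by rewrite ltW // (lt_trans ab).
rewrite -lerBlDl; apply: IH => // k kg; rewrite lerBlDl.
by have := hc k.+1 kg.
Qed.

Lemma incr_cons a x b g : incr a ((x, b) :: g) = (a < b) && incr b g.
Proof. by []. Qed.
Lemma ends_cons a x b g : ends a ((x, b) :: g) = ends b g.
Proof. by []. Qed.
Lemma ends_rcons a g x b : ends a (rcons g (x, b)) = b.
Proof. by rewrite /ends /unzip2 map_rcons last_rcons. Qed.

Lemma rcons_belast_ends a g : rcons (take (size g) (a :: unzip2 g)) (ends a g) = a :: unzip2 g.
Proof. by rewrite [in take _ _]lastI -[in take _ _]cats1 take_size_cat ?size_belast ?size_map // [RHS]lastI. Qed.

Arguments incr : simpl never.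
Arguments ends : simpl never.

Lemma min_diff (a b t : R) : a < b -> 0 <= Num.min t b - Num.min t a <= b - a.
Proof. by move=> ab; case: (leP t b) => h1; case: (leP t a) => h2; lra. Qed.

Definition descending (g : seq seg) : bool := all (fun u : seg => p u.1 < 0) g.

Lemma hgt_le0 a g t : descending g -> incr a g -> hgt a g t <= 0.
Proof.
elim: g a => [|[x b] g IH] a //; rewrite incr_cons /= => /andP[px gd] /andP[ab gi].
by rewrite -[leRHS]addr0 lerD ?IH // mulr_ge0_le0 ?(ltW px) //; case/andP: (min_diff t ab).
Qed.
Lemma hgt_lt0 a g t : descending g -> incr a g -> g != [::] -> a < t -> hgt a g t < 0.
Proof.
case: g => [|[x b] g] //; rewrite incr_cons /= => /andP[px gd] /andP[ab gi] _ at_.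
rewrite -[ltRHS]addr0 ltr_leD ?hgt_le0 // pmulr_rlt0 // subr_gt0 (min_r (ltW at_)).
by rewrite lt_min at_.
Qed.
Lemma tot_le_hgt a g t : descending g -> incr a g -> tot a g <= hgt a g t.
Proof.
elim: g a => [|[x b] g IH] a //; rewrite incr_cons /= => /andP[px gd] /andP[ab gi].
by rewrite lerD ?IH // ler_nM2r //; case/andP: (min_diff t ab).
Qed.
Lemma tot_lt_hgt a g t : descending g -> incr a g -> t < ends a g -> g != [::] ->
  tot a g < hgt a g t.
Proof.
elim: g a => [|[x b] g IH] a //; rewrite incr_cons ends_cons /=.
move=> /andP[px gd] /andP[ab gi] tg _.
have w : (b - a) * p x <= (Num.min t b - Num.min t a) * p x.
  by rewrite ler_nM2r //; case/andP: (min_diff t ab).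
case: g IH gd gi tg => [|u g] IH gd gi tg.
  have {}tg : t < b := tg.
  rewrite /= !addr0 ltr_nM2r // (min_l (ltW tg)).
  by case: (leP t a); lra.
by apply: ler_ltD => //; apply: IH.
Qed.

Definition sseg (g : seq seg) : seq seg := [seq (s u.1, u.2) | u <- g].

Lemma unzip2_sseg g : unzip2 (sseg g) = unzip2 g.
Proof. by rewrite /unzip2 -map_comp. Qed.
Lemma unzip1_sseg g : unzip1 (sseg g) = map s (unzip1 g).
Proof. by rewrite /unzip1 -!map_comp. Qed.
Lemma ends_sseg a g : ends a (sseg g) = ends a g.
Proof. by rewrite /ends unzip2_sseg. Qed.
Lemma incr_sseg a g : incr a (sseg g) = incr a g.
Proof. by rewrite /incr unzip2_sseg. Qed.
Lemma ssegK : involutive sseg.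
Proof.
by move=> g; rewrite /sseg -map_comp -[RHS]map_id; apply: eq_map => -[x b] /=; rewrite (sdirK hX).
Qed.
Lemma hgt_sseg a g t : hgt a (sseg g) t = - hgt a g t.
Proof.
by elim: g a => [|[x b] g IH] a /=; rewrite ?oppr0 // IH (pw_sdir hX) mulrN opprD.
Qed.
Lemma tot_sseg a g : tot a (sseg g) = - tot a g.
Proof.
by elim: g a => [|[x b] g IH] a /=; rewrite ?oppr0 // IH (pw_sdir hX) mulrN opprD.
Qed.
Lemma pvec_sseg a g t : pvec a (sseg g) t = pvec a g t - hgt a g t *: simple_root R i.
Proof.
elim: g a => [|[x b] g IH] a /=; first by rewrite scale0r subr0.
rewrite IH /sdir -mulmxA reflection_mul -/(pw m i x) scalerBr scalerA scalerDl opprD.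
by rewrite addrACA.
Qed.

(** * Merging equal adjacent directions *)

Local Notation d0 := ((0, 0) : seg).

(** A segment records only its ending time, so deleting the last segment of [A] extends the first
    one of [B] backwards. *)
Definition trim (A B : seq seg) : seq seg :=
  take (size A - ((B != [::]) && ((last d0 A).1 == (head d0 B).1))) A.

Variant trim_spec (A B : seq seg) : seq seg -> Prop :=
| TrimNo of (A != [::] -> B != [::] -> (last d0 A).1 != (head d0 B).1) : trim_spec A B A
| TrimYes A' x t b B' of A = rcons A' (x, t) & B = (x, b) :: B' : trim_spec A B A'.

Lemma trimP A B : trim_spec A B (trim A B).
Proof.
rewrite /trim; case: (lastP A) => [|A' [x t]]; first exact: TrimNo.
case: B => [|[y b] B']; first by rewrite subn0 take_size; apply: TrimNo.
rewrite last_rcons /=; have [<-|xy] := eqVneq x y.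
  rewrite size_rcons subn1 /= -cats1 take_size_cat // cats1.
  exact: (@TrimYes _ _ A' x t b B').
by rewrite subn0 take_size; apply: TrimNo => _ _; rewrite last_rcons.
Qed.

Lemma hgt_glue a A B t : hgt a (trim A B ++ B) t = hgt a (A ++ B) t.
Proof.
case: trimP => // A' x c b B' -> ->; rewrite -cats1 -catA !hgt_cat /=.
by congr (_ + _); ring.
Qed.
Lemma pvec_glue a A B t : pvec a (trim A B ++ B) t = pvec a (A ++ B) t.
Proof.
case: trimP => // A' x c b B' -> ->; rewrite -cats1 -catA !pvec_cat /=.
congr (_ + _); rewrite addr0 addrA -scalerDl; congr (_ *: _ + _).
by rewrite /ends /=; ring.
Qed.
Lemma incr_glue a A B : incr a (A ++ B) -> incr a (trim A B ++ B).
Proof.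
case: trimP => // A' x c b B' -> ->; rewrite -cats1 -catA !incr_cat /=.
rewrite !incr_cons => /and3P[-> /andP[ac _] /andP[cb ->]].
by rewrite (lt_trans ac cb).
Qed.
Lemma ends_glue a A B : ends a (trim A B ++ B) = ends a (A ++ B).
Proof. by case: trimP => // A' x c b B' -> ->; rewrite -cats1 -catA !ends_cat. Qed.

(** * Comparison with the paths of the definitions *)

Lemma path_at_rec a g t : incr a g -> a <= t <= ends a g ->
  let k := find (fun b => t <= b) (unzip2 g) in
  \sum_(j < k) ((a :: unzip2 g)`_j.+1 - (a :: unzip2 g)`_j) *: (nth 1%:M (unzip1 g) j *m lam)
  + (t - (a :: unzip2 g)`_k) *: (nth 1%:M (unzip1 g) k *m lam) = pvec a g t.
Proof.
elim: g a => [|[x b] g IH] a.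
  move=> _ tt; have -> : t = a by apply/eqP; rewrite eq_le andbC.
  rewrite /=.
  by rewrite big_ord0 subrr scale0r addr0.
rewrite incr_cons ends_cons => /andP[ab gi] /andP[at_ tg] /=.
have [tb|bt] := leP t b.
  by rewrite big_ord0 /= add0r (min_r at_) pvec_before // addr0.
rewrite big_ord_recl /= (min_r at_) -addrA; congr (_ + _).
by apply: IH => //; rewrite ltW.
Qed.

Lemma path_at_pvec g t : incr 0 g -> 0 <= t <= ends 0 g -> path_at m (seg_path g) t = pvec 0 g t.
Proof. exact: path_at_rec. Qed.
Lemma Hfun_hgt g t : incr 0 g -> 0 <= t <= ends 0 g -> Hfun m i (seg_path g) t = hgt 0 g t.
Proof. by move=> gi tg; rewrite /Hfun path_at_pvec // pairing_pvec. Qed.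

Lemma path_wt_pvec g : incr 0 g -> path_wt m (seg_path g) = pvec 0 g (ends 0 g).
Proof.
rewrite /path_wt /= => gi.
suff st t : forall b, incr b g -> ends b g <= t ->
    \sum_(k < size (unzip1 g)) ((b :: unzip2 g)`_k.+1 - (b :: unzip2 g)`_k)
      *: (nth 1%:M (unzip1 g) k *m lam) = pvec b g t by apply: st.
elim: g {gi} => [|[x c] g IH] b /=; first by rewrite big_ord0.
rewrite incr_cons ends_cons => /andP[bc gi] gt; rewrite big_ord_recl /=.
have ct : c <= t := le_trans (incr_ends gi) gt.
rewrite (min_r ct) (min_r (le_trans (ltW bc) ct)); congr (_ + _).
exact: IH.
Qed.

(** The chain runs from the later direction to the earlier one, at the time where the earlier
    segment ends. *)
Definition adj (u v : seg) : bool := `[< dchain u.2 v.1 u.1 >].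
Definition okseg (u : seg) : bool := `[< W u.1 /\ is_rational u.2 >].

Definition LS (g : seq seg) : Prop :=
  [/\ incr 0 g, ends 0 g = 1, all okseg g & sorted adj g].

Lemma LS_siLS g : LS g -> is_siLS m (seg_path g).
Proof.
move=> [gi ge /(all_nthP d0) go gs]; rewrite /is_siLS /= !size_map.
have n1 k : (k < size g)%N -> nth 1%:M (unzip1 g) k = (nth d0 g k).1.
  by move=> kg; rewrite (nth_map d0).
have n2 k : (k < size g)%N -> (unzip2 g)`_k = (nth d0 g k).2.
  by move=> kg; rewrite (nth_map d0).
split=> //.
- by move=> k kg; rewrite n1 //; have /asboolP [] := go k kg.
- case=> [|k] kg /=; first by exists 0; rewrite rmorph0.
  by rewrite n2 //; have /asboolP [] := go k kg.
- split=> //; first by rewrite -ge /ends (last_nth 0) size_map.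
  by move=> k kg; move/(pathP 0): gi => /(_ k); rewrite size_map; exact.
case=> [|k] //= kg; rewrite n2 ?(ltn_trans (ltnSn k)) // !n1 ?(ltn_trans (ltnSn k)) //.
by move/(sortedP d0): gs => /(_ k kg) /asboolP [bs b0 C]; exists bs.
Qed.

Lemma siLS_LS eta : is_siLS m eta -> exists2 g, eta = seg_path g & LS g.
Proof.
case: eta => xs ts [/= szt Wx rt [t0 ts1 tincr] ch].
case: ts szt t0 ts1 rt tincr ch => [|t ts] //= [szt] t0 ts1 rt tincr ch.
have gE1 : unzip1 (zip xs ts) = xs by rewrite unzip1_zip // szt.
have gE2 : unzip2 (zip xs ts) = ts by rewrite unzip2_zip // szt.
have sz : size (zip xs ts) = size xs by rewrite size_zip szt minnn.
have n k : nth d0 (zip xs ts) k = (nth 0 xs k, nth 0 ts k) by rewrite nth_zip.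
have nx k : (k < size xs)%N -> nth 0 xs k = nth 1%:M xs k.
  by move=> kx; apply: set_nth_default.
exists (zip xs ts); first by rewrite /seg_path gE1 gE2 t0.
split.
- rewrite /incr gE2; apply/(pathP 0) => k; rewrite szt => kx.
  by have := tincr k kx; rewrite t0.
- by move: ts1; rewrite t0 => <-; rewrite /ends gE2 (last_nth 0) szt.
- apply/(all_nthP d0) => k; rewrite sz => kx; rewrite n; apply/asboolP; split=> /=.
    by rewrite nx //; exact: Wx.
  exact: (rt k.+1).
apply/(sortedP d0) => k; rewrite sz => kx; rewrite !n; apply/asboolP => /=.
rewrite !nx ?(ltn_trans (ltnSn k)) //.
by have [bs b0 C] := ch k.+1 kx; exists bs.
Qed.

Lemma set_minE (S : set R) v : S v -> (forall w, S w -> v <= w) -> set_min S = v.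
Proof.
move=> Sv lv; apply: xget_unique => // w [Sw lw].
by apply/eqP; rewrite eq_le lv // andbT; apply: lw.
Qed.
Lemma set_maxE (S : set R) v : S v -> (forall w, S w -> w <= v) -> set_max S = v.
Proof.
move=> Sv lv; apply: xget_unique => // w [Sw lw].
by apply/eqP; rewrite eq_le lv //=; apply: lw.
Qed.

(* The function H has minimum [mm], first reached on the path A B C at the end of B,
   and [mm + 1] is the value of H at the beginning of B. *)
Record config (A B C : seq seg) (mm : R) : Prop := Config {
  cf_ne : B != [::];
  cf_incr : incr 0 (A ++ B ++ C);
  cf_end : ends 0 (A ++ B ++ C) = 1;
  cf_desc : descending B;
  cf_int : mm \is a Num.int;
  cf_totA : tot 0 A = mm + 1;
  cf_A : forall t, mm + 1 <= hgt 0 A t;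
  cf_totB : tot (ends 0 A) B = - 1;
  cf_C : forall t, 0 <= hgt (ends (ends 0 A) B) C t
}.

(** Only one joint of each path can need merging: slopes in [B] are negative and [C] begins with a
    nonnegative slope; after reflection the slopes of [B] are positive and [A] ends with a
    nonpositive one. *)
Definition low_path (A B C : seq seg) : seq seg := (trim A B ++ B) ++ C.
Definition high_path (A B C : seq seg) : seq seg := A ++ (trim (sseg B) C ++ C).

Lemma nth_ends a g h : nth 0 (a :: unzip2 (g ++ h)) (size g) = ends a g.
Proof.
by rewrite /unzip2 map_cat -cat_cons nth_cat /= size_map ltnS leqnn /ends (last_nth 0) size_map.
Qed.
Lemma index_ends a g h : incr a (g ++ h) -> index (ends a g) (a :: unzip2 (g ++ h)) = size g.
Proof.
move=> gi; rewrite -(nth_ends a g h) index_uniq //.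
  by rewrite /= size_map size_cat ltnS leq_addr.
exact: (sorted_uniq lt_trans (@ltxx _ R)).
Qed.
Lemma find_gt a g v h t : incr a (g ++ v :: h) -> ends a g <= t -> t < v.2 ->
  find (fun b => t < b) (a :: unzip2 (g ++ v :: h)) = (size g).+1.
Proof.
elim: g a => [|[x b] g IH] a gi gt tv.
  by rewrite /= [t < a]ltNge [a <= t]gt /= tv.
move: gi; rewrite cat_cons incr_cons => /andP[ab gi].
have bt : b <= t by move: gi gt; rewrite incr_cat ends_cons => /andP[/incr_ends h1 _]; exact: le_trans.
rewrite [LHS]/= [t < a]ltNge (le_trans (ltW ab)) //=.
by congr S; apply: IH.
Qed.
Lemma find_ge a g v h t : incr a (g ++ v :: h) -> ends a g < t -> t <= v.2 ->
  find (fun b => t <= b) (a :: unzip2 (g ++ v :: h)) = (size g).+1.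
Proof.
elim: g a => [|[x b] g IH] a gi gt tv.
  by rewrite /= [t <= a]leNgt [a < t]gt /= tv.
move: gi; rewrite cat_cons incr_cons => /andP[ab gi].
have bt : b < t.
  by move: gi gt; rewrite incr_cat ends_cons => /andP[/incr_ends h1 _]; exact: le_lt_trans.
rewrite [LHS]/= [t <= a]leNgt (lt_trans ab) //=.
by congr S; apply: IH.
Qed.

(** * The root operators on a decomposed path *)

Section Config.
Context (A B C : seq seg) (mm : R) (cf : config A B C mm).
Local Notation t0 := (ends 0 A).
Local Notation t1 := (ends t0 B).

Lemma cf_incrs : [/\ incr 0 A, incr t0 B & incr t1 C].
Proof. by have := cf_incr cf; rewrite !incr_cat => /and3P[]. Qed.
Lemma cf_times : [/\ 0 <= t0, t0 < t1 & t1 <= 1].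
Proof.
have [iA iB iC] := cf_incrs; split; [exact: incr_ends | exact: incr_ends_lt iB (cf_ne cf) |].
by have := incr_ends iC; rewrite -(cf_end cf) !ends_cat.
Qed.
Lemma cf_mm : mm + 1 <= 0.
Proof. by have := cf_A cf 0; have [iA _ _] := cf_incrs; rewrite hgt_before. Qed.

Lemma hgt_low t : hgt 0 (low_path A B C) t = hgt 0 A t + hgt t0 B t + hgt t1 C t.
Proof. by rewrite hgt_cat hgt_glue ends_glue hgt_cat ends_cat. Qed.
Lemma hgt_high t : hgt 0 (high_path A B C) t = hgt 0 A t - hgt t0 B t + hgt t1 C t.
Proof. by rewrite hgt_cat hgt_glue hgt_cat ends_sseg hgt_sseg addrA. Qed.

Lemma low_incr : incr 0 (low_path A B C).
Proof.
have := cf_incr cf; rewrite catA incr_cat => /andP[iAB iC].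
by rewrite incr_cat incr_glue // ends_glue.
Qed.
Lemma low_end : ends 0 (low_path A B C) = 1.
Proof. by rewrite ends_cat ends_glue -(cf_end cf) catA [RHS]ends_cat. Qed.
Lemma high_incr : incr 0 (high_path A B C).
Proof.
have [iA iB iC] := cf_incrs; rewrite incr_cat iA; apply: incr_glue.
by rewrite incr_cat incr_sseg ends_sseg iB.
Qed.
Lemma high_end : ends 0 (high_path A B C) = 1.
Proof. by rewrite ends_cat ends_glue ends_cat ends_sseg -(cf_end cf) !ends_cat. Qed.

Local Notation in01 t := (0 <= t <= 1).

Lemma Hfun_low t : in01 t -> Hfun m i (seg_path (low_path A B C)) t = hgt 0 A t + hgt t0 B t + hgt t1 C t.
Proof. by move=> t01; rewrite Hfun_hgt ?hgt_low ?low_end //; exact: low_incr. Qed.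
Lemma Hfun_high t : in01 t -> Hfun m i (seg_path (high_path A B C)) t = hgt 0 A t - hgt t0 B t + hgt t1 C t.
Proof. by move=> t01; rewrite Hfun_hgt ?hgt_high ?high_end //; exact: high_incr. Qed.

Lemma in01_t0 : in01 t0.
Proof. by have [h1 h2 h3] := cf_times; rewrite h1 (le_trans (ltW h2)). Qed.
Lemma in01_t1 : in01 t1.
Proof. by have [h1 h2 h3] := cf_times; rewrite h3 (le_trans h1) // ltW. Qed.

Lemma hA_after t : t0 <= t -> hgt 0 A t = mm + 1.
Proof. by have [iA _ _] := cf_incrs => h; rewrite hgt_after // (cf_totA cf). Qed.
Lemma hB_after t : t1 <= t -> hgt t0 B t = - 1.
Proof. by have [_ iB _] := cf_incrs => h; rewrite hgt_after // (cf_totB cf). Qed.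
Lemma hB_le0 t : hgt t0 B t <= 0.
Proof. by have [_ iB _] := cf_incrs; rewrite hgt_le0 ?(cf_desc cf). Qed.
Lemma hB_lt0 t : t0 < t -> hgt t0 B t < 0.
Proof. by have [_ iB _] := cf_incrs => h; apply: hgt_lt0 => //; [exact: cf_desc cf | exact: cf_ne cf]. Qed.
Lemma hB_ge t : - 1 <= hgt t0 B t.
Proof. by have [_ iB _] := cf_incrs; rewrite -(cf_totB cf) tot_le_hgt ?(cf_desc cf). Qed.
Lemma hB_gt t : t < t1 -> - 1 < hgt t0 B t.
Proof.
have [_ iB _] := cf_incrs => h; rewrite -(cf_totB cf).
by apply: tot_lt_hgt => //; [exact: cf_desc cf | exact: cf_ne cf].
Qed.
Lemma hB_before t : t <= t0 -> hgt t0 B t = 0.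
Proof. by have [_ iB _] := cf_incrs; exact: hgt_before. Qed.
Lemma hC_before t : t <= t1 -> hgt t1 C t = 0.
Proof. by have [_ _ iC] := cf_incrs; exact: hgt_before. Qed.

Lemma Hmin_low : Hmin m i (seg_path (low_path A B C)) = mm.
Proof.
have [h1 h2 h3] := cf_times; apply: set_minE => [|_ [t t01 ->]].
  exists t1; first exact: in01_t1.
  by rewrite Hfun_low ?in01_t1 // hA_after ?(ltW h2) // hB_after // hC_before //; ring.
by rewrite Hfun_low //; have := cf_A cf t; have := hB_ge t; have := cf_C cf t; lra.
Qed.
Lemma Hmin_high : Hmin m i (seg_path (high_path A B C)) = mm + 1.
Proof.
have [h1 h2 h3] := cf_times; apply: set_minE => [|_ [t t01 ->]].
  exists t0; first exact: in01_t0.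
  by rewrite Hfun_high ?in01_t0 // hA_after // hB_before // hC_before ?(ltW h2) //; ring.
by rewrite Hfun_high //; have := cf_A cf t; have := hB_le0 t; have := cf_C cf t; lra.
Qed.

Lemma low_t1 : set_min [set t | in01 t /\ Hfun m i (seg_path (low_path A B C)) t = mm]%classic = t1.
Proof.
have [h1 h2 h3] := cf_times; apply: set_minE => [|t [t01]].
  split; first exact: in01_t1.
  by rewrite Hfun_low ?in01_t1 // hA_after ?(ltW h2) // hB_after // hC_before //; ring.
rewrite Hfun_low // => E; rewrite leNgt; apply/negP => tt.
by have := cf_A cf t; have := hB_gt tt; have := cf_C cf t; lra.
Qed.
Lemma low_t0 : set_max [set t | 0 <= t <= t1 /\
   Hfun m i (seg_path (low_path A B C)) t = mm + 1]%classic = t0.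
Proof.
have [h1 h2 h3] := cf_times; apply: set_maxE => [|t [/andP[t_0 t_1]]].
  split; first by rewrite h1 ltW.
  by rewrite Hfun_low ?in01_t0 // hA_after // hB_before // hC_before ?(ltW h2) //; ring.
have t01 : in01 t by rewrite t_0 (le_trans t_1).
rewrite Hfun_low // => E; rewrite leNgt; apply/negP => tt.
have := hB_lt0 tt; rewrite hA_after ?(ltW tt) // hC_before // in E; lra.
Qed.
Lemma high_t0 : set_max [set t | in01 t /\
   Hfun m i (seg_path (high_path A B C)) t = mm + 1]%classic = t0.
Proof.
have [h1 h2 h3] := cf_times; apply: set_maxE => [|t [t01]].
  split; first exact: in01_t0.
  by rewrite Hfun_high ?in01_t0 // hA_after // hB_before // hC_before ?(ltW h2) //; ring.
rewrite Hfun_high // => E; rewrite leNgt; apply/negP => tt.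
by have := hB_lt0 tt; have := cf_A cf t; have := cf_C cf t; lra.
Qed.
Lemma high_t1 : set_min [set t | t0 <= t <= 1 /\
   Hfun m i (seg_path (high_path A B C)) t = mm + 1 + 1]%classic = t1.
Proof.
have [h1 h2 h3] := cf_times; apply: set_minE => [|t [/andP[t_0 t_1]]].
  split; first by rewrite h3 ltW.
  by rewrite Hfun_high ?in01_t1 // hA_after ?(ltW h2) // hB_after // hC_before //; ring.
have t01 : in01 t by rewrite t_1 (le_trans h1).
rewrite Hfun_high // => E; rewrite leNgt; apply/negP => tt.
have := hB_gt tt; rewrite hA_after // hC_before ?(ltW tt) // in E; lra.
Qed.

Lemma Hfun_high1 : Hfun m i (seg_path (high_path A B C)) 1 != mm + 1.
Proof.
have [h1 h2 h3] := cf_times; rewrite Hfun_high ?ler01 ?lexx // hB_after //.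
by apply/eqP; have := cf_A cf 1; have := cf_C cf 1; lra.
Qed.
Lemma last_segs : exists B1 y, sseg B = rcons B1 (y, t1).
Proof.
have := cf_ne cf; rewrite -size_eq0 -(size_map (fun u => (s u.1, u.2)) B) -/(sseg B) size_eq0.
rewrite -(ends_sseg t0 B); case: (lastP (sseg B)) => [//|B1 [y t]] _; exists B1, y.
by rewrite /ends /unzip2 map_rcons last_rcons.
Qed.

(** A computation on lists with p = size A' + 1 and q = size A' + size B, where A' is the trimmed
    [A]. [drop_p] holds when trimming changed nothing, [drop_q] when the reflected [B] merges with
    [C]. *)
Lemma e_raw_low : e_raw m i (seg_path (low_path A B C)) = Some (seg_path (high_path A B C)).
Proof.
have [h1 h2 h3] := cf_times.
rewrite /e_raw Hmin_low (_ : (mm == 0) = false); last by apply/eqP; have := cf_mm; lra.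
rewrite low_t1 low_t0; congr Some.
set xs := dirs _; set ts := times _.
set A' := trim A B; set n := size A'.
have A'A : ends 0 A' <= t0.
  rewrite /A'; case: trimP => // A1 x t b B1 EA _.
  have [iA _ _] := cf_incrs; rewrite EA ends_rcons; move: iA.
  by rewrite EA -cats1 incr_cat => /andP[_]; rewrite incr_cons => /andP[/ltW].
have [v [B2 EB]] : exists v B2, B = v :: B2.
  by case: (B) (cf_ne cf) => // v B2 _; exists v, B2.
have vt : t0 < v.2.
  by have [_ iB _] := cf_incrs; move: iB; rewrite EB; case: (v) => x b; rewrite incr_cons => /andP[].
have li := low_incr; rewrite /low_path -/A' in li.
have tsE : ts = 0 :: unzip2 ((A' ++ B) ++ C) by [].
have ge : ends 0 (A' ++ B) = t1 by rewrite /A' ends_glue ends_cat.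
have -> : index t1 ts = (n + size B)%N.
  by rewrite tsE -ge index_ends // size_cat.
have -> : find (fun a => t0 < a) ts = n.+1.
  rewrite tsE -catA EB cat_cons; apply: find_gt => //.
  by rewrite -cat_cons -EB catA.
have -> : ts`_n.+1.-1 = ends 0 A' by rewrite tsE -catA nth_ends.
have xsE : xs = unzip1 A' ++ unzip1 B ++ unzip1 C.
  by rewrite /xs /= /low_path /unzip1 !map_cat catA.
have {}tsE : ts = 0 :: unzip2 A' ++ unzip2 B ++ unzip2 C.
  by rewrite tsE /unzip2 !map_cat catA.
have k0 : (0 < size B)%N by rewrite EB.
set k := size B in k0 *.
have sx : size xs = (n + k + size C)%N by rewrite xsE !size_cat !size_map addnA.
set dp := t0 == ends 0 A'; set dq := (_ < _)%N && _.
have xq : nth 1%:M xs (n + k).-1 = (last d0 B).1.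
  have -> : ((n + k).-1 = n + k.-1)%N by rewrite -{1}(prednK k0) addnS.
  rewrite xsE nth_cat size_map -/n ltnNge leq_addr /= addKn.
  by rewrite nth_cat size_map -/k ltn_predL k0 (nth_map d0) ?ltn_predL // nth_last.
have xq1 : (size C != 0)%N -> nth 1%:M xs (n + k) = (head d0 C).1.
  move=> C0; rewrite xsE nth_cat size_map -/n ltnNge leq_addr /= addKn.
  rewrite nth_cat size_map -/k ltnn subnn.
  by case: (C) C0 => [|u C1] //=.
have dqE : dq = (size C != 0)%N && ((last d0 (sseg B)).1 == (head d0 C).1).
  rewrite /dq sx xq; rewrite -{1}[(n + k)%N]addn0 ltn_add2l lt0n.
  have [//|C0] := eqVneq (size C) 0%N; rewrite /= xq1 //.
  by rewrite EB /sseg map_cons /= last_map.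
(* If [A] was trimmed, its last segment is recovered by splitting the first segment of [B] at the
   inserted time [t0]. *)
have lt1 : take (if dp then n else n.+1) xs = unzip1 A /\
    rcons (take (if dp then n else n.+1) ts) t0 = 0 :: unzip2 A.
  rewrite /dp xsE tsE /n /A'; case: trimP => [_|A1 x t b B1 EA EB'].
    rewrite eqxx take_size_cat ?size_map //; split=> //.
    by rewrite -cat_cons takel_cat ?rcons_belast_ends //= size_map ltnW.
  have [iA _ _] := cf_incrs; move: iA; rewrite EA -cats1 incr_cat incr_cons => /and3P[_ tt _].
  rewrite ends_cat ends_cons (gt_eqF tt) EB' /= /unzip1 /unzip2 !map_cat /=.
  rewrite -[in X in X /\ _]cat_rcons take_size_cat ?size_rcons ?size_map // cats1.
  split=> //; rewrite take_size_cat ?size_map //.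
  by rewrite -cats1.
have lt2 : drop n (take (n + k) xs) = unzip1 B.
  rewrite xsE catA take_size_cat ?drop_size_cat ?size_cat ?size_map //.
have [lt3 lt4 lt5] : [/\ map s (unzip1 B) ++ drop (if dq then (n + k).+1 else (n + k)%N) xs =
      unzip1 (trim (sseg B) C) ++ unzip1 C,
    drop n.+1 (take (if dq then n + k else (n + k).+1)%N ts) = unzip2 (trim (sseg B) C) &
    drop (n + k).+1 ts = unzip2 C].
  have d3 : drop (n + k).+1 ts = unzip2 C.
    by rewrite tsE /= catA drop_size_cat // size_cat !size_map.
  have [B1 [y sE]] := last_segs.
  have kE : k = (size B1).+1 by rewrite -(size_rcons B1 (y, t1)) -sE size_map.
  have uB : unzip2 B = rcons (unzip2 B1) t1 by rewrite -unzip2_sseg sE /unzip2 map_rcons.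
  split=> //.
    rewrite -unzip1_sseg dqE; case: trimP => [ne|B1' y' t c C1 sE' EC].
      case: (C) xsE ne => [|u C1] xsE ne /=.
        by rewrite xsE catA drop_size_cat // size_cat !size_map.
      rewrite (negbTE (ne _ _)) //; last by rewrite sE -size_eq0 size_rcons.
      by rewrite xsE catA drop_size_cat // size_cat !size_map.
    rewrite xsE EC sE' last_rcons eqxx /= catA -cat_rcons drop_size_cat.
      by rewrite /unzip1 map_rcons cat_rcons.
    by rewrite size_rcons size_cat !size_map.
  rewrite dqE; case: trimP => [ne|B1' y' t c C1 sE' EC].
    have -> : (size C != 0)%N && ((last d0 (sseg B)).1 == (head d0 C).1) = false.
      case: (C) ne => [//|u C1] ne; rewrite (negbTE (ne _ _)) //.
      by rewrite sE -size_eq0 size_rcons.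
    rewrite tsE /= catA take_size_cat ?size_cat ?size_map //.
    by rewrite drop_size_cat ?size_map // unzip2_sseg.
  rewrite EC sE' last_rcons eqxx /= tsE.
  have [-> _] : B1' = B1 /\ true by move: sE'; rewrite sE => /rcons_inj [->].
  rewrite kE addnS /= uB cat_rcons catA take_size_cat ?size_cat ?size_map //.
  by rewrite drop_size_cat ?size_map.
rewrite [n.+1.-1]/= lt2 lt3 lt4 lt5; have [-> tA] := lt1.
rewrite /seg_path /high_path; congr Prepath; first by rewrite /unzip1 !map_cat.
by rewrite -cat_rcons tA /unzip2 !map_cat.
Qed.

Lemma f_raw_high : f_raw m i (seg_path (high_path A B C)) = Some (seg_path (low_path A B C)).
Proof.
have [h1 h2 h3] := cf_times.
rewrite /f_raw Hmin_high (negbTE Hfun_high1) high_t0 high_t1; congr Some.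
set xs := dirs _; set ts := times _; set n := size A.
have [B1 [y sE]] := last_segs; have hi := high_incr.
have [iA iB iC] := cf_incrs.
(* [w] is the segment of the high path that contains the end of the reflected part: it stops at
   [t1], or continues beyond it when the last reflected segment was merged into [C]. *)
have [w [C1 [gE w1 w2 wC]]] : exists w C1, [/\ high_path A B C = (A ++ B1) ++ w :: C1,
    w.1 = y, t1 <= w.2 & C = if t1 == w.2 then C1 else w :: C1].
  rewrite /high_path; case: trimP => [_|B1' y' t c C1 sE' EC].
    by exists (y, t1), C; rewrite lexx eqxx sE cat_rcons catA.
  move: sE'; rewrite sE => /rcons_inj [<- ey _]; exists (y, c), C1.
  have tc : t1 < c by move: iC; rewrite EC incr_cons => /andP[].
  by rewrite EC -ey catA ltW // lt_eqF.
have xsE : xs = unzip1 A ++ unzip1 B1 ++ y :: unzip1 C1.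
  by rewrite /xs /= gE /unzip1 !map_cat /= w1 catA.
have tsE : ts = 0 :: unzip2 A ++ unzip2 B1 ++ w.2 :: unzip2 C1.
  by rewrite /ts /= gE /unzip2 !map_cat /= catA.
have -> : index t0 ts = n by apply: index_ends; exact: hi.
have iB1 : ends 0 (A ++ B1) < t1.
  move: iB; rewrite -(incr_sseg _ B) sE -cats1 incr_cat incr_cons => /and3P[_ h _].
  by rewrite ends_cat.
have -> : (find (fun a => t1 <= a) ts).-1 = (n + size B1)%N.
  have -> : ts = 0 :: unzip2 ((A ++ B1) ++ w :: C1) by rewrite /ts gE.
  by rewrite find_ge ?size_cat // -gE.
set nb := size B1.
have -> : ts`_(n + nb).+1 = w.2.
  by rewrite tsE /= catA nth_cat size_cat !size_map ltnn subnn.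
set dp := (0 < n)%N && _; set dq := t1 == w.2.
have szB : size B = nb.+1 by rewrite -(size_map (fun u => (s u.1, u.2)) B) -/(sseg B) sE size_rcons.
have uB : unzip2 B = rcons (unzip2 B1) t1 by rewrite -unzip2_sseg sE /unzip2 map_rcons.
have uB1 : map s (rcons (unzip1 B1) y) = unzip1 B.
  by rewrite -{1}[y]/(y, t1).1 -map_rcons -/(unzip1 _) -sE -unzip1_sseg ssegK.
have xn : s (nth 1%:M xs n) = (head d0 B).1.
  rewrite xsE nth_cat size_map ltnn subnn -cat_rcons -(sdirK hX i (head d0 B).1); congr s.
  case: (B) (cf_ne cf) uB1 => // u B2 _; case: (B1) => [|u' B1'] /= [<- _]; by rewrite (sdirK hX).
have dpE : dp = (0 < n)%N && ((last d0 A).1 == (head d0 B).1).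
  rewrite /dp /= -/(s _) xn [RHS]andbC andbC; apply: andb_id2r => n0.
  rewrite eq_sym xsE nth_cat size_map prednK // leqnn (nth_map d0) ?prednK //.
  by rewrite nth_last.
have [lt1 lt2] : take (if dp then n.-1 else n) xs = unzip1 (trim A B) /\
    take (if dp then n else n.+1) ts = 0 :: unzip2 (trim A B).
  rewrite dpE xsE tsE /n; case: trimP => [ne|A1 x t b B2 EA EB].
    have -> : (0 < size A)%N && ((last d0 A).1 == (head d0 B).1) = false.
      by case: (A) ne => // u A1 ne; rewrite (negbTE (ne _ (cf_ne cf))).
    by rewrite take_size_cat ?size_map //= take_size_cat ?size_map.
  rewrite EA EB last_rcons size_rcons eqxx /= /unzip1 /unzip2 !map_rcons !cat_rcons.
  by rewrite !take_size_cat ?size_map.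
have lt3 : map s (drop n (take (n + nb).+1 xs)) = unzip1 B.
  rewrite xsE -cat_rcons catA take_size_cat ?size_cat ?size_rcons ?size_map ?addnS //.
  by rewrite drop_size_cat ?size_map.
have lt4 : drop (if dq then (n + nb).+1 else (n + nb)%N) xs = unzip1 C.
  rewrite wC -/dq xsE; case: dq.
    by rewrite -cat_rcons catA drop_size_cat // size_cat size_rcons !size_map addnS.
  by rewrite catA drop_size_cat ?size_cat ?size_map //= w1.
have lt5 : drop n.+1 (take (n + nb).+1 ts) = unzip2 B1.
  by rewrite tsE /= catA take_size_cat ?size_cat ?size_map // drop_size_cat ?size_map.
have lt6 : drop (if dq then (n + nb).+2 else (n + nb).+1) ts = unzip2 C.
  rewrite wC -/dq tsE /=; case: (dq) => /=.
    by rewrite -cat_rcons catA drop_size_cat // size_cat size_rcons !size_map addnS.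
  by rewrite catA drop_size_cat // size_cat !size_map.
rewrite lt1 lt2 lt3 lt4 lt5 lt6 /seg_path /low_path; congr Prepath.
  by rewrite /unzip1 !map_cat catA.
by rewrite -cat_rcons -uB /unzip2 !map_cat catA.
Qed.

End Config.


(** * Transfer of the chain conditions *)

Definition junction (r : rel seg) (A B : seq seg) : bool :=
  [|| A == [::], B == [::] | r (last d0 A) (head d0 B)].
(** The condition needed at a joint where equal directions get merged; see [sorted_glue]. *)
Definition wadj (u v : seg) : bool := (u.1 == v.1) || adj u v.

Lemma sorted_junction r A B : sorted r (A ++ B) = [&& sorted r A, sorted r B & junction r A B].
Proof.
case: A => [|u A]; first by rewrite /= /junction eqxx andbT.
rewrite [LHS]/= cat_path; case: B => [|v B]; first by rewrite /junction orbT !andbT.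
by rewrite /= /junction /=; congr (_ && _); rewrite andbC.
Qed.

Lemma sorted_glue A B : sorted adj (trim A B ++ B) =
  [&& sorted adj A, sorted adj B & junction wadj A B].
Proof.
case: trimP => [ne|A1 x t b B1 -> ->].
  rewrite sorted_junction /junction /wadj; case: A ne => // u A ne; case: B ne => // v B ne.
  by rewrite (negbTE (ne _ _)).
have -> : junction wadj (rcons A1 (x, t)) ((x, b) :: B1).
  by rewrite /junction /wadj last_rcons /= eqxx !orbT.
rewrite -cats1 !sorted_junction andbT -andbA; congr (_ && _).
by rewrite andbC [sorted adj [:: _]]/=.
Qed.

Lemma trim_cat A B C : B != [::] -> trim A (B ++ C) = trim A B.
Proof. by case: B. Qed.

Lemma adjP u v : reflect (dchain u.2 v.1 u.1) (adj u v).
Proof. exact: asboolP. Qed.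

Lemma eq_int (x y : R) : y = x -> x \is a Num.int -> y \is a Num.int.
Proof. by move=> ->. Qed.

(** Abel summation: at an inner break point b between directions x and y the term b (p x - p y) is
    an integer by [dchain_int]. *)
Lemma tot_int a u g : sorted adj (u :: g) ->
  tot a (u :: g) - ends a (u :: g) * p (last u g).1 + a * p u.1 \is a Num.int.
Proof.
elim: g a u => [|v g IH] a [x b] /=.
  by move=> _; rewrite (_ : _ + _ = 0) ?rpred0 // /ends /=; ring.
move=> /andP[/adjP /= uv gs]; have := IH b v gs; have h := dchain_int hX i uv.
move=> /rpredB /(_ h); apply: eq_int; rewrite ends_cons; case: (v) => y c /=; ring.
Qed.

(** Supplies the rationality of the break points created by splitting a segment. *)
Lemma rational_of_int (t : R) x : W x -> p x != 0 -> t * p x \is a Num.int -> is_rational t.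
Proof.
move=> Wx px /intrP [z zE]; have /intrP [y yE] := pwW_int hX i Wx.
exists (z%:~R / y%:~R); rewrite rmorphM fmorphV /= !ratr_int -zE -yE.
by rewrite mulfK.
Qed.

Lemma all_okseg_dir g : all okseg g -> forall u, u \in g -> W u.1.
Proof. by move=> /allP h u /h /asboolP []. Qed.

Lemma head_mem (g : seq seg) : g != [::] -> head d0 g \in g.
Proof. by case: g => //= u g; rewrite mem_head. Qed.
Lemma last_mem (g : seq seg) : g != [::] -> last d0 g \in g.
Proof. by case: g => //= u g _; rewrite mem_last. Qed.

Lemma sorted_sseg_neg g : descending g -> sorted adj g -> sorted adj (sseg g).
Proof.
move=> /allP gd; rewrite sorted_map; apply: sub_in_sorted (allss g) => u v ug vg /adjP uv.
by apply/adjP; apply: dchain_neg => //; exact: gd.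
Qed.
Lemma sorted_sseg_pos g : descending g -> sorted adj (sseg g) -> sorted adj g.
Proof.
move=> /allP gd; rewrite sorted_map; apply: sub_in_sorted (allss g) => u v ug vg /adjP uv.
apply/adjP; rewrite -(sdirK hX i u.1) -(sdirK hX i v.1); apply: dchain_pos => //.
  by rewrite (pw_sdir hX) oppr_gt0 gd.
by rewrite (pw_sdir hX) oppr_gt0 gd.
Qed.

Lemma okseg_sseg g : descending g -> all okseg g -> all okseg (sseg g).
Proof.
move=> /allP gd /allP go; apply/allP => _ /mapP [u ug ->]; apply/asboolP.
have /asboolP [Wu ru] := go u ug; split=> //=.
by apply: W_sdir => //; rewrite lt_eqF ?gd.
Qed.

Lemma okseg_glue_dir D D' : all okseg (trim D D' ++ D') -> forall u, u \in D -> W u.1.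
Proof.
rewrite all_cat; case: trimP => [_ /andP[/all_okseg_dir h _] //|D1 x t b D2 -> ->].
move=> /andP[/all_okseg_dir h /= /andP[/asboolP [Wx _] _]] u.
by rewrite mem_rcons inE => /predU1P [->|/h].
Qed.

Lemma head_glue D D' : D != [::] -> (head d0 (trim D D' ++ D')).1 = (head d0 D).1.
Proof.
move=> ne; case: trimP => [_|D1 x t b D2 DE D'E]; first by case: (D) ne.
by rewrite DE D'E; case: D1 {DE}.
Qed.

Lemma ends_last a g : g != [::] -> ends a g = (last d0 g).2.
Proof. by case: (lastP g) => // g' [x b] _; rewrite ends_rcons last_rcons. Qed.

Lemma junction_adj a D D' : D != [::] -> D' != [::] -> junction adj D D' ->
  dchain (ends a D) (head d0 D').1 (last d0 D).1.
Proof.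
move=> n1 n2; rewrite /junction (negbTE n1) (negbTE n2) => /asboolP.
by rewrite -(ends_last a n1).
Qed.
Lemma junction_wadj a D D' : D != [::] -> D' != [::] -> junction wadj D D' ->
  (head d0 D').1 = (last d0 D).1 \/ dchain (ends a D) (head d0 D').1 (last d0 D).1.
Proof.
move=> n1 n2; rewrite /junction (negbTE n1) (negbTE n2) /= /wadj => /orP[/eqP|/asboolP]; first by left.
by rewrite -(ends_last a n1); right.
Qed.
Lemma junction_adjI a D D' :
  (D != [::] -> D' != [::] -> dchain (ends a D) (head d0 D').1 (last d0 D).1) ->
  junction adj D D'.
Proof.
rewrite /junction; case: eqVneq => // n1; case: eqVneq => // n2 /(_ isT isT).
by rewrite (ends_last a n1) => /adjP.
Qed.
Lemma junction_wadjI a D D' :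
  (D != [::] -> D' != [::] ->
     (head d0 D').1 = (last d0 D).1 \/ dchain (ends a D) (head d0 D').1 (last d0 D).1) ->
  junction wadj D D'.
Proof.
rewrite /junction; case: eqVneq => // n1; case: eqVneq => // n2 /(_ isT isT).
rewrite /wadj (ends_last a n1) => -[->|/asboolP h]; first by rewrite eqxx.
by rewrite /adj h orbT.
Qed.

Section Transfer.
Context (A B C : seq seg) (mm : R) (cf : config A B C mm).
Local Notation t0 := (ends 0 A).
Local Notation t1 := (ends t0 B).
Local Notation b0 := (head d0 B).1.
Local Notation b1 := (last d0 B).1.

Lemma p_b0 : p b0 < 0.
Proof. by have /allP := cf_desc cf; apply; exact: head_mem (cf_ne cf). Qed.
Lemma p_b1 : p b1 < 0.
Proof. by have /allP := cf_desc cf; apply; exact: last_mem (cf_ne cf). Qed.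

Lemma slope_C : C != [::] -> 0 <= p (head d0 C).1.
Proof.
have [_ _] := cf_incrs cf; have := cf_C cf; case: C => [//|[x c] C'] h iC _ /=.
have := h c; move: iC; rewrite incr_cons => /andP[tc iC] /=.
rewrite hgt_before // addr0 minxx (min_r (ltW tc)).
by rewrite pmulr_rge0 // subr_gt0.
Qed.
Lemma slope_A : A != [::] -> p (last d0 A).1 <= 0.
Proof.
have [iA _ _] := cf_incrs cf; have := cf_A cf; have := cf_totA cf.
case: (lastP A) iA => [//|A' [x t]]; rewrite -cats1 incr_cat incr_cons => /and3P[iA' at_ _].
move=> tA hA _; have := hA (ends 0 A'); rewrite -tA hgt_cat tot_cat hgt_after //=.
rewrite (min_l (ltW at_)) minxx subrr mul0r !addr0 gerDl last_cat /=.
by rewrite pmulr_rle0 // subr_gt0.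
Qed.

(** H takes the integer value mm + 1 at [t0], so [tot_int] from time 0 leaves only this term. *)
Lemma int_last_A : A != [::] -> sorted adj A -> t0 * p (last d0 A).1 \is a Num.int.
Proof.
have := cf_totA cf; case: A => [//|u A'] tA _ /(tot_int 0); rewrite tA mul0r addr0 => h.
by apply: eq_int (rpredB (rpredD (cf_int cf) (rpred1 _)) h); rewrite /=; ring.
Qed.

Lemma int_b1 : sorted adj B -> t0 * p b0 \is a Num.int -> t1 * p b1 \is a Num.int.
Proof.
have := cf_totB cf; have := cf_ne cf; case: B => [//|u B'] _ tB /(tot_int t0); rewrite tB => h k.
by apply: eq_int (rpredB (rpredB k (rpred1 _)) h); rewrite /=; ring.
Qed.

Lemma head_sseg : (head d0 (sseg B)).1 = s b0.
Proof. by case: (B) (cf_ne cf). Qed.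
Lemma last_sseg : (last d0 (sseg B)).1 = s b1.
Proof. by case: (B) (cf_ne cf) => //= u B' _; rewrite last_map. Qed.
Lemma sseg_ne : sseg B != [::].
Proof. by case: (B) (cf_ne cf). Qed.
Lemma catBC_ne : B ++ C != [::].
Proof. by case: (B) (cf_ne cf). Qed.
Lemma glueBC_ne : trim (sseg B) C ++ C != [::].
Proof.
have := sseg_ne; case: trimP => [_|D1 x t b D2 _ ->]; first by case: (sseg B).
by case: D1.
Qed.
Lemma head_catBC : (head d0 (B ++ C)).1 = b0.
Proof. by case: (B) (cf_ne cf). Qed.

(** At [t0] the edge s b0 -> b0, allowed because t0 p(b0) is an integer, is put before the chain to
    the end of [A]. At [t1] the chain from [C] to b1 crosses to a negative value, so it can be
    shortened to end at s b1. *)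
Lemma LS_low_high : LS (low_path A B C) -> LS (high_path A B C).
Proof.
move=> [_ _ ok so]; have ne := cf_ne cf.
move: so; rewrite /low_path -catA -(trim_cat _ C ne) sorted_glue sorted_junction.
case/and3P=> sA /and3P[sB sC jBC] jAB.
have hAB : A != [::] -> b0 = (last d0 A).1 \/ dchain t0 b0 (last d0 A).1.
  by move=> An; have := junction_wadj 0 An catBC_ne jAB; rewrite head_catBC.
have hBC : C != [::] -> dchain t1 (head d0 C).1 b1.
  by move=> Cn; exact: junction_adj jBC.
move: ok; rewrite /low_path !all_cat => /andP[/andP[okA okB] okC].
have Wb0 : W b0 := all_okseg_dir okB (head_mem ne).
have Wb1 : W b1 := all_okseg_dir okB (last_mem ne).
have k0 : t0 * p b0 \is a Num.int.
  have [->|An] := eqVneq A [::]; first by rewrite /ends /= mul0r rpred0.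
  have kA := int_last_A An sA; case: (hAB An) => [->//|/(dchain_int hX i) k].
  by apply: eq_int (rpredD k kA); ring.
have k1 := int_b1 sB k0.
split; [exact: high_incr cf | exact: high_end cf | |].
  rewrite /high_path !all_cat okC andbT; apply/andP; split.
    move: okA k0; case: trimP => // A1 x t b B2 EA EB okA1.
    rewrite EA ends_rcons all_rcons okA1 andbT => k0; apply/asboolP.
    have xb : x = b0 by rewrite EB.
    split=> /=; first by rewrite xb.
    by apply: (rational_of_int Wb0) k0; rewrite lt_eqF ?p_b0.
  apply/allP => u /mem_take; apply: (allP _ u).
  exact: okseg_sseg (cf_desc cf) okB.
rewrite /high_path sorted_junction sorted_glue sA sC (sorted_sseg_neg (cf_desc cf) sB) /=.
apply/andP; split.
  apply: (@junction_wadjI t0) => _ Cn; rewrite last_sseg ends_sseg.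
  by have [] := dchain_cross_end hX (hBC Cn) (slope_C Cn) p_b1.
apply: (@junction_adjI 0) => An _; rewrite (head_glue _ sseg_ne) head_sseg.
have c := dchain_simple' hX Wb0 p_b0 k0.
by case: (hAB An) => [<-//|]; exact: dchain_trans.
Qed.

(** Here the edge s b1 -> b1 is appended at [t1], and at [t0] the chain leaving s b0 is shortened at
    its start. *)
Lemma LS_high_low : LS (high_path A B C) -> LS (low_path A B C).
Proof.
move=> [_ _ ok so]; have ne := cf_ne cf; have desc := cf_desc cf.
move: so; rewrite /high_path sorted_junction sorted_glue.
case/and3P=> sA /and3P[/(sorted_sseg_pos desc) sB sC jBC] jAB.
have hAB : A != [::] -> dchain t0 (s b0) (last d0 A).1.
  move=> An; have := junction_adj 0 An glueBC_ne jAB.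
  by rewrite (head_glue _ sseg_ne) head_sseg.
have hBC : C != [::] -> (head d0 C).1 = s b1 \/ dchain t1 (head d0 C).1 (s b1).
  by move=> Cn; have := junction_wadj t0 sseg_ne Cn jBC; rewrite last_sseg ends_sseg.
move: ok; rewrite /high_path all_cat => /andP[okA okBC].
have WB u : u \in B -> W u.1.
  move=> uB; rewrite -(sdirK hX i u.1); apply: W_sdir => //.
    by apply: (okseg_glue_dir okBC (u := (s u.1, u.2))); apply/mapP; exists u.
  by rewrite (pw_sdir hX) oppr_eq0 lt_eqF //; move/allP: desc; exact.
have Wb0 : W b0 := WB _ (head_mem ne).
have Wb1 : W b1 := WB _ (last_mem ne).
have k0 : t0 * p b0 \is a Num.int.
  have [->|An] := eqVneq A [::]; first by rewrite /ends /= mul0r rpred0.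
  have kA := int_last_A An sA; have k := dchain_int hX i (hAB An).
  rewrite -rpredN; apply: eq_int (rpredD k kA); rewrite (pw_sdir hX); ring.
have k1 := int_b1 sB k0.
split; [exact: low_incr cf | exact: low_end cf | |].
  move: okBC; rewrite all_cat => /andP[okB okC].
  rewrite /low_path !all_cat okC andbT; apply/andP; split.
    by apply/allP => u /mem_take; apply: (allP okA).
  apply/allP => u uB; apply/asboolP; split; first exact: WB.
  have uS : (s u.1, u.2) \in sseg B by apply/mapP; exists u.
  have t1E := ends_sseg t0 B.
  move: uS okB t1E; case: trimP => [_ uS /allP /(_ _ uS) /asboolP [] //|D1 x t b D2 -> _].
  rewrite mem_rcons inE ends_rcons => /predU1P [[_ ->]|uD] okB t1E.
    by rewrite t1E; apply: (rational_of_int Wb1) k1; rewrite lt_eqF ?p_b1.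
  by have /asboolP [] := allP okB _ uD.
rewrite /low_path -catA -(trim_cat _ C ne) sorted_glue sorted_junction sA sB sC /=.
apply/andP; split.
  apply: (@junction_adjI t0) => _ Cn; have c := dchain_simple' hX Wb1 p_b1 k1.
  by case: (hBC Cn) => [->//|h]; exact: dchain_trans h c.
apply: (@junction_wadjI 0) => An _; rewrite head_catBC.
have ps : 0 < p (s b0) by rewrite (pw_sdir hX) oppr_gt0 p_b0.
have [_ h] := dchain_cross_start hX (hAB An) ps (slope_A An).
by move: h; rewrite (sdirK hX).
Qed.

End Transfer.


(** * Finding the decomposition *)

Lemma first_argmin (h : nat -> R) N : exists q,
  [/\ (q <= N)%N, forall k, (k <= N)%N -> h q <= h k & forall k, (k < q)%N -> h q < h k].
Proof.
elim: N => [|N [q [qN qm qs]]].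
  by exists 0%N; split=> // k; rewrite leqn0 => /eqP ->.
have [lt|ge] := ltP (h N.+1) (h q).
  exists N.+1; split=> // k.
    by rewrite leq_eqVlt => /predU1P [->//|kN]; apply: le_trans (ltW lt) (qm k kN).
  by move=> kN; apply: lt_le_trans lt (qm k kN).
exists q; split=> //; first exact: leqW.
by move=> k; rewrite leq_eqVlt => /predU1P [->//|]; exact: qm.
Qed.

Lemma int_lt_succ (x y : R) : x \is a Num.int -> y \is a Num.int -> x < y -> x + 1 <= y.
Proof.
move=> xi yi xy; rewrite -lerBrDl; apply: int_gt0_ge1; first exact: rpredB.
by rewrite subr_gt0.
Qed.

(** [h] lists the values of H at the break points. Local minima are integers, so none of them lies
    strictly between mm and mm + 1; this forces a monotone descent from the level mm + 1 to the
    first minimum. *)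
Lemma descent_to_min (h : nat -> R) N : h 0%N = 0 ->
  (forall k, (0 < k < N)%N -> h k < h k.-1 -> h k <= h k.+1 -> h k \is a Num.int) ->
  h N \is a Num.int -> (exists2 k, (k <= N)%N & h k < 0) ->
  exists a b mm, [/\ (a < b <= N)%N, mm \is a Num.int /\ h b = mm,
    forall k, (k <= N)%N -> mm <= h k, forall k, (k <= a)%N -> mm + 1 <= h k &
    forall k, (a < k <= b)%N -> h k < mm + 1 /\ h k < h k.-1].
Proof.
move=> h0 loc hN [k0 k0N hk0]; have [q [qN qm qs]] := first_argmin h N.
have m0 : h q < 0 by apply: le_lt_trans (qm k0 k0N) hk0.
have q0 : (0 < q)%N by rewrite lt0n; apply: contraTneq m0 => ->; rewrite h0 ltxx.
have mi : h q \is a Num.int.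
  move: qN; rewrite leq_eqVlt => /predU1P [->//|qN].
  apply: loc; rewrite ?q0 ?qN // ?qs ?ltn_predL //; exact: qm.
have m1 : h q + 1 <= 0 by apply: int_lt_succ => //; exact: rpred0.
(* [a] will be the last index up to q with value at least h q + 1; index 0 qualifies because the
   minimum is a negative integer. *)
have exP : exists k, (k <= q)%N && (h q + 1 <= h k) by exists 0%N; rewrite h0.
have ubP k : (k <= q)%N && (h q + 1 <= h k) -> (k <= q)%N by case/andP.
case: (ex_maxnP exP ubP) => a /andP[aq ha] amax.
have aq' : (a < q)%N.
  by move: aq; rewrite leq_eqVlt => /predU1P [aE|//]; move: ha; rewrite aE; lra.
have between k : (k < q)%N -> h k < h q + 1 -> ~ h k \is a Num.int.
  by move=> kq kl ki; have := int_lt_succ mi ki (qs k kq); lra.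
have low k : (a < k <= q)%N -> h k < h q + 1.
  move=> /andP[ak kq]; rewrite ltNge; apply/negP => hk.
  by have := amax k; rewrite kq hk leqNgt ak => /(_ isT).
exists a, q, (h q); split=> //; first by rewrite aq'.
  (* The first minimum over the indices up to [a] would, if below mm + 1, be a non-integral local
     minimum. *)
  move=> k ka; have [j [ja jm js]] := first_argmin h a.
  apply: le_trans (jm k ka); rewrite leNgt; apply/negP => hj.
  have j0 : (0 < j)%N by rewrite lt0n; apply: contraTneq hj => ->; rewrite h0 -leNgt.
  have ja' : (j < a)%N.
    by rewrite ltn_neqAle ja andbT; apply: contraTneq hj => ->; rewrite -leNgt.
  apply: (between j (ltn_trans ja' aq') hj); apply: loc.
  - by rewrite j0 (leq_trans ja') // ltnW // (leq_trans aq').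
  - by apply: js; rewrite ltn_predL.
  - exact: jm.
elim=> [//|k IH] /andP[ak kq]; split; first by apply: low; rewrite ak.
rewrite /=; move: ak; rewrite ltnS leq_eqVlt => /predU1P [aE|ak].
  by apply: lt_le_trans (low _ _) _; rewrite -aE ?ha // ltnSn aq'.
have [hk1 hk2] := IH (introT andP (conj ak (ltnW kq))).
(* If the descent stopped here, k would be a local minimum strictly between the two levels. *)
rewrite ltNge; apply/negP => hk; apply: (between k kq hk1); apply: loc => //.
by rewrite (leq_ltn_trans (leq0n a) ak) (leq_trans kq).
Qed.

(** [descent_to_min] for the reversed sequence, shifted so as to begin at 0. *)
Lemma ascent_from_min (h : nat -> R) N : h 0%N = 0 ->
  (forall k, (0 < k < N)%N -> h k <= h k.-1 -> h k < h k.+1 -> h k \is a Num.int) ->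
  h N \is a Num.int -> (exists2 k, (k <= N)%N & h k < h N) ->
  exists a b mm, [/\ (a < b <= N)%N, mm \is a Num.int /\ h a = mm,
    forall k, (k <= N)%N -> mm <= h k, forall k, (b <= k <= N)%N -> mm + 1 <= h k &
    forall k, (a <= k < b)%N -> h k < mm + 1 /\ h k < h k.+1].
Proof.
move=> h0 loc hN [k0 k0N hk0].
have [||||a [b [mm [/andP[ab bN] [mi hb] mn ha hd]]]] :=
    @descent_to_min (fun k => h (N - k)%N - h N) N.
- by rewrite subn0 subrr.
- move=> k /andP[k1 kN]; rewrite !ltrD2r lerD2r => h1 h2; rewrite rpredB //.
  apply: loc; first by lia.
    by have -> : ((N - k).-1 = N - k.+1)%N by lia.
  by have -> : ((N - k).+1 = N - k.-1)%N by lia.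
- by rewrite subnn h0 sub0r rpredN.
- by exists (N - k0)%N; rewrite ?leq_subr // subKn // subr_lt0.
exists (N - b)%N, (N - a)%N, (mm + h N); split; first by lia.
- by split; [exact: rpredD | rewrite -hb subrK].
- by move=> k kN; have := mn (N - k)%N (leq_subr _ _); rewrite subKn //; lra.
- move=> k /andP[kb kN]; suff : mm + 1 <= h k - h N by lra.
  by have := ha (N - k)%N; rewrite subKn //; apply; lia.
move=> k kb; have := hd (N - k)%N; rewrite subKn; last lia.
have -> : (N - (N - k).-1 = k.+1)%N by lia.
by case=> [|h1 h2]; [lia | split; lra].
Qed.

(** The value of H at the k-th break point. *)
Definition brk (g : seq seg) (k : nat) : R := tot 0 (take k g).

Lemma ends_take g k : (k < size g)%N -> incr 0 g ->
  ends 0 (take k g) < (nth d0 g k).2.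
Proof.
move=> kg; rewrite -{1}(cat_take_drop k g) incr_cat (drop_nth d0 kg).
by case: (nth d0 g k) => x b; rewrite incr_cons => /and3P[_ h _].
Qed.

Lemma brkS g k : (k < size g)%N ->
  brk g k.+1 = brk g k + ((nth d0 g k).2 - ends 0 (take k g)) * p (nth d0 g k).1.
Proof.
move=> kg; rewrite /brk (take_nth d0) // -cats1 tot_cat.
by case: (nth d0 g k) => x b /=; rewrite addr0.
Qed.

Lemma brk_lt g k : (k < size g)%N -> incr 0 g -> (brk g k.+1 < brk g k) = (p (nth d0 g k).1 < 0).
Proof.
by move=> kg gi; rewrite brkS // gtrDl pmulr_rlt0 // subr_gt0 ends_take.
Qed.
Lemma brk_gt g k : (k < size g)%N -> incr 0 g -> (brk g k < brk g k.+1) = (0 < p (nth d0 g k).1).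
Proof.
by move=> kg gi; rewrite brkS // ltrDl pmulr_rgt0 // subr_gt0 ends_take.
Qed.

Lemma brk_int_last g k : sorted adj g -> (0 < k <= size g)%N ->
  brk g k - ends 0 (take k g) * p (nth d0 g k.-1).1 \is a Num.int.
Proof.
move=> gs /andP[k0 kg]; have st : sorted adj (take k g) by exact: take_sorted.
have sz : size (take k g) = k by rewrite size_takel.
have := nth_last d0 (take k g); rewrite sz nth_take ?ltn_predL // => ->.
move: st sz; rewrite /brk; case: (take k g) => [|u g'] st sz; first by rewrite -sz in k0.
by have := tot_int 0 st; rewrite mul0r addr0.
Qed.

Lemma brk_chain g k : sorted adj g -> (0 < k < size g)%N ->
  dchain (ends 0 (take k g)) (nth d0 g k).1 (nth d0 g k.-1).1.
Proof.
move=> gs /andP[k0 kg]; have sz : size (take k g) = k by rewrite size_takel // ltnW.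
have -> : ends 0 (take k g) = (nth d0 g k.-1).2.
  rewrite ends_last; last by rewrite -size_eq0 sz -lt0n.
  by rewrite -nth_last sz nth_take ?ltn_predL.
move/(sortedP d0): gs => /(_ k.-1); rewrite prednK // => /(_ kg) /asboolP.
exact.
Qed.

(** The chain between the two directions changes sign, so it crosses an edge labelled alpha_i; its
    condition makes the break time multiplied by the slope an integer, and [tot_int] passes this on
    to H. *)
Lemma brk_int g k : sorted adj g -> (0 < k < size g)%N ->
  (p (nth d0 g k.-1).1 < 0 /\ 0 <= p (nth d0 g k).1) \/
  (p (nth d0 g k.-1).1 <= 0 /\ 0 < p (nth d0 g k).1) -> brk g k \is a Num.int.
Proof.
move=> gs kk; have c := brk_chain gs kk; have [k0 kg] := andP kk.
have hl : (0 < k <= size g)%N by rewrite k0 ltnW.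
have := brk_int_last gs hl; move: c; set t := ends _ _ => c hi.
move=> hs; suff hp : t * p (nth d0 g k.-1).1 \is a Num.int.
  by apply: eq_int (rpredD hi hp); rewrite subrK.
case: hs => [[h1 h2]|[h1 h2]]; first by have [] := dchain_cross_end hX c h2 h1.
have [h3 _] := dchain_cross_start hX c h2 h1; have h4 := dchain_int hX i c.
by apply: eq_int (rpredB h3 h4); ring.
Qed.

Lemma LS_size g : LS g -> (0 < size g)%N.
Proof. by case: g => //; case=> _ /eqP; rewrite /ends /= eq_sym oner_eq0. Qed.

Lemma brk_int_end g : LS g -> brk g (size g) \is a Num.int.
Proof.
move=> L; have g0 := LS_size L; have [gi ge go gs] := L.
have := @brk_int_last g (size g) gs; rewrite g0 leqnn => /(_ isT).
rewrite take_size ge mul1r => h.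
have h' : p (nth d0 g (size g).-1).1 \is a Num.int.
  by apply: (pwW_int hX); apply: (all_okseg_dir go); rewrite mem_nth // ltn_predL.
by apply: eq_int (rpredD h h'); rewrite subrK.
Qed.

Lemma brk0 g : brk g 0 = 0. Proof. by rewrite /brk take0. Qed.
Lemma brk_size g : brk g (size g) = tot 0 g. Proof. by rewrite /brk take_size. Qed.

Lemma Hmin_ge0 g : LS g -> (forall k, (k <= size g)%N -> 0 <= brk g k) ->
  Hmin m i (seg_path g) = 0.
Proof.
move=> [gi ge _ _] h; apply: set_minE => [|_ [t t01 ->]].
  by exists 0; rewrite ?lexx ?ler01 // Hfun_hgt ?ge ?lexx ?ler01 // hgt_before.
by rewrite Hfun_hgt ?ge //; apply: hgt_ge.
Qed.
Lemma Hfun1 g : LS g -> Hfun m i (seg_path g) 1 = tot 0 g.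
Proof. by move=> [gi ge _ _]; rewrite Hfun_hgt ?ge ?lexx ?ler01 // hgt_after // ge. Qed.
Lemma Hmin_end g : LS g -> (forall k, (k <= size g)%N -> brk g (size g) <= brk g k) ->
  Hfun m i (seg_path g) 1 = Hmin m i (seg_path g).
Proof.
move=> L h; have [gi ge _ _] := L; apply/esym; apply: set_minE => [|_ [t t01 ->]].
  by exists 1; rewrite ?lexx ?ler01.
by rewrite Hfun1 // Hfun_hgt ?ge // -brk_size; apply: hgt_ge.
Qed.

Lemma take_part (g : seq seg) a b k : (a <= b)%N -> (a + k <= b)%N ->
  take a g ++ take k (drop a (take b g)) = take (a + k) g.
Proof. by move=> ab kb; rewrite -(take_takel g kb) takeD take_takel. Qed.


Lemma brk_ends g a b : (a <= b)%N -> ends (ends 0 (take a g)) (drop a (take b g)) = ends 0 (take b g).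
Proof. by move=> ab; rewrite -ends_cat -(take_takel g ab) cat_take_drop. Qed.

Lemma brk_tot g a b k : (a <= b)%N -> (a + k <= b)%N ->
  tot (ends 0 (take a g)) (take k (drop a (take b g))) = brk g (a + k) - brk g a.
Proof.
by move=> ab kb; rewrite /brk -(take_part g ab kb) tot_cat addrAC subrr add0r.
Qed.

Lemma brk_tot_end g a k : (a <= size g)%N -> (k <= size (drop a g))%N ->
  tot (ends 0 (take a g)) (take k (drop a g)) = brk g (a + k) - brk g a.
Proof.
move=> ag; rewrite size_drop => kg; rewrite -{2}(take_size g) brk_tot //.
by rewrite -leq_subRL.
Qed.

Lemma nth_part g a b j : (j < size (drop a (take b g)))%N ->
  nth d0 (drop a (take b g)) j = nth d0 g (a + j).
Proof.
move=> hj; rewrite nth_drop nth_take //.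
by move: hj; rewrite size_drop size_take; case: ifP; lia.
Qed.

Lemma all_part (P : pred seg) g a b : (b <= size g)%N ->
  (forall k, (a <= k < b)%N -> P (nth d0 g k)) -> all P (drop a (take b g)).
Proof.
move=> bg h; apply/(all_nthP d0) => j hj; rewrite nth_part //; apply: h.
by move: hj; rewrite size_drop size_takel //; lia.
Qed.

Lemma dirs_neq g k : sorted adj g -> (0 < k < size g)%N ->
  (nth d0 g k.-1).1 != (nth d0 g k).1.
Proof.
by move=> gs kg; apply/eqP => E; have := brk_chain gs kg; rewrite E; exact: dchain_irrefl.
Qed.

Lemma trim_no D D' : (D != [::] -> D' != [::] -> (last d0 D).1 != (head d0 D').1) -> trim D D' = D.
Proof.
case: trimP => // D1 x t b D2 -> ->; rewrite last_rcons /= eqxx => h.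
by have := h _ isT; rewrite -size_eq0 size_rcons => /(_ isT).
Qed.
Lemma trim_yes D x t b D' : trim (rcons D (x, t)) ((x, b) :: D') = D.
Proof. by rewrite /trim last_rcons /= eqxx size_rcons subn1 /= -cats1 take_size_cat. Qed.

Lemma trim_split g a : sorted adj g -> (a <= size g)%N -> trim (take a g) (drop a g) = take a g.
Proof.
move=> gs ag; apply: trim_no => n1 n2.
have sz : size (take a g) = a by rewrite size_takel.
have a0 : (0 < a)%N by rewrite lt0n -sz size_eq0.
have ag' : (a < size g)%N by rewrite -subn_gt0 -size_drop lt0n size_eq0.
rewrite -nth_last sz nth_take ?ltn_predL // -nth0 nth_drop addn0.
by apply: dirs_neq; rewrite ?a0.
Qed.

(** If H takes the value mm + 1 inside a segment, that segment is split there between [A] and [B],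
    and [trim] undoes the split in the low path. *)
Lemma low_config g : LS g -> Hmin m i (seg_path g) != 0 ->
  exists A B C mm, config A B C mm /\ g = low_path A B C.
Proof.
move=> L Hn; have [gi ge go gs] := L.
have [||||a [b [mm [/andP[ab bN] [mi hb] mn ha hd]]]] := @descent_to_min (brk g) (size g).
- exact: brk0.
- move=> k /andP[k0 kN] h1 h2; apply: (brk_int gs); first by rewrite k0.
  left; split; last by rewrite leNgt -brk_lt // -leNgt.
  by rewrite -brk_lt ?prednK // ltnW.
- exact: brk_int_end.
- apply: contrapT => nex; case/eqP: Hn; apply: (Hmin_ge0 L) => k kN.
  by rewrite leNgt; apply/negP => h; apply: nex; exists k.
have aN : (a < size g)%N by exact: leq_trans ab bN.
pose B0 := drop a (take b g); pose C := drop b g; pose A0 := take a g.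
have gE : g = A0 ++ B0 ++ C.
  by rewrite /A0 /B0 catA -{1}(take_takel g (ltnW ab)) cat_take_drop cat_take_drop.
have B0E : B0 = nth d0 g a :: drop a.+1 (take b g).
  by rewrite /B0 (drop_nth d0) ?nth_take // size_takel.
have eB : ends (ends 0 A0) B0 = ends 0 (take b g) by rewrite brk_ends // ltnW.
have sB0 : size B0 = (b - a)%N by rewrite size_drop size_takel.
have desc : descending B0.
  apply: all_part => // k /andP[ak kb]; rewrite -brk_lt //; last exact: leq_trans kb bN.
  by have [|_] := hd k.+1; rewrite ?ltnS ?ak.
have hC t : 0 <= hgt (ends 0 (take b g)) C t.
  apply: hgt_ge.
    by move: gi; rewrite -{1}(cat_take_drop b g) incr_cat => /andP[].
  move=> k kC; rewrite brk_tot_end // subr_ge0 hb; apply: mn.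
  by move: kC; rewrite size_drop; clear -bN; lia.
have totB : tot (ends 0 A0) B0 = mm - brk g a.
  by rewrite -hb -(take_size B0) sB0 brk_tot ?subnKC // ltnW.
have incA : incr 0 A0 by move: gi; rewrite gE incr_cat => /andP[].
case nE : (nth d0 g a) B0E => [x c] B0E.
have px : p x < 0 by have := desc; rewrite B0E => /andP[].
have sa : brk g a.+1 = brk g a + (c - ends 0 A0) * p x by rewrite brkS // nE.
have [h1 _] : brk g a.+1 < mm + 1 /\ brk g a.+1 < brk g a by have := hd a.+1; rewrite ltnSn ab; exact.
have h2 := ha a (leqnn a).
have trimA : trim A0 (B0 ++ C) = A0.
  have -> : B0 ++ C = drop a g.
    by rewrite [in RHS]gE drop_size_cat // size_takel // ltnW.
  exact: trim_split gs (ltnW aN).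
have B0n : B0 != [::] by rewrite B0E.
have [E|NE] := eqVneq (brk g a) (mm + 1).
  exists A0, B0, C, mm; split; last by rewrite /low_path -catA -(trim_cat _ C) // trimA.
  split=> //; rewrite -?gE //.
  - move=> t; apply: hgt_ge => // k; rewrite size_takel ?(ltnW aN) // => ka; rewrite take_takel //; exact: ha.
  - by rewrite totB E; ring.
  - by rewrite eB.
have gt : mm + 1 < brk g a by rewrite lt_neqAle eq_sym NE.
(* The time at which the segment of slope p x < 0 passes the level mm + 1. *)
pose t0 := ends 0 A0 + (mm + 1 - brk g a) / p x.
have t0E : (t0 - ends 0 A0) * p x = mm + 1 - brk g a.
  by rewrite /t0 addrAC subrr add0r divfK // lt_eqF.
have t0a : ends 0 A0 < t0.
  by rewrite ltrDl nmulr_lgt0 ?invr_lt0 // subr_lt0.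
have t0c : t0 < c.
  by rewrite -(ltrD2r (- ends 0 A0)) -(ltr_nM2r px) t0E; lra.
have incr' : incr 0 ((rcons A0 (x, t0)) ++ B0 ++ C).
  move: gi; rewrite gE -cats1 -!catA !incr_cat B0E /= !incr_cons.
  by rewrite /ends /= => /andP[-> /andP[/andP[_ ->] ->]]; rewrite t0a t0c.
exists (rcons A0 (x, t0)), B0, C, mm; split; last first.
  by rewrite /low_path -catA -(trim_cat _ C) // B0E cat_cons trim_yes -cat_cons -B0E.
split=> //; rewrite ?ends_rcons //.
- by rewrite -[RHS]ge gE -cats1 -catA !ends_cat B0E.
- by rewrite -cats1 tot_cat /= t0E addr0 addrC subrK.
- move=> t; apply: hgt_ge; first by move: incr'; rewrite incr_cat => /andP[].
  move=> k; rewrite size_rcons leq_eqVlt => /predU1P [->|kA].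
    rewrite -(size_rcons A0 (x, t0)) take_size -cats1 tot_cat /= t0E addr0.
    by rewrite -/(brk g a); lra.
  rewrite -cats1 takel_cat //; move: kA; rewrite ltnS size_takel ?(ltnW aN) // => ka.
  by rewrite take_takel //; exact: ha.
- move: totB; rewrite B0E /= => h; rewrite (_ : (c - t0) * p x = (c - ends 0 A0) * p x - (t0 - ends 0 A0) * p x); last by ring.
  by rewrite t0E; lra.
- by move: eB; rewrite B0E /ends /= => ->.
Qed.

(** Here the ascent after the last minimum is cut out and reflected back. The configuration has
    parameter mm - 1, because the low path has a minimum one below that of the given path. *)
Lemma high_config g : LS g -> Hfun m i (seg_path g) 1 != Hmin m i (seg_path g) ->
  exists A B C mm, config A B C mm /\ g = high_path A B C.
Proof.
move=> L Hn; have [gi ge go gs] := L.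
have [||||a [b [mm [/andP[ab bN] [mi hma] mn hb hd]]]] := @ascent_from_min (brk g) (size g).
- exact: brk0.
- move=> k /andP[k0 kN] h1 h2; apply: (brk_int gs); first by rewrite k0.
  right; split; last by rewrite -brk_gt.
  by rewrite leNgt -brk_gt ?prednK // -?leNgt // ltnW.
- exact: brk_int_end.
- apply: contrapT => nex; case/eqP: Hn; apply: (Hmin_end L) => k kN.
  by rewrite leNgt; apply/negP => h; apply: nex; exists k.
pose A := take a g; pose S0 := drop a (take b g); pose C0 := drop b g.
have gE : g = A ++ S0 ++ C0.
  by rewrite /A /S0 catA -{1}(take_takel g (ltnW ab)) cat_take_drop cat_take_drop.
have eS : ends (ends 0 A) S0 = ends 0 (take b g) by rewrite brk_ends // ltnW.
have sS0 : size S0 = (b - a)%N by rewrite size_drop size_takel.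
have b0 : (0 < b)%N by exact: leq_ltn_trans ab.
have asc : all (fun u : seg => 0 < p u.1) S0.
  apply: all_part => // k /andP[ak kb]; rewrite -brk_gt //; last exact: leq_trans kb bN.
  by have [|_] := hd k; rewrite ?ak.
have totS : tot (ends 0 A) S0 = brk g b - mm.
  by rewrite -hma -(take_size S0) sS0 brk_tot ?subnKC // ltnW.
have incA : incr 0 A by move: gi; rewrite gE incr_cat => /andP[].
have hA t : mm - 1 + 1 <= hgt 0 A t.
  rewrite subrK; apply: hgt_ge => // k; rewrite size_takel ?(leq_trans (ltnW ab)) // => ka.
  by rewrite take_takel //; apply: mn; rewrite (leq_trans ka) // (leq_trans (ltnW ab)).
have totA : tot 0 A = mm - 1 + 1 by rewrite subrK -hma.
have mi' : mm - 1 \is a Num.int by rewrite rpredB ?rpred1.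
have S0n : S0 != [::] by rewrite -size_eq0 sS0 -lt0n subn_gt0.
have descS S : all (fun u : seg => 0 < p u.1) S -> descending (sseg S).
  move=> /allP h; apply/allP => _ /mapP [u uS ->] /=.
  by rewrite (pw_sdir hX) oppr_lt0 h.
have hbb : mm + 1 <= brk g b by apply: hb; rewrite leqnn.
have hC k : (k <= size C0)%N -> mm + 1 <= brk g (b + k).
  by rewrite size_drop => kC; apply: hb; clear -kC bN; lia.
have [E|NE] := eqVneq (brk g b) (mm + 1).
  exists A, (sseg S0), C0, (mm - 1); split; last first.
    rewrite /high_path ssegK [LHS]gE; congr (_ ++ (_ ++ _)); apply/esym/trim_no => _ n2.
    have bN' : (b < size g)%N by rewrite -subn_gt0 -size_drop lt0n size_eq0.
    have -> : last d0 S0 = nth d0 g b.-1.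
      rewrite -nth_last nth_part sS0 ?ltn_predL ?subn_gt0 //.
      by have -> : (a + (b - a).-1 = b.-1)%N by clear -ab; lia.
    by rewrite -nth0 nth_drop addn0; apply: dirs_neq; rewrite ?b0.
  split=> //.
  - by rewrite -size_eq0 size_map size_eq0.
  - by move: gi; rewrite {1}gE !incr_cat incr_sseg ends_sseg.
  - by rewrite -[RHS]ge [in RHS]gE !ends_cat ends_sseg.
  - exact: descS.
  - by rewrite tot_sseg totS E; ring.
  - move=> t; rewrite ends_sseg eS; apply: hgt_ge.
      by move: gi; rewrite -{1}(cat_take_drop b g) incr_cat => /andP[].
    by move=> k kC; rewrite brk_tot_end // subr_ge0 E; exact: hC.
have gt : mm + 1 < brk g b by rewrite lt_neqAle eq_sym NE.
pose S1 := drop a (take b.-1 g).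
have bN1 : (b.-1 < size g)%N by clear -b0 bN; lia.
have ab1 : (a <= b.-1)%N by clear -ab; lia.
case nE : (nth d0 g b.-1) => [y c].
have S0E : S0 = rcons S1 (y, c).
  have -> : S0 = drop a (rcons (take b.-1 g) (y, c)).
    by rewrite -nE -(take_nth d0 bN1) (prednK b0).
  rewrite -!cats1 drop_cat (size_takel (ltnW bN1)) /S1; case: ltnP => [//|h].
  have -> : a = b.-1 by apply/eqP; rewrite eqn_leq ab1 h.
  by rewrite subnn drop0 drop_oversize // (size_takel (ltnW bN1)).
have eS1 : ends (ends 0 A) S1 = ends 0 (take b.-1 g) by rewrite brk_ends.
have py : 0 < p y by have := asc; rewrite S0E all_rcons => /andP[].
have sb : brk g b = brk g b.-1 + (c - ends 0 (take b.-1 g)) * p y.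
  by rewrite -{1}(prednK b0) brkS // nE.
have [h1 _] : brk g b.-1 < mm + 1 /\ brk g b.-1 < brk g b.-1.+1.
  by apply: hd; clear -ab b0; lia.
pose e := ends 0 (take b.-1 g).
pose t1 := e + (mm + 1 - brk g b.-1) / p y.
have t1E : (t1 - e) * p y = mm + 1 - brk g b.-1.
  by rewrite /t1 addrAC subrr add0r divfK // gt_eqF.
have et1 : e < t1 by rewrite ltrDl divr_gt0 // subr_gt0.
have t1c : t1 < c.
  by rewrite -(ltrD2r (- e)) -(ltr_pM2r py) t1E; rewrite -/e in sb; lra.
have totS1 : tot (ends 0 A) S1 = brk g b.-1 - mm.
  have s1 : size S1 = (b.-1 - a)%N by rewrite size_drop size_takel // ltnW.
  by rewrite -hma -(take_size S1) s1 brk_tot // subnKC.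
have eb : ends 0 (take b g) = c by rewrite -eS S0E ends_rcons.
(* The last ascending segment is split at [t1], where H reaches mm + 1; its remainder becomes the
   head of [C] and is merged back by [trim]. *)
pose S := rcons S1 (y, t1).
exists A, (sseg S), ((y, c) :: C0), (mm - 1); split; last first.
  by rewrite /high_path ssegK trim_yes [LHS]gE S0E cat_rcons.
split=> //.
- by rewrite -size_eq0 size_map size_rcons.
- move: gi; rewrite {1}gE S0E cat_rcons !incr_cat incr_sseg ends_sseg /S -cats1 incr_cat ends_cat.
  by rewrite !incr_cons eS1 -/e => /and3P[-> -> /andP[_ h]]; rewrite et1 t1c /= h.
- by rewrite -[RHS]ge [in RHS]gE !ends_cat ends_sseg S0E ends_rcons.
- by apply: descS; move: asc; rewrite S0E !all_rcons.
- by rewrite tot_sseg /S -cats1 tot_cat totS1 eS1 -/e /= t1E; ring.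
move=> t; rewrite ends_sseg /S ends_rcons; apply: hgt_ge.
  rewrite incr_cons t1c /= -eb.
  by move: gi; rewrite -{1}(cat_take_drop b g) incr_cat => /andP[].
case=> [|k] //= kC.
have -> : tot c (take k C0) = brk g (b + k) - brk g b by rewrite -eb brk_tot_end.
have -> : (c - t1) * p y = brk g b - (mm + 1).
  by rewrite sb -/e; have := t1E; rewrite !mulrBl; lra.
by have := hC k kC; lra.
Qed.


(** * Single steps of the operators, and integrality of weights *)

Lemma Hfun_end eta : is_siLS m eta ->
  Hfun m i eta 1 = pairing (simple_coroot R i) (path_wt m eta).
Proof.
move=> /siLS_LS [g -> [gi ge _ _]]; rewrite path_wt_pvec // pairing_pvec.
by rewrite Hfun_hgt ?ge ?lexx ?ler01 //.
Qed.

(** Reflecting [B] subtracts its total height change, which is -1, times alpha_i. *)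
Lemma path_wt_high A B C mm : config A B C mm ->
  path_wt m (seg_path (high_path A B C)) =
  path_wt m (seg_path (low_path A B C)) + simple_root R i.
Proof.
move=> cf; rewrite !path_wt_pvec ?(low_incr cf) ?(high_incr cf) // (low_end cf) (high_end cf).
have [_ _ t1] := cf_times cf.
rewrite /high_path /low_path pvec_cat pvec_glue pvec_cat pvec_sseg ends_sseg.
rewrite [in RHS]pvec_cat pvec_glue ends_glue pvec_cat ends_cat (hB_after cf t1).
by rewrite scaleN1r opprK -!addrA; congr (_ + (_ + _)); rewrite addrC.
Qed.

Lemma e_step eta : is_siLS m eta -> Hmin m i eta != 0 -> exists eta',
  [/\ e_raw m i eta = Some eta', is_siLS m eta', f_raw m i eta' = Some eta,
      Hmin m i eta' = Hmin m i eta + 1 & path_wt m eta' = path_wt m eta + simple_root R i].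
Proof.
move=> /siLS_LS [g -> L] Hn; have [A [B [C [mm [cf gE]]]]] := low_config L Hn.
rewrite gE in L *; exists (seg_path (high_path A B C)); split.
- exact: e_raw_low cf.
- by apply: LS_siLS; exact: LS_low_high cf L.
- exact: f_raw_high cf.
- by rewrite (Hmin_low cf) (Hmin_high cf).
- exact: path_wt_high cf.
Qed.

Lemma f_step eta : is_siLS m eta -> Hfun m i eta 1 != Hmin m i eta -> exists eta',
  [/\ f_raw m i eta = Some eta', is_siLS m eta', e_raw m i eta' = Some eta,
      Hmin m i eta = Hmin m i eta' + 1 & path_wt m eta = path_wt m eta' + simple_root R i].
Proof.
move=> /siLS_LS [g -> L] Hn; have [A [B [C [mm [cf gE]]]]] := high_config L Hn.
rewrite gE in L *; exists (seg_path (low_path A B C)); split.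
- exact: f_raw_high cf.
- by apply: LS_siLS; exact: LS_high_low cf L.
- exact: e_raw_low cf.
- by rewrite (Hmin_low cf) (Hmin_high cf).
- exact: path_wt_high cf.
Qed.

Lemma Hmin_le0_int (eta : prepath R X) : is_siLS m eta -> Hmin m i eta <= 0 /\ Hmin m i eta \is a Num.int.
Proof.
move=> L; have [->|Hn] := eqVneq (Hmin m i eta) 0; first by rewrite rpred0.
have [g gE Lg] := siLS_LS L; rewrite gE in Hn *.
have [A [B [C [mm [cf gE']]]]] := low_config Lg Hn.
by rewrite gE' (Hmin_low cf) (cf_int cf); split=> //; have := cf_mm cf; lra.
Qed.

Lemma Hfun_Hmin (eta : prepath R X) : is_siLS m eta ->
  Hmin m i eta <= Hfun m i eta 1 /\ Hfun m i eta 1 \is a Num.int.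
Proof.
move=> /siLS_LS [g -> L]; split; last by rewrite Hfun1 // -brk_size brk_int_end.
have [->//|Hn] := eqVneq (Hfun m i (seg_path g) 1) (Hmin m i (seg_path g)).
have [A [B [C [mm [cf ->]]]]] := high_config L Hn.
rewrite (Hmin_high cf) (Hfun_high cf) ?ler01 ?lexx //.
by have := cf_A cf 1; have := cf_C cf 1; have := hB_le0 cf 1; lra.
Qed.

Definition intH (mu : hdual) : Prop := forall j, mu j 0 \is a Num.int.

Lemma intH_Paf mu : intH mu -> Paf mu.
Proof.
move=> mi.
exists (fun j => Num.floor (mu (widen_ord (leqnSn _) j) 0)), (Num.floor (mu ord_max 0)).
(* All simple coroots vanish on delta and d takes the value 1 on it, so delta is the last vector of
   the standard basis. *)
have nE : null_root R X = delta_mx ord_max 0.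
  apply/matrixP => j j'; rewrite (ord1 j') mxE andbT null_rootE.
  have [jl jE|jE] := unliftP ord_max j.
    rewrite jE (_ : lift ord_max jl = widen_ord (leqnSn _) jl); last first.
      by apply: val_inj; rewrite /= /bump leqNgt ltn_ord.
    rewrite -pairing_coroot pairing_RT (cpair_delta (HA R hX)).
    by rewrite -val_eqE /= ltn_eqF.
  by rewrite jE RT_last (delta0 (HA R hX)) eqxx.
apply/matrixP => j j'; rewrite (ord1 j') mxE summxE nE [X in _ + X]mxE.
have [jl jE|jE] := unliftP ord_max j.
  rewrite jE (_ : lift ord_max jl = widen_ord (leqnSn _) jl); last first.
    by apply: val_inj; rewrite /= /bump leqNgt ltn_ord.
  rewrite (bigD1 jl) //= big1 => [|q qj]; rewrite !mxE ?eqxx ?mulr1.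
    by rewrite -[_ == ord_max]val_eqE /= ltn_eqF // mulr0 !addr0 floorK.
  rewrite -[_ == widen_ord _ q]val_eqE /= (_ : (jl == q :> nat) = false) ?mulr0 //.
  by apply/negbTE; rewrite eq_sym.
rewrite jE big1 => [|q _]; rewrite !mxE.
  by rewrite !eqxx mulr1 add0r floorK.
by rewrite -[_ == widen_ord _ q]val_eqE /= gtn_eqF // mulr0.
Qed.

Lemma intH_RT (c : 'cV[R]_(rank X).+1) : intv c -> intH (RT c).
Proof.
move=> ci j; rewrite /RT summxE rpred_sum // => q _; rewrite !mxE rpredM //.
by case: ifP => _; rewrite ?intr_int ?rpred_nat.
Qed.

Lemma intH_word x : Waf x -> intH (x *m lam).
Proof.
case=> w ->; elim: w => [|j w IH].
  rewrite word_prod_nil mul1mx => j; rewrite /level0_weight summxE rpred_sum // => q _.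
  have [c [e [_ _ ->]]] := varpi_coef R hX q.
  by rewrite !mxE !rpredM ?rpredB ?rpredM ?rpred_nat.
rewrite word_prod_cons -mulmxA reflection_mul => q; rewrite mxE [X in _ + X]mxE [X in - X]mxE.
rewrite rpredB // rpredM //; first by rewrite pairing_coroot.
by rewrite mxE; case: ifP => _; rewrite ?intr_int ?rpred_nat.
Qed.

(** The vector form of [tot_int], with the affine root lattice in place of the integers. *)
Lemma pvec_int a u g t : incr a (u :: g) -> sorted adj (u :: g) -> ends a (u :: g) <= t ->
  exists2 c : 'cV[R]_(rank X).+1, intv c & pvec a (u :: g) t =
    ends a (u :: g) *: ((last u g).1 *m lam) - a *: (u.1 *m lam) + RT c.
Proof.
elim: g a u => [|v g IH] a [x b].
  rewrite incr_cons ends_cons => /andP[ab _] _ bt; rewrite /ends /= in bt *.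
  exists 0; first by move=> j; rewrite mxE rpred0.
  by rewrite RT0 !addr0 (min_r bt) min_r ?scalerBl // (le_trans (ltW ab)).
rewrite incr_cons ends_cons [sorted _ _]/= => /andP[ab gi] /andP[/adjP uv gs] gt.
have [c ci cE] := IH b v gi gs gt; have bt : b <= t by apply: le_trans (incr_ends gi) gt.
have [e ei eE] : exists2 e : 'cV[R]_(rank X).+1, intv e & b *: (v.1 *m lam - x *m lam) = RT e.
  by case: uv => bs _ /(achain_int hX).
exists (c - e); first by move=> j; rewrite mxE mxE rpredB.
rewrite [pvec _ _ _]/= -/(pvec b (v :: g) t) cE RTB -eE (min_r bt) min_r; last first.
  by rewrite (le_trans (ltW ab)).
rewrite [last _ _]/= scalerBl scalerBr.
move: (ends _ _ *: _) (a *: _) (b *: (x *m _)) (b *: (v.1 *m _)) (RT c) => y1 y2 y3 y4 y5.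
by apply/matrixP => q q'; rewrite !mxE; ring.
Qed.

(** As the path runs from time 0 to time 1, its weight is the image of lambda under the last
    direction, modulo the affine root lattice. *)
Lemma path_wt_Paf (eta : prepath R X) : is_siLS m eta -> Paf (path_wt m eta).
Proof.
move=> /siLS_LS [g -> L]; have [gi ge go gs] := L; have g0 := LS_size L.
rewrite path_wt_pvec // ge; case: g L gi ge go gs g0 => // u g L gi ge go gs _.
have [c ci ->] : exists2 c : 'cV[R]_(rank X).+1, intv c & pvec 0 (u :: g) 1 =
    1 *: ((last u g).1 *m lam) - 0 *: (u.1 *m lam) + RT c.
  by rewrite -{2}ge; apply: pvec_int; rewrite ?ge.
apply: intH_Paf => j; rewrite scale1r scale0r subr0 mxE rpredD //; last exact: intH_RT.
apply: intH_word; have [//] : W (last u g).1.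
by apply: (all_okseg_dir go); rewrite mem_last.
Qed.

End SegmentLists.

Lemma is_max_iter_measure (B : Type) (g : B -> option B) (M : B -> nat) :
  (forall b, M b = 0%N -> g b = None) ->
  (forall b, M b != 0%N -> exists2 b', g b = Some b' & M b = (M b').+1) ->
  forall b, is_max_iter g b (M b).
Proof.
move=> g0 gS; have st k : forall b, iter k (obind g) (Some b) <> None <-> (k <= M b)%N.
  elim: k => [|k IH] b; first by split.
  rewrite iterSr /=; have [M0|M0] := eqVneq (M b) 0%N.
    by rewrite g0 // M0; split=> // H; case: H; elim: k {IH} => //= k ->.
  by have [b' -> ->] := gS b M0; rewrite ltnS.
by move=> b; split; [apply/st | move=> k /st].
Qed.

Theorem theorem3p2p1 (R : realType) (X : twisted_type) (hX : admissible X)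
    (m : Ifin X -> nat) :
  exists (e f : 'I_(rank X).+1 -> siLS R m -> option (siLS R m))
         (eps phi : 'I_(rank X).+1 -> siLS R m -> nat),
    (forall i b, omap (@proj1_sig _ _) (e i b) = e_raw m i (proj1_sig b)) /\
    (forall i b, omap (@proj1_sig _ _) (f i b) = f_raw m i (proj1_sig b)) /\
    (forall i b, is_max_iter (e i) b (eps i b)) /\
    (forall i b, is_max_iter (f i) b (phi i b)) /\
    is_crystal (fun b => path_wt m (proj1_sig b))
      (fun i b => Some (Posz (eps i b))) (fun i b => Some (Posz (phi i b))) e f.
Proof.
have e0 i (b : siLS R m) : Hmin m i (proj1_sig b) = 0 -> e_raw m i (proj1_sig b) = None.
  by rewrite /e_raw => ->; rewrite eqxx.
have f0 i (b : siLS R m) : Hfun m i (proj1_sig b) 1 = Hmin m i (proj1_sig b) ->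
    f_raw m i (proj1_sig b) = None.
  by rewrite /f_raw => ->; rewrite eqxx.
have exE (ib : 'I_(rank X).+1 * siLS R m) :
    exists o : option (siLS R m), omap (@proj1_sig _ _) o = e_raw m ib.1 (proj1_sig ib.2).
  case: ib => i b; have [/e0 h|h] := eqVneq (Hmin m i (proj1_sig b)) 0; first by exists None.
  have [eta [-> L _ _ _]] := e_step hX (proj2_sig b) h.
  by exists (Some (exist _ eta L)).
have exF (ib : 'I_(rank X).+1 * siLS R m) :
    exists o : option (siLS R m), omap (@proj1_sig _ _) o = f_raw m ib.1 (proj1_sig ib.2).
  case: ib => i b; have [/f0 h|h] := eqVneq (Hfun m i (proj1_sig b) 1) (Hmin m i (proj1_sig b)).
    by exists None.
  have [eta [-> L _ _ _]] := f_step hX (proj2_sig b) h.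
  by exists (Some (exist _ eta L)).
(* Choice lifts the operators from prepaths to the subtype of LS paths, which they preserve by
   [e_step] and [f_step]. *)
have [ee eeE] := choice exE; have [ff ffE] := choice exF.
(* Each e_i raises min H by one until it is 0, and each f_i lowers H(1) - min H by one until it is
   0; these integers are therefore the string lengths. *)
pose eps i (b : siLS R m) := Num.truncn (- Hmin m i (proj1_sig b)).
pose phi i (b : siLS R m) := Num.truncn (Hfun m i (proj1_sig b) 1 - Hmin m i (proj1_sig b)).
pose e i b := ee (i, b); pose f i b := ff (i, b).
have eE i b : omap (@proj1_sig _ _) (e i b) = e_raw m i (proj1_sig b) := eeE (i, b).
have fE i b : omap (@proj1_sig _ _) (f i b) = f_raw m i (proj1_sig b) := ffE (i, b).
have epsE i b : (eps i b)%:R = - Hmin m i (proj1_sig b).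
  have [h1 h2] := Hmin_le0_int hX i (proj2_sig b).
  by rewrite truncnK // natrEint rpredN h2 oppr_ge0.
have phiE i b : (phi i b)%:R = Hfun m i (proj1_sig b) 1 - Hmin m i (proj1_sig b).
  have [_ h2] := Hmin_le0_int hX i (proj2_sig b).
  have [h3 h4] := Hfun_Hmin hX i (proj2_sig b).
  by rewrite truncnK // natrEint rpredB // subr_ge0.
have val_inj (b b' : siLS R m) : proj1_sig b = proj1_sig b' -> b = b'.
  by case: b b' => b hb [b' hb'] /= bb; apply: eq_exist.
have eSome i b b' : e i b = Some b' <-> e_raw m i (proj1_sig b) = Some (proj1_sig b').
  rewrite -eE; split=> [->//|]; case: (e i b) => //= c [/val_inj ->] //.
have fSome i b b' : f i b = Some b' <-> f_raw m i (proj1_sig b) = Some (proj1_sig b').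
  rewrite -fE; split=> [->//|]; case: (f i b) => //= c [/val_inj ->] //.
have estep i b b' : e i b = Some b' ->
    [/\ f i b' = Some b, Hmin m i (proj1_sig b') = Hmin m i (proj1_sig b) + 1 &
        path_wt m (proj1_sig b') = path_wt m (proj1_sig b) + simple_root R i].
  move=> /eSome h; have [/e0 z|h0] := eqVneq (Hmin m i (proj1_sig b)) 0; first by rewrite z in h.
  have [eta [h1 _ h2 h3 h4]] := e_step hX (proj2_sig b) h0.
  have etaE : eta = proj1_sig b' by move: h1; rewrite h => -[->].
  by rewrite -etaE; split=> //; apply/fSome; rewrite -etaE.
have fstep i b b' : f i b = Some b' -> e i b' = Some b.
  move=> /fSome h.
  have [/f0 z|h0] := eqVneq (Hfun m i (proj1_sig b) 1) (Hmin m i (proj1_sig b)).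
    by rewrite z in h.
  have [eta [h1 _ h2 _ _]] := f_step hX (proj2_sig b) h0.
  by apply/eSome; move: h2; have -> : eta = proj1_sig b' by move: h1; rewrite h => -[->].
have H1 i (b : siLS R m) := Hfun_end i (proj2_sig b).
have eint i b b' : e i b = Some b' -> eps i b = (eps i b').+1 /\ phi i b' = (phi i b).+1.
  move=> /estep [_ hm hw]; split; apply/eqP; rewrite -(eqr_nat R) -natr1.
    by rewrite !epsE hm; apply/eqP; ring.
  rewrite !phiE hm !H1 hw pairingDr pairing_simple.
  by rewrite (_ : cA R i i = 2) ?(ac_diag (HA R hX)) //; apply/eqP; ring.
exists e, f, eps, phi; split=> //; split=> //; split; last split.
- move=> i; apply: is_max_iter_measure => b h.
    have Hz : Hmin m i (proj1_sig b) = 0.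
      by have := epsE i b; rewrite h => /eqP; rewrite eq_sym oppr_eq0 => /eqP.
    by have := eE i b; rewrite e0 //; case: (e i b).
  case E : (e i b) => [b'|]; first by exists b' => //; have [] := eint _ _ _ E.
  have := eE i b; rewrite E /= /e_raw; case: eqP => // Hz _.
  by move: h; rewrite -(eqr_nat R) epsE Hz oppr0 eqxx.
- move=> i; apply: is_max_iter_measure => b h.
    have Hz : Hfun m i (proj1_sig b) 1 = Hmin m i (proj1_sig b).
      by have := phiE i b; rewrite h => /eqP; rewrite eq_sym subr_eq0 => /eqP.
    by have := fE i b; rewrite f0 //; case: (f i b).
  case E : (f i b) => [b'|]; first by exists b' => //; have [] := eint _ _ _ (fstep _ _ _ E).
  have := fE i b; rewrite E /= /f_raw; case: eqP => // Hz _.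
  by move: h; rewrite -(eqr_nat R) phiE Hz subrr eqxx.
split.
- by move=> b; apply: path_wt_Paf; [exact: hX | exact: proj2_sig b].
- move=> i b; rewrite -!pmulrn phiE epsE -H1; ring.
- move=> i b b' E; have [_ _ hw] := estep _ _ _ E; have [h1 h2] := eint _ _ _ E; split=> //.
    by rewrite /= h1; congr Some; lia.
  by rewrite /= h2; congr Some; lia.
- move=> i b b' /fstep E; have [_ _ hw] := estep _ _ _ E; have [h1 h2] := eint _ _ _ E; split.
  + by rewrite hw addrK.
  + by rewrite /= h1; congr Some; lia.
  + by rewrite /= h2; congr Some; lia.
- by move=> i b b'; split; [exact: fstep | case/estep].
- by [].
Qed.
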